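(* Let $\Omega\subset\mathbb{R}^2$ be a bounded domain containing $[c_1,c_2]$, whose boundary is a simple closed curve of class $\mathcal{C}^1$ which is not an ellipse with foci $c_1,c_2$, and let $h\ge0$. Let $I=[\theta_-,\theta_+]$, $\theta_0\notin I$, $k_0$ and $\mathcal{S}=\{k\in\mathbb{N}:k\ge k_0\}$ be chosen as described in the context. Then for every $n\ge1$ and every finite sequence $\sigma=(\sigma_1,\dots,\sigma_n)$ with values in $\mathcal{S}$ there is an $n$-periodic point of the billiard map at energy $h$ (the actual minimal period may divide $n$), all of whose impact parameters $\theta_1,\dots,\theta_n$ lie in $I$, and whose consecutive arcs are $s_{\sigma_i,\theta_0}^{\theta_i,\theta_{i+1}}$, $i=1,\dots,n$ (with $\theta_{n+1}=\theta_1$).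
   Context: Setting. $m_1\ge m_2>0$, $\mu_1=m_1+m_2$, $\mu_2=m_1-m_2$; the centres are normalised as $c_1=(-1,0)$, $c_2=(1,0)$; $U=\frac{m_1}{|x-c_1|}+\frac{m_2}{|x-c_2|}$. Energy-$h$ trajectories are solutions of $\ddot x=\nabla U(x)$ with $\frac12|\dot x|^2-U=h$. $\Phi(\xi,\eta)=(\cosh\xi\cos\eta,\sinh\xi\sin\eta)$ maps $\{\xi>0\}\subset\mathbb{R}\times\mathbb{R}/2\pi\mathbb{Z}$ diffeomorphically onto $\mathbb{R}^2\setminus[c_1,c_2]$. $W_1(\xi)=(\mu_1+h\cosh\xi)\cosh\xi$, $W_2(\eta)=(\mu_2+h\cos\eta)\cos\eta$, $a(\xi)=\sqrt{2(W_1(\xi)-\mu_1-h)}$, $b(\eta)=\sqrt{2(\mu_1+h-W_2(\eta))}$, $X^h_\pm=(-a(\xi),\pm b(\eta))$ on $\{\xi>0\}$. $g_h=2(h+U)(dx_1^2+dx_2^2)$, with length $\mathcal{L}_h$; $\hat X^h_\pm$ is the push-forward of $X^h_\pm$ by $\Phi$ normalised to $g_h$-norm $1$. Boundary and billiard map. $\gamma:\mathbb{S}^1\to\partial\Omega$ is a regular $\mathcal{C}^1$ counterclockwise parametrisation; $f(\theta)=\frac12(|\gamma(\theta)-c_1|+|\gamma(\theta)-c_2|)$, $\bar f=\min f$. The billiard map acts on pairs (boundary point, strictly inward velocity of energy $h$): it follows the energy-$h$ trajectory until its first return to $\partial\Omega$ (required to be at finite time and transversal) and reflects the velocity elastically.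 Arcs. For $\theta_0\in\mathbb{S}^1$, $k\in\mathbb{Z}\setminus\{0\}$, $\theta_1,\theta_2\in\mathbb{S}^1\setminus\{\theta_0\}$, $s_{k,\theta_0}^{\theta_1,\theta_2}$ is the unique minimiser of $\mathcal{L}_h$ among curves in $\mathbb{R}^2\setminus[c_1,c_2]$ from $\gamma(\theta_1)$ to $\gamma(\theta_2)$ whose concatenation with the arc of $\gamma$ from $\theta_2$ to $\theta_1$ not containing $\theta_0$ is homotopic to $\gamma^k$ in $\mathbb{R}^2\setminus[c_1,c_2]$; it is, up to reparametrisation, an energy-$h$ trajectory. $S^k_{\theta_0}(\theta_1,\theta_2)=\mathcal{L}_h(s_{k,\theta_0}^{\theta_1,\theta_2})$. Choices. (1) $\delta_0>0$ and $k_1\in\mathbb{N}$ depend only on $h,m_1,m_2,\Omega$ and are such that, whenever $0<\delta<\delta_0$, $I=[\theta_-,\theta_+]$ satisfies $( * )$: $f'(\theta_-)<0<f'(\theta_+)$, $\max_I|f'|<\delta$, $\max_I f\le\bar f+\delta$, and $\theta_0\notin I$, then for all $\theta_1,\theta_2\in I$, $|k|\ge k_1$ the arc $s_{k,\theta_0}^{\theta_1,\theta_2}$ is contained in $\overline\Omega$, meets $\partial\Omega$ only at its endpoints, and does so transversally (such constants exist). (2) Some $\delta<\delta_0$, an interval $I$ satisfying $( * )$ and a point $\theta_0\notin I$ are fixed. (3) With $\Upsilon(\theta)=-\langle\hat X^h_++\hat X^h_-,\dot\gamma(\theta)\rangle_{g_h}$ (a positive multiple of $f'(\theta)$), set $2\varepsilon=\min\{|\Upsilon(\theta_-)|,|\Upsilon(\theta_+)|\}>0$.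 (4) $k_0\ge k_1$ is an integer such that for every $k\ge k_0$: $\sup_{(\theta_1,\theta_2)\in I\times I}\left|\partial_1S^k_{\theta_0}(\theta_1,\theta_2)+\langle\hat X^h_+,\dot\gamma(\theta_1)\rangle_{g_h}\right|+\left|\partial_2S^k_{\theta_0}(\theta_1,\theta_2)+\langle\hat X^h_-,\dot\gamma(\theta_2)\rangle_{g_h}\right|\le\varepsilon/2$ (such $k_0$ exists). *)

(* Defs.v *)
From Stdlib Require Export Reals ZArith Lra Lia ClassicalEpsilon.
From Coquelicot Require Export Coquelicot.
Open Scope R_scope.

Definition pt : Type := (R * R)%type.

Definition vadd (u v : pt) : pt := (fst u + fst v, snd u + snd v).
Definition vsub (u v : pt) : pt := (fst u - fst v, snd u - snd v).
Definition vscale (a : R) (u : pt) : pt := (a * fst u, a * snd u).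
Definition dot (u v : pt) : R := fst u * fst v + snd u * snd v.
Definition det (u v : pt) : R := fst u * snd v - snd u * fst v.
Definition enorm (u : pt) : R := sqrt (dot u u).
Definition edist (x y : pt) : R := enorm (vsub x y).

(* Coquelicot's derivatives are two-sided, and so is everything built on
   [velocity]. *)
Definition velocity (x : R -> pt) (t : R) : pt :=
  (Derive (fun s => fst (x s)) t, Derive (fun s => snd (x s)) t).

Definition differentiable (x : R -> pt) (t : R) : Prop :=
  ex_derive (fun s => fst (x s)) t /\ ex_derive (fun s => snd (x s)) t.

Definition C1 (x : R -> pt) : Prop :=
  forall t, differentiable x t /\ continuous (velocity x) t.

(* C^1 on a closed interval means having a C^1 extension to the line. *)
Definition piecewise_C1 (T : R) (y : R -> pt) : Prop :=
  exists (N : nat) (s : nat -> R) (g : nat -> R -> pt),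
    s 0%nat = 0 /\ s N = T /\
    forall i, (i < N)%nat ->
      s i < s (S i) /\ C1 (g i) /\
      forall t, s i <= t <= s (S i) -> y t = g i t.

Definition closure (A : pt -> Prop) (x : pt) : Prop :=
  forall P : pt -> Prop, locally x P -> exists y, P y /\ A y.

Definition boundary (A : pt -> Prop) (x : pt) : Prop :=
  closure A x /\ closure (fun y => ~ A y) x.

Definition connected (A : pt -> Prop) : Prop :=
  forall U V : pt -> Prop,
    open U -> open V ->
    (forall x, A x -> U x \/ V x) ->
    (exists x, A x /\ U x) -> (exists x, A x /\ V x) ->
    exists x, A x /\ U x /\ V x.

Definition bounded_domain (Omega : pt -> Prop) : Prop :=
  open Omega /\ connected Omega /\ (exists x, Omega x) /\
  exists M, forall x, Omega x -> enorm x <= M.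

Definition c1 : pt := (-1, 0).
Definition c2 : pt := (1, 0).

Definition on_segment (x : pt) : Prop := -1 <= fst x <= 1 /\ snd x = 0.

Definition is_focal_ellipse (A : pt -> Prop) : Prop :=
  exists r, 1 < r /\ forall x, A x <-> edist x c1 + edist x c2 = 2 * r.

Definition U (m1 m2 : R) (x : pt) : R := m1 / edist x c1 + m2 / edist x c2.

Definition gradU (m1 m2 : R) (x : pt) : pt :=
  (Derive (fun s => U m1 m2 (s, snd x)) (fst x),
   Derive (fun s => U m1 m2 (fst x, s)) (snd x)).

Definition energy (m1 m2 : R) (x v : pt) : R := / 2 * dot v v - U m1 m2 x.

(* A collision-free energy-h solution on the closed interval [a,b].  By the
   two-sided derivatives, [x] solves the equation at the endpoints as well;
   any solution on [a,b] has such an extension past its endpoints. *)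
Definition energy_trajectory (m1 m2 h : R) (x : R -> pt) (a b : R) : Prop :=
  forall t, a <= t <= b ->
    x t <> c1 /\ x t <> c2 /\
    differentiable x t /\ differentiable (velocity x) t /\
    velocity (velocity x) t = gradU m1 m2 (x t) /\
    energy m1 m2 (x t) (velocity x t) = h.

Definition gdot (m1 m2 h : R) (x u v : pt) : R :=
  2 * (h + U m1 m2 x) * dot u v.

Definition gnorm (m1 m2 h : R) (x u : pt) : R := sqrt (gdot m1 m2 h x u u).

Definition jacobi_length (m1 m2 h T : R) (y : R -> pt) : R :=
  RInt (fun t => gnorm m1 m2 h (y t) (velocity y t)) 0 T.

Definition Phi (xi eta : R) : pt := (cosh xi * cos eta, sinh xi * sin eta).

(* The second coordinate is determined modulo 2 pi only. *)
Definition Phi_inv (x : pt) : pt :=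
  epsilon (inhabits (0, 0)) (fun p => 0 < fst p /\ Phi (fst p) (snd p) = x).

Definition dPhi (xi eta : R) (u : pt) : pt :=
  vadd (vscale (fst u) (velocity (fun s => Phi s eta) xi))
       (vscale (snd u) (velocity (fun s => Phi xi s) eta)).

Definition W1 (m1 m2 h xi : R) : R := ((m1 + m2) + h * cosh xi) * cosh xi.
Definition W2 (m1 m2 h eta : R) : R := ((m1 - m2) + h * cos eta) * cos eta.

Definition coef_a (m1 m2 h xi : R) : R :=
  sqrt (2 * (W1 m1 m2 h xi - (m1 + m2) - h)).
Definition coef_b (m1 m2 h eta : R) : R :=
  sqrt (2 * ((m1 + m2) + h - W2 m1 m2 h eta)).

(* The sign [e] is 1 for X_+ and -1 for X_-. *)
Definition X (m1 m2 h e xi eta : R) : pt :=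
  (- coef_a m1 m2 h xi, e * coef_b m1 m2 h eta).

Definition hatX (m1 m2 h e : R) (x : pt) : pt :=
  let xi := fst (Phi_inv x) in
  let eta := snd (Phi_inv x) in
  let w := dPhi xi eta (X m1 m2 h e xi eta) in
  vscale (/ gnorm m1 m2 h x w) w.


(* Points of the circle are reals modulo 2 pi. *)
Definition circle_eq (a b : R) : Prop := exists j : Z, b = a + 2 * PI * IZR j.

(* [v] at [gamma theta] is strictly inward: transversal to the boundary and
   pointing into Omega. *)
Definition inward (Omega : pt -> Prop) (gamma : R -> pt) (theta : R) (v : pt)
  : Prop :=
  det v (velocity gamma theta) <> 0 /\
  exists r, 0 < r /\
    forall t, 0 < t < r -> Omega (vadd (gamma theta) (vscale t v)).

(* Counterclockwise: Omega lies to the left of gamma. *)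
Definition boundary_parametrisation (Omega : pt -> Prop) (gamma : R -> pt)
  : Prop :=
  C1 gamma /\
  (forall theta, velocity gamma theta <> (0, 0)) /\
  (forall a b, gamma a = gamma b <-> circle_eq a b) /\
  (forall x, boundary Omega x <-> exists theta, x = gamma theta) /\
  (forall theta,
     inward Omega gamma theta
       (- snd (velocity gamma theta), fst (velocity gamma theta))).

Definition f (gamma : R -> pt) (theta : R) : R :=
  / 2 * (edist (gamma theta) c1 + edist (gamma theta) c2).

Definition fbar (gamma : R -> pt) : R :=
  real (Glb_Rbar (fun y => exists theta, y = f gamma theta)).

(* [theta_-, theta_+] stands for a proper closed arc of the circle.  Since f'
   is continuous and the arc compact, the pointwise strict bound on |f'| is the
   strict bound on its maximum. *)
Definition star (gamma : R -> pt) (delta thm thp : R) : Prop :=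
  thm < thp < thm + 2 * PI /\
  Derive (f gamma) thm < 0 < Derive (f gamma) thp /\
  (forall theta, thm <= theta <= thp ->
     Rabs (Derive (f gamma) theta) < delta) /\
  (forall theta, thm <= theta <= thp -> f gamma theta <= fbar gamma + delta).

Definition off_arc (thm thp theta0 : R) : Prop :=
  forall theta, circle_eq theta0 theta -> ~ (thm <= theta <= thp).

(* The representative of [theta] in [theta0, theta0 + 2 pi). *)
Definition lift (theta0 theta : R) : R :=
  theta - 2 * PI * IZR (Int_part ((theta - theta0) / (2 * PI))).

(* [y] on [0,T], followed by the arc of gamma from theta2 to theta1 that does
   not contain theta0, as a loop on [0,1]. *)
Definition closed_up (gamma : R -> pt) (theta0 theta1 theta2 T : R)
    (y : R -> pt) (t : R) : pt :=
  if Rle_dec t (/ 2) then y (2 * t * T)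
  else gamma (lift theta0 theta2 +
              (2 * t - 1) * (lift theta0 theta1 - lift theta0 theta2)).

Definition loop_power (gamma : R -> pt) (k : Z) (t : R) : pt :=
  gamma (2 * PI * IZR k * t).

(* Free homotopy, in the complement of the segment, of loops on [0,1]. *)
Definition loop_homotopic (l l' : R -> pt) : Prop :=
  exists H : R * R -> pt,
    continuous_on (fun p : R * R => 0 <= fst p <= 1 /\ 0 <= snd p <= 1) H /\
    (forall t, 0 <= t <= 1 -> H (0, t) = l t /\ H (1, t) = l' t) /\
    (forall s, 0 <= s <= 1 -> H (s, 0) = H (s, 1)) /\
    (forall s t, 0 <= s <= 1 -> 0 <= t <= 1 -> ~ on_segment (H (s, t))).

Definition admissible (gamma : R -> pt) (k : Z) (theta0 theta1 theta2 T : R)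
    (y : R -> pt) : Prop :=
  0 < T /\ piecewise_C1 T y /\
  (forall t, 0 <= t <= T -> ~ on_segment (y t)) /\
  y 0 = gamma theta1 /\ y T = gamma theta2 /\
  loop_homotopic (closed_up gamma theta0 theta1 theta2 T y)
                 (loop_power gamma k).

Definition reparametrisation (T' : R) (y : R -> pt) (T : R) (x : R -> pt)
  : Prop :=
  exists phi : R -> R,
    (forall t, continuous phi t) /\ phi 0 = 0 /\ phi T' = T /\
    (forall s t, 0 <= s -> s <= t -> t <= T' -> phi s <= phi t) /\
    (forall t, 0 <= t <= T' -> y t = x (phi t)).

Definition unique_minimiser (m1 m2 h : R) (gamma : R -> pt) (k : Z)
    (theta0 theta1 theta2 T : R) (x : R -> pt) : Prop :=
  admissible gamma k theta0 theta1 theta2 T x /\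
  forall T' y, admissible gamma k theta0 theta1 theta2 T' y ->
    jacobi_length m1 m2 h T x <= jacobi_length m1 m2 h T' y /\
    (jacobi_length m1 m2 h T' y = jacobi_length m1 m2 h T x ->
     reparametrisation T' y T x).

(* The minimiser is a curve up to reparametrisation; it is represented by its
   parametrisation on [0,T] as an energy-h trajectory. *)
Definition is_arc (m1 m2 h : R) (gamma : R -> pt) (k : Z)
    (theta0 theta1 theta2 T : R) (x : R -> pt) : Prop :=
  unique_minimiser m1 m2 h gamma k theta0 theta1 theta2 T x /\
  energy_trajectory m1 m2 h x 0 T.

(* [arc_time] and [arc_curve] are meaningful where [arc_exists] holds. *)
Definition arc (m1 m2 h : R) (gamma : R -> pt) (k : Z)
    (theta0 theta1 theta2 : R) : R * (R -> pt) :=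
  epsilon (inhabits (0, fun _ => (0, 0)))
    (fun s => is_arc m1 m2 h gamma k theta0 theta1 theta2 (fst s) (snd s)).

Definition arc_time m1 m2 h gamma k theta0 theta1 theta2 : R :=
  fst (arc m1 m2 h gamma k theta0 theta1 theta2).

Definition arc_curve m1 m2 h gamma k theta0 theta1 theta2 : R -> pt :=
  snd (arc m1 m2 h gamma k theta0 theta1 theta2).

Definition arc_exists m1 m2 h gamma k theta0 theta1 theta2 : Prop :=
  exists T x, is_arc m1 m2 h gamma k theta0 theta1 theta2 T x.

Definition arc_length m1 m2 h gamma k theta0 theta1 theta2 : R :=
  jacobi_length m1 m2 h
    (arc_time m1 m2 h gamma k theta0 theta1 theta2)
    (arc_curve m1 m2 h gamma k theta0 theta1 theta2).

Definition phase_point (m1 m2 h : R) (Omega : pt -> Prop) (gamma : R -> pt)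
    (p : pt * pt) : Prop :=
  exists theta, fst p = gamma theta /\ inward Omega gamma theta (snd p) /\
    energy m1 m2 (fst p) (snd p) = h.

(* Elastic reflection in a line of direction [tau]: the component along [tau]
   is kept and the normal one is reversed. *)
Definition reflect (tau w : pt) : pt :=
  vsub (vscale (2 * (dot w tau / dot tau tau)) tau) w.

(* The billiard map is partial, hence a functional relation on pairs (q, v).
   From [p], the trajectory [x] first returns to the boundary at time [T],
   transversally, and is reflected there to [p']. *)
Definition billiard_step (m1 m2 h : R) (Omega : pt -> Prop) (gamma : R -> pt)
    (p : pt * pt) (T : R) (x : R -> pt) (p' : pt * pt) : Prop :=
  0 < T /\ energy_trajectory m1 m2 h x 0 T /\
  x 0 = fst p /\ velocity x 0 = snd p /\
  (forall t, 0 < t < T -> ~ boundary Omega (x t)) /\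
  x T = fst p' /\
  exists theta, fst p' = gamma theta /\
    det (velocity x T) (velocity gamma theta) <> 0 /\
    snd p' = reflect (velocity gamma theta) (velocity x T).

Definition billiard_map (m1 m2 h : R) (Omega : pt -> Prop) (gamma : R -> pt)
    (p p' : pt * pt) : Prop :=
  phase_point m1 m2 h Omega gamma p /\ phase_point m1 m2 h Omega gamma p' /\
  exists T x, billiard_step m1 m2 h Omega gamma p T x p'.

Definition arc_inside (Omega : pt -> Prop) (gamma : R -> pt)
    (theta1 theta2 T : R) (x : R -> pt) : Prop :=
  (forall t, 0 <= t <= T -> closure Omega (x t)) /\
  (forall t, 0 < t < T -> ~ boundary Omega (x t)) /\
  det (velocity x 0) (velocity gamma theta1) <> 0 /\
  det (velocity x T) (velocity gamma theta2) <> 0.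

Definition choice1 (m1 m2 h : R) (Omega : pt -> Prop) (gamma : R -> pt)
    (delta0 : R) (k1 : nat) : Prop :=
  0 < delta0 /\ (1 <= k1)%nat /\
  forall delta thm thp theta0,
    0 < delta < delta0 -> star gamma delta thm thp ->
    off_arc thm thp theta0 ->
    forall theta1 theta2 (k : Z),
      thm <= theta1 <= thp -> thm <= theta2 <= thp ->
      (Z.of_nat k1 <= Z.abs k)%Z ->
      arc_exists m1 m2 h gamma k theta0 theta1 theta2 /\
      arc_inside Omega gamma theta1 theta2
        (arc_time m1 m2 h gamma k theta0 theta1 theta2)
        (arc_curve m1 m2 h gamma k theta0 theta1 theta2).

Definition Upsilon (m1 m2 h : R) (gamma : R -> pt) (theta : R) : R :=
  - gdot m1 m2 h (gamma theta)
      (vadd (hatX m1 m2 h 1 (gamma theta)) (hatX m1 m2 h (-1) (gamma theta)))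
      (velocity gamma theta).

Definition choice4 (m1 m2 h : R) (gamma : R -> pt) (thm thp theta0 eps : R)
    (k1 k0 : nat) : Prop :=
  (k1 <= k0)%nat /\
  forall (k : nat) theta1 theta2,
    (k0 <= k)%nat -> thm <= theta1 <= thp -> thm <= theta2 <= thp ->
    let S := arc_length m1 m2 h gamma (Z.of_nat k) theta0 in
    ex_derive (fun s => S s theta2) theta1 /\
    ex_derive (fun s => S theta1 s) theta2 /\
    Rabs (Derive (fun s => S s theta2) theta1 +
          gdot m1 m2 h (gamma theta1) (hatX m1 m2 h 1 (gamma theta1))
            (velocity gamma theta1)) +
    Rabs (Derive (fun s => S theta1 s) theta2 +
          gdot m1 m2 h (gamma theta2) (hatX m1 m2 h (-1) (gamma theta2))
            (velocity gamma theta2)) <= eps / 2.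

(* Main.v *)
Require Import Defs.
From Stdlib Require Import Psatz FunctionalExtensionality.

(* For n arcs with winding numbers sigma_1, ..., sigma_n, minimise the total
   length sum_i S^{sigma_i}(theta_i, theta_{i+1}) over the cube I^n.  By the
   choice of k_0 its derivative in each theta_i differs from Upsilon(theta_i)
   by at most eps, so it decreases when an endpoint of I is moved inwards and a
   minimiser is interior.

   Only separate differentiability of S is known, which does not suffice for
   n = 1, so criticality is obtained from curves: translating an arc x by an
   affine interpolation of the displacements of its ends gives a competitor,
   whose length is bounded (AM-GM) by its action.  This bounds S from above by
   the first-order expansion with the end velocities of x as coefficients, plus
   a quadratic error.  At an interior minimiser the incoming and outgoing
   velocities therefore have the same tangential component; by conservation of
   energy they are equal or elastic reflections of each other.

   They are not equal because Omega lies on one side of its boundary only: at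
   the point of the boundary farthest from the origin the right normal leaves
   Omega, and the right normals of a fixed small length form a path along the
   curve that never meets the boundary. *)

(** [boundary_parametrisation] speaks only of the left normal; that the right side lies outside
    [Omega] has to be proved, and this is done without the Jordan curve theorem. Near a boundary
    point all other boundary points lie in a thin double cone around the tangent. Each of the two
    complementary cones misses the boundary, so one test point decides whether it is inside or
    outside. Hence the velocities before and after an impact lie strictly on opposite sides of the
    tangent. The bound on S is only an upper bound, and this is enough: at a minimiser the increment
    is nonnegative, so a linear term plus a quadratic error is nonnegative in both directions, and
    the linear term vanishes. The room at the ends of I comes from the choice of eps: two arcs meet
    at each theta_i, each with an error of eps/2, whereas Upsilon is at least 2 eps in absolute
    value there. [hatX] passes through a chosen preimage under [Phi], so its continuity cannot be
    read off the definition. It is recovered by expressing the elliptic coordinates through the two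
    focal distances. *)

Section Continuity.
Context {T : UniformSpace}.
Implicit Types (f g : T -> R) (x : T).

Lemma continuous_Rplus f g x :
  continuous f x -> continuous g x -> continuous (fun y => f y + g y) x.
Proof. exact (continuous_plus (V := R_NormedModule) f g x). Qed.

Lemma continuous_Ropp f x :
  continuous f x -> continuous (fun y => - f y) x.
Proof. exact (continuous_opp (V := R_NormedModule) f x). Qed.

Lemma continuous_Rminus f g x :
  continuous f x -> continuous g x -> continuous (fun y => f y - g y) x.
Proof. exact (continuous_minus (V := R_NormedModule) f g x). Qed.

Lemma continuous_Rmult f g x :
  continuous f x -> continuous g x -> continuous (fun y => f y * g y) x.
Proof. exact (continuous_mult (K := R_AbsRing) f g x). Qed.

Lemma continuous_Rinv' f x :
  continuous f x -> f x <> 0 -> continuous (fun y => / f y) x.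
Proof.
intros Hf H0. apply (continuous_comp f Rinv); [exact Hf | exact (continuous_Rinv _ H0)].
Qed.

Lemma continuous_sqrt' f x :
  continuous f x -> continuous (fun y => sqrt (f y)) x.
Proof.
intros Hf. apply (continuous_comp f sqrt); [exact Hf | apply continuous_sqrt].
Qed.

Lemma continuous_Rabs' f x :
  continuous f x -> continuous (fun y => Rabs (f y)) x.
Proof.
intros Hf. apply (continuous_comp f Rabs); [exact Hf | apply continuous_Rabs].
Qed.

Lemma continuous_Rmin f g x :
  continuous f x -> continuous g x -> continuous (fun y => Rmin (f y) (g y)) x.
Proof.
intros Hf Hg.
apply continuous_ext with (fun y => / 2 * (f y + g y - Rabs (f y - g y))).
- intros y. unfold Rmin, Rabs.
  destruct (Rle_dec (f y) (g y)); destruct (Rcase_abs (f y - g y)); lra.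
- apply continuous_Rmult; [apply continuous_const|].
  apply continuous_Rminus; [now apply continuous_Rplus|].
  now apply continuous_Rabs', continuous_Rminus.
Qed.

Lemma continuous_Rmax f g x :
  continuous f x -> continuous g x -> continuous (fun y => Rmax (f y) (g y)) x.
Proof.
intros Hf Hg.
apply continuous_ext with (fun y => - Rmin (- f y) (- g y)).
- intros y. rewrite Ropp_Rmin, !Ropp_involutive. reflexivity.
- now apply continuous_Ropp, continuous_Rmin; apply continuous_Ropp.
Qed.

Lemma continuous_fst_comp {V W : UniformSpace} (F : T -> V * W) x :
  continuous F x -> continuous (fun y => fst (F y)) x.
Proof.
intros H. apply (continuous_comp F fst); [exact H|].
destruct (F x). apply continuous_fst.
Qed.

Lemma continuous_snd_comp {V W : UniformSpace} (F : T -> V * W) x :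
  continuous F x -> continuous (fun y => snd (F y)) x.
Proof.
intros H. apply (continuous_comp F snd); [exact H|].
destruct (F x). apply continuous_snd.
Qed.

Lemma continuous_pair {V W : UniformSpace} (F : T -> V) (G : T -> W) x :
  continuous F x -> continuous G x -> continuous (fun y => (F y, G y)) x.
Proof.
intros HF HG. apply filterlim_locally. intros e.
generalize (proj1 (filterlim_locally _ _) HF e) (proj1 (filterlim_locally _ _) HG e).
intros H1 H2. generalize (filter_and _ _ H1 H2). apply filter_imp.
intros y [A B]. split; assumption.
Qed.

End Continuity.

(** Descends syntactically to atoms that are hypotheses; what it leaves open are mostly the
    nonvanishing conditions produced by inverses. *)
Ltac cont :=
  repeat match goal with
  | H : continuous ?f ?x |- continuous ?f ?x => exact H
  | |- continuous (fun x => x) _ => apply continuous_id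
  | |- continuous (fun _ => ?c) _ => apply continuous_const
  | |- continuous (fun x => @?f x + @?g x) _ => apply (continuous_Rplus f g)
  | |- continuous (fun x => @?f x - @?g x) _ => apply (continuous_Rminus f g)
  | |- continuous (fun x => - @?f x) _ => apply (continuous_Ropp f)
  | |- continuous (fun x => @?f x * @?g x) _ => apply (continuous_Rmult f g)
  | |- continuous (fun x => @?f x / @?g x) _ =>
      apply (continuous_Rmult f (fun x => / g x))
  | |- continuous (fun x => / @?f x) _ => apply (continuous_Rinv' f)
  | |- continuous (fun x => Rmin (@?f x) (@?g x)) _ => apply (continuous_Rmin f g)
  | |- continuous (fun x => Rmax (@?f x) (@?g x)) _ => apply (continuous_Rmax f g)
  | |- continuous (fun x => Rabs (@?f x)) _ => apply (continuous_Rabs' f)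
  | |- continuous (fun x => sqrt (@?f x)) _ => apply (continuous_sqrt' f)
  | |- continuous (fun x => (@?f x, @?g x)) _ => apply (continuous_pair f g)
  | |- continuous (fun x => fst (@?f x)) _ => apply (continuous_fst_comp f)
  | |- continuous (fun x => snd (@?f x)) _ => apply (continuous_snd_comp f)
  end.

Lemma continuous_R_ball (f : R -> R) (x e : R) :
  continuous f x -> 0 < e ->
  exists d, 0 < d /\ forall y, Rabs (y - x) < d -> Rabs (f y - f x) < e.
Proof.
intros H He. destruct (proj1 (filterlim_locally _ _) H (mkposreal e He)) as [d Hd].
exists d. split; [apply cond_pos | exact Hd].
Qed.

(** * The two sides of the boundary curve *)

(** The l1 norm is used for local estimates because its inequalities reduce to absolute values and
    linear arithmetic, with no square roots. *)
Definition norm1 (z : pt) : R := Rabs (fst z) + Rabs (snd z).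

(** The left normal: the tangent turned by a quarter turn, with the length of the velocity. It is
    the vector that [boundary_parametrisation] requires to be inward. *)
Definition normal (gamma : R -> pt) (theta : R) : pt :=
  (- snd (velocity gamma theta), fst (velocity gamma theta)).

Lemma norm1_ge0 z : 0 <= norm1 z.
Proof. unfold norm1. generalize (Rabs_pos (fst z)) (Rabs_pos (snd z)). lra. Qed.

Lemma norm1_gt0 z : z <> (0, 0) -> 0 < norm1 z.
Proof.
intros H. unfold norm1.
generalize (Rabs_pos (fst z)) (Rabs_pos (snd z)). intros A B.
destruct (Req_dec (fst z) 0) as [E|E].
- destruct (Req_dec (snd z) 0) as [E'|E'].
  + destruct z; simpl in *; subst; easy.
  + generalize (Rabs_pos_lt _ E'). lra.
- generalize (Rabs_pos_lt _ E). lra.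
Qed.

Lemma norm1_add u v : norm1 (vadd u v) <= norm1 u + norm1 v.
Proof.
unfold norm1, vadd; simpl.
generalize (Rabs_triang (fst u) (fst v)) (Rabs_triang (snd u) (snd v)). lra.
Qed.

Lemma norm1_scale a u : norm1 (vscale a u) = Rabs a * norm1 u.
Proof. unfold norm1, vscale; simpl. rewrite !Rabs_mult. ring. Qed.

Lemma det_le_norm1 u v : Rabs (det u v) <= norm1 u * norm1 v.
Proof.
unfold det, norm1.
eapply Rle_trans; [apply Rabs_triang|]. rewrite Rabs_Ropp, !Rabs_mult.
generalize (Rabs_pos (fst u)) (Rabs_pos (snd u)) (Rabs_pos (fst v)) (Rabs_pos (snd v)). nra.
Qed.

Lemma pt_ext (u v : pt) : fst u = fst v -> snd u = snd v -> u = v.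
Proof. destruct u, v; simpl; congruence. Qed.

Lemma is_derive_velocity x t :
  differentiable x t ->
  is_derive (fun s => fst (x s)) t (fst (velocity x t)) /\
  is_derive (fun s => snd (x s)) t (snd (velocity x t)).
Proof. intros [H1 H2]. split; now apply Derive_correct. Qed.

Lemma differentiable_continuous x t : differentiable x t -> continuous x t.
Proof.
intros [H1 H2].
apply continuous_ext with (fun s => (fst (x s), snd (x s))).
- intros s. now destruct (x s).
- apply continuous_pair;
    [exact (ex_derive_continuous _ _ H1) | exact (ex_derive_continuous _ _ H2)].
Qed.

(** Strict differentiability: both ends of the increment vary near t, which plain differentiability
    at t does not allow. It follows from the mean value theorem in each coordinate, with half of e
    for each. *)
Lemma C1_strict_derivative x t e :
  C1 x -> 0 < e ->
  exists d, 0 < d /\ forall a b, Rabs (a - t) < d -> Rabs (b - t) < d ->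
    norm1 (vsub (vsub (x b) (x a)) (vscale (b - a) (velocity x t)))
      <= e * Rabs (b - a) /\
    norm1 (vsub (velocity x a) (velocity x t)) <= e.
Proof.
intros HC He.
assert (He2 : 0 < e / 2) by lra.
destruct (continuous_R_ball (fun s => fst (velocity x s)) t (e / 2)) as [d1 [Hd1 K1]];
  [apply continuous_fst_comp, HC | lra |].
destruct (continuous_R_ball (fun s => snd (velocity x s)) t (e / 2)) as [d2 [Hd2 K2]];
  [apply continuous_snd_comp, HC | lra |].
exists (Rmin d1 d2). split; [now apply Rmin_glb_lt|].
intros a b Ha Hb.
assert (M : forall (u du : R -> R), (forall s, is_derive u s (du s)) ->
   forall d, Rmin d1 d2 <= d ->
   (forall s, Rabs (s - t) < d -> Rabs (du s - du t) < e / 2) ->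
   Rabs (u b - u a - (b - a) * du t) <= e / 2 * Rabs (b - a)).
{ intros u du Hu d Hd K.
  destruct (MVT_gen u a b du) as [c [Hc E]].
  - intros s _. apply Hu.
  - intros s _. apply continuity_pt_filterlim, (ex_derive_continuous u s).
    exact (ex_intro _ (du s) (Hu s)).
  - rewrite E. replace (_ - _) with ((du c - du t) * (b - a)) by ring.
    rewrite Rabs_mult. apply Rmult_le_compat_r; [apply Rabs_pos|].
    apply Rlt_le, K.
    apply Rabs_def2 in Ha. apply Rabs_def2 in Hb.
    apply Rabs_def1; destruct Hc as [Hc1 Hc2]; revert Hc1 Hc2;
      unfold Rmin at 1, Rmax; destruct (Rle_dec a b); lra. }
split.
- generalize (M (fun s => fst (x s)) (fun s => fst (velocity x s))
    (fun s => proj1 (is_derive_velocity x s (proj1 (HC s)))) d1 (Rmin_l _ _) K1).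
  generalize (M (fun s => snd (x s)) (fun s => snd (velocity x s))
    (fun s => proj2 (is_derive_velocity x s (proj1 (HC s)))) d2 (Rmin_r _ _) K2).
  unfold norm1, vsub, vscale; simpl; lra.
- generalize (K1 a (Rlt_le_trans _ _ _ Ha (Rmin_l _ _)))
    (K2 a (Rlt_le_trans _ _ _ Ha (Rmin_r _ _))).
  unfold norm1, vsub; simpl; lra.
Qed.

Lemma vsub_velocity_decomp (x : R -> pt) a b t :
  vsub (x b) (x a) =
  vadd (vscale (b - a) (velocity x t))
       (vsub (vsub (x b) (x a)) (vscale (b - a) (velocity x t))).
Proof. apply pt_ext; unfold vadd, vsub, vscale; simpl; ring. Qed.

Lemma norm1_add_ge u v : norm1 u - norm1 v <= norm1 (vadd u v).
Proof.
unfold norm1, vadd; simpl.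
generalize (Rabs_triang_inv (fst u) (- fst v)) (Rabs_triang_inv (snd u) (- snd v)).
unfold Rminus; rewrite !Rabs_Ropp, !Ropp_involutive. lra.
Qed.

(** Since [det v v] vanishes, [det v' z] consists of [det v err] and [det (v' - v) z]. The bound on
    e makes [norm1 v] times the absolute value of s at most twice [norm1 z], so the two parts cost
    2e and e. *)
Lemma near_tangent (v v' z err : pt) (s e : R) :
  0 < norm1 v -> 0 < e <= norm1 v / 2 ->
  z = vadd (vscale s v) err -> norm1 err <= e * Rabs s ->
  norm1 (vsub v' v) <= e ->
  Rabs (det v' z) <= 3 * e * norm1 z.
Proof.
intros Hv [He He'] Hz Herr Hv'.
assert (A : det v' z = det v err + det (vsub v' v) z).
{ rewrite Hz. unfold det, vadd, vscale, vsub; simpl; ring. }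
assert (B : norm1 v * Rabs s <= 2 * norm1 z).
{ generalize (norm1_add_ge (vscale s v) err). rewrite <- Hz, norm1_scale.
  generalize (Rabs_pos s). nra. }
rewrite A. eapply Rle_trans; [apply Rabs_triang|].
generalize (det_le_norm1 v err) (det_le_norm1 (vsub v' v) z) (norm1_ge0 z). nra.
Qed.

Section Geometry.
Context {Omega : pt -> Prop} {gamma : R -> pt}.
Context (Hgamma : boundary_parametrisation Omega gamma).

Lemma gamma_C1 : C1 gamma.
Proof. apply Hgamma. Qed.

Lemma gamma_continuous theta : continuous gamma theta.
Proof. apply differentiable_continuous, gamma_C1. Qed.

Lemma gamma_regular theta : 0 < norm1 (velocity gamma theta).
Proof. apply norm1_gt0, Hgamma. Qed.

Lemma gamma_inj a b : gamma a = gamma b <-> circle_eq a b.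
Proof. apply Hgamma. Qed.

Lemma gamma_boundary theta : boundary Omega (gamma theta).
Proof. apply Hgamma. now exists theta. Qed.

Lemma gamma_period theta j : gamma (theta + 2 * PI * IZR j) = gamma theta.
Proof. symmetry. apply gamma_inj. now exists j. Qed.

Lemma circle_representative a theta :
  exists theta', circle_eq theta theta' /\ a <= theta' < a + 2 * PI.
Proof.
exists (lift a theta). generalize PI_RGT_0. intros HP.
split.
- exists (- Int_part ((theta - a) / (2 * PI)))%Z. unfold lift. rewrite opp_IZR. ring.
- unfold lift. destruct (base_Int_part ((theta - a) / (2 * PI))) as [A B].
  set (n := IZR (Int_part _)) in *.
  assert (E : theta - a = 2 * PI * ((theta - a) / (2 * PI))) by (field; apply Rgt_not_eq; lra).
  set (q := (theta - a) / (2 * PI)) in *.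
  replace (theta - 2 * PI * n) with (a + 2 * PI * (q - n)) by lra.
  split; [assert (0 <= 2 * PI * (q - n)) by (apply Rmult_le_pos; lra) |
          assert (2 * PI * (q - n) < 2 * PI * 1) by (apply Rmult_lt_compat_l; lra)]; lra.
Qed.

Lemma gamma_representative a theta :
  exists theta', gamma theta' = gamma theta /\ a <= theta' <= a + 2 * PI.
Proof.
destruct (circle_representative a theta) as [t [H1 H2]].
exists t. split; [symmetry; now apply gamma_inj | lra].
Qed.

(** Short chords of the curve are nearly tangent. If u and v give the same point, phi is moved by a
    period next to u and strict differentiability applies; otherwise the two pieces of the curve are
    too far apart for a short chord z. *)
Lemma gamma_transversal_local u v k :
  0 < k ->
  exists d : posreal, forall theta phi z,
    Rabs (theta - u) < d -> Rabs (phi - v) < d -> norm1 z < d ->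
    vadd (gamma theta) z = gamma phi ->
    Rabs (det (velocity gamma theta) z) <= k * norm1 z.
Proof.
intros Hk.
destruct (classic (gamma u = gamma v)) as [E|E].
- apply gamma_inj in E. destruct E as [j Hj]. subst v.
  assert (HN := gamma_regular u). set (N := norm1 (velocity gamma u)) in *.
  (* The third compensates for the factor 3 in [near_tangent]; the other bound is its hypothesis. *)
  set (e := Rmin (k / 3) (N / 2)).
  assert (He : 0 < e) by (apply Rmin_glb_lt; lra).
  destruct (C1_strict_derivative gamma u e gamma_C1 He) as [d [Hd H]].
  exists (mkposreal d Hd). simpl. intros theta phi z Ht Hp _ Ez.
  set (phi' := phi - 2 * PI * IZR j).
  assert (Ep : gamma phi = gamma phi').
  { rewrite <- (gamma_period phi' j). f_equal. unfold phi'; ring. }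
  assert (Hp' : Rabs (phi' - u) < d).
  { unfold phi'. replace (_ - _ - _) with (phi - (u + 2 * PI * IZR j)) by ring. exact Hp. }
  destruct (H theta phi' Ht Hp') as [H1 H2].
  assert (Hz : z = vsub (gamma phi') (gamma theta)).
  { rewrite <- Ep, <- Ez. apply pt_ext; unfold vsub, vadd; simpl; ring. }
  rewrite (vsub_velocity_decomp gamma theta phi' u) in Hz.
  eapply Rle_trans.
  + eapply (near_tangent (velocity gamma u) _ z _ _ e HN); [ | exact Hz | exact H1 | exact H2].
    split; [exact He | apply Rmin_r].
  + apply Rmult_le_compat_r; [apply norm1_ge0|].
    generalize (Rmin_l (k / 3) (N / 2)). fold e. lra.
(* Three displacements, each below D/4, would have to bridge the distance D. *)
- set (D := norm1 (vsub (gamma u) (gamma v))).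
  assert (HD : 0 < D).
  { apply norm1_gt0. intros F. apply E. generalize (f_equal fst F) (f_equal snd F).
    unfold vsub; simpl. intros. apply pt_ext; lra. }
  destruct (continuous_R_ball (fun s => norm1 (vsub (gamma s) (gamma u))) u (D / 4))
    as [d1 [Hd1 K1]]; [unfold norm1, vsub; simpl; cont; apply gamma_continuous | lra |].
  destruct (continuous_R_ball (fun s => norm1 (vsub (gamma s) (gamma v))) v (D / 4))
    as [d2 [Hd2 K2]]; [unfold norm1, vsub; simpl; cont; apply gamma_continuous | lra |].
  assert (Hd : 0 < Rmin (Rmin d1 d2) (D / 4)).
  { repeat apply Rmin_glb_lt; lra. }
  exists (mkposreal _ Hd). simpl. intros theta phi z Ht Hp Hz Ez. exfalso.
  assert (A1 := Rmin_l (Rmin d1 d2) (D / 4)). assert (A2 := Rmin_r (Rmin d1 d2) (D / 4)).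
  assert (A3 := Rmin_l d1 d2). assert (A4 := Rmin_r d1 d2).
  assert (B1 := K1 theta ltac:(lra)). assert (B2 := K2 phi ltac:(lra)).
  replace (norm1 (vsub (gamma u) (gamma u))) with 0 in B1
    by (unfold norm1, vsub; simpl; rewrite !Rminus_diag, Rabs_R0; ring).
  replace (norm1 (vsub (gamma v) (gamma v))) with 0 in B2
    by (unfold norm1, vsub; simpl; rewrite !Rminus_diag, Rabs_R0; ring).
  rewrite Rminus_0_r, Rabs_pos_eq in B1, B2 by apply norm1_ge0.
  assert (F : D <= norm1 (vsub (gamma theta) (gamma u)) + norm1 z
                   + norm1 (vsub (gamma phi) (gamma v))); [|lra].
  unfold D. rewrite <- Ez.
  replace (vsub (gamma u) (gamma v)) with
    (vadd (vadd (vsub (vadd (gamma theta) z) (gamma v)) (vscale (-1) z))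
       (vscale (-1) (vsub (gamma theta) (gamma u))))
    by (apply pt_ext; unfold vadd, vsub, vscale; simpl; ring).
  eapply Rle_trans; [apply norm1_add|].
  eapply Rle_trans; [apply Rplus_le_compat_r, norm1_add|].
  rewrite !norm1_scale, (Rabs_left (-1)) by lra. lra.
Qed.

(** Compactness of the square of parameter pairs makes the local radius uniform. The local radii
    have to be a function of the pair, hence the choice; phi is arbitrary because it can be brought
    into the window by periodicity. *)
Lemma gamma_transversal a k :
  0 < k ->
  exists r, 0 < r /\ forall theta phi z,
    a <= theta <= a + 2 * PI -> norm1 z < r ->
    vadd (gamma theta) z = gamma phi ->
    Rabs (det (velocity gamma theta) z) <= k * norm1 z.
Proof.
intros Hk.
assert (F : forall u v, {d : posreal | forall theta phi z,
    Rabs (theta - u) < d -> Rabs (phi - v) < d -> norm1 z < d ->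
    vadd (gamma theta) z = gamma phi ->
    Rabs (det (velocity gamma theta) z) <= k * norm1 z}).
{ intros u v. apply constructive_indefinite_description.
  now apply gamma_transversal_local. }
destruct (compactness_value_2d a (a + 2 * PI) a (a + 2 * PI)
            (fun u v => proj1_sig (F u v))) as [d Hd].
exists d. split; [apply cond_pos|].
intros theta phi z Ht Hz E.
destruct (gamma_representative a phi) as [phi' [Ep Hp]].
apply NNPP. intros HC. apply (Hd theta phi' Ht Hp).
intros (u & v & _ & _ & Hu & Hv & Hdd). apply HC.
apply (proj2_sig (F u v) theta phi' z Hu Hv); [lra | now rewrite Ep].
Qed.

End Geometry.

Ltac nonzero := repeat split; first [apply Rgt_not_eq; lra | apply Rlt_not_eq; lra].

(** * Paths that avoid the boundary *)

Lemma locally_inside_or_outside Omega x :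
  ~ boundary Omega x -> locally x Omega \/ locally x (fun y => ~ Omega y).
Proof.
intros H. apply not_and_or in H. destruct H as [H|H]; [right|left];
  apply not_all_ex_not in H; destruct H as [P H];
  apply imply_to_and in H; destruct H as [HP H];
  revert HP; apply filter_imp; intros y Hy.
- intros Ho. apply H. now exists y.
- apply NNPP. intros Ho. apply H. now exists y.
Qed.

(** Retraction of the line onto an interval; it extends maps known only on that interval to
    continuous maps on the whole line. *)
Definition clamp (a b t : R) : R := Rmax a (Rmin b t).

Lemma clamp_bounds a b t : a <= b -> a <= clamp a b t <= b.
Proof.
intros H. unfold clamp, Rmax, Rmin.
destruct (Rle_dec b t); destruct (Rle_dec a _); lra.
Qed.

Lemma clamp_id a b t : a <= t <= b -> clamp a b t = t.
Proof.
intros H. unfold clamp, Rmax, Rmin.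
destruct (Rle_dec b t); destruct (Rle_dec a _); lra.
Qed.

Lemma continuous_clamp {T : UniformSpace} a b (f : T -> R) x :
  continuous f x -> continuous (fun y => clamp a b (f y)) x.
Proof. intros H. unfold clamp. cont. Qed.

(** Along the path the indicator of [Omega] is locally constant, hence continuous; if it took both
    values, the intermediate value theorem would make it equal to 1/2 somewhere. *)
Lemma path_avoiding_boundary Omega (c : R -> pt) p q :
  (forall t, continuous c t) ->
  (forall t, Rmin p q <= t <= Rmax p q -> ~ boundary Omega (c t)) ->
  Omega (c p) -> Omega (c q).
Proof.
intros Hc Hb Hp. apply NNPP. intros Hq.
set (K := clamp (Rmin p q) (Rmax p q)).
assert (Hmm : Rmin p q <= Rmax p q) by apply Rminmax.
set (g := fun t => if excluded_middle_informative (Omega (c (K t))) then 1 else 0).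
assert (Kp : K p = p)
  by (apply clamp_id; split; [apply Rmin_l | apply Rmax_l]).
assert (Kq : K q = q)
  by (apply clamp_id; split; [apply Rmin_r | apply Rmax_r]).
assert (Hg : continuity g).
{ intros t. apply continuity_pt_filterlim.
  assert (HK : continuous (fun s => c (K s)) t).
  { apply (continuous_comp K c); [apply continuous_clamp, continuous_id | apply Hc]. }
  apply (filterlim_ext_loc (fun _ => g t)); [|apply filterlim_const].
  destruct (locally_inside_or_outside Omega (c (K t))) as [HL|HL];
    [apply Hb, clamp_bounds, Hmm | |];
    generalize (locally_singleton _ _ HL); intros H0;
    specialize (HK _ HL); unfold filtermap in HK;
    revert HK; apply filter_imp; intros s Hs; unfold g;
    destruct (excluded_middle_informative (Omega (c (K t))));
    destruct (excluded_middle_informative (Omega (c (K s)))); tauto. }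
destruct (IVT_gen g p q (1 / 2) Hg) as [t [_ Ht]].
- unfold g. rewrite Kp, Kq.
  destruct (excluded_middle_informative (Omega (c p))) as [_|]; [|easy].
  destruct (excluded_middle_informative (Omega (c q))) as [|_]; [easy|].
  unfold Rmin, Rmax. destruct (Rle_dec 1 0); lra.
- unfold g in Ht. destruct (excluded_middle_informative _); lra.
Qed.

Lemma open_not_boundary (Omega : pt -> Prop) x :
  open Omega -> Omega x -> ~ boundary Omega x.
Proof.
intros Ho Hx [_ H]. destruct (H Omega (Ho x Hx)) as [y [A B]]. now apply B.
Qed.

Section Sides.
Context {Omega : pt -> Prop} {gamma : R -> pt}.
Context (HOmega : bounded_domain Omega).
Context (Hseg : forall x, on_segment x -> Omega x).
Context (Hgamma : boundary_parametrisation Omega gamma).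

Lemma gamma_off_segment theta : ~ on_segment (gamma theta).
Proof.
intros H. apply (open_not_boundary Omega (gamma theta)).
- apply HOmega.
- now apply Hseg.
- apply (gamma_boundary Hgamma).
Qed.

Lemma boundary_gamma x : boundary Omega x -> exists theta, x = gamma theta.
Proof. apply Hgamma. Qed.

Lemma dot_velocity_pos theta : 0 < dot (velocity gamma theta) (velocity gamma theta).
Proof.
generalize (gamma_regular Hgamma theta). unfold norm1, dot.
destruct (velocity gamma theta) as [u v]; simpl. intros H.
destruct (Req_dec u 0) as [E|E]; [destruct (Req_dec v 0) as [E'|E']|].
- subst. rewrite Rabs_R0 in H. lra.
- generalize (Rsqr_pos_lt _ E'). unfold Rsqr. nra.
- generalize (Rsqr_pos_lt _ E). unfold Rsqr. nra.
Qed.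

(** The window begins at an arbitrary a, so that a path from a given parameter to phi stays in one
    period, where [normal_side] is uniform. *)
Lemma farthest_point :
  forall a, exists phi, a <= phi <= a + 2 * PI /\
    forall theta, dot (gamma theta) (gamma theta) <= dot (gamma phi) (gamma phi).
Proof.
intros a. generalize PI_RGT_0; intros HP.
destruct (continuity_ab_maj (fun t => dot (gamma t) (gamma t)) a (a + 2 * PI))
  as [phi [H1 H2]]; [lra | |].
- intros c _. apply continuity_pt_filterlim.
  assert (Hc := gamma_continuous Hgamma c).
  change (continuous (fun t => dot (gamma t) (gamma t)) c). unfold dot. cont.
- exists phi. split; [exact H2|]. intros theta.
  destruct (gamma_representative Hgamma a theta) as [t [E Ht]].
  rewrite <- E. now apply H1.
Qed.

Lemma farthest_point_normal phi :
  (forall theta, dot (gamma theta) (gamma theta) <= dot (gamma phi) (gamma phi)) ->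
  dot (gamma phi) (velocity gamma phi) = 0.
Proof.
intros H.
destruct (is_derive_velocity gamma phi (proj1 (gamma_C1 Hgamma phi))) as [D1 D2].
assert (D : is_derive (fun t => dot (gamma t) (gamma t)) phi
              (2 * dot (gamma phi) (velocity gamma phi))).
{ unfold dot.
  evar_last.
  - apply (is_derive_plus (V := R_NormedModule)
      (fun t => fst (gamma t) * fst (gamma t)) (fun t => snd (gamma t) * snd (gamma t))).
    + apply (is_derive_mult (K := R_AbsRing) _ _ _ _ _ D1 D1 Rmult_comm).
    + apply (is_derive_mult (K := R_AbsRing) _ _ _ _ _ D2 D2 Rmult_comm).
  - unfold plus, mult; simpl. ring. }
assert (Hd := proj1 (is_derive_Reals _ _ _) D).
assert (E : derive_pt _ phi (exist _ _ Hd) = 0).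
{ apply (deriv_maximum _ (phi - 1) (phi + 1)); try lra. intros x _ _. apply H. }
simpl in E. lra.
Qed.

(* The ray beyond a farthest boundary point does not meet the boundary, so if
   it met the bounded set Omega it would stay inside. *)
Lemma farthest_ray_outside phi t :
  (forall theta, dot (gamma theta) (gamma theta) <= dot (gamma phi) (gamma phi)) ->
  0 < t -> ~ Omega (vscale (1 + t) (gamma phi)).
Proof.
intros H Ht HO.
assert (Hpos : 0 < dot (gamma phi) (gamma phi)).
{ assert (A := gamma_off_segment phi). unfold dot.
  destruct (Req_dec (fst (gamma phi)) 0) as [E|E];
    [destruct (Req_dec (snd (gamma phi)) 0) as [E'|E']|].
  - exfalso. apply A. split; [lra | exact E'].
  - generalize (Rsqr_pos_lt _ E'). unfold Rsqr. nra.
  - generalize (Rsqr_pos_lt _ E). unfold Rsqr. nra. }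
set (d := dot (gamma phi) (gamma phi)) in *.
assert (Hd : forall s, dot (vscale s (gamma phi)) (vscale s (gamma phi)) = s * s * d).
{ intros s. unfold d, dot, vscale; simpl. ring. }
destruct HOmega as (_ & _ & _ & M & HM).
(* A parameter so far out on the ray that [q * d] exceeds [M * M]; as q is at least 1, the squared
   norm [q * q * d] then exceeds the bound valid on [Omega]. *)
set (q := 1 + t + (M * M + 1) / d).
assert (Hq : d * q = d * (1 + t) + (M * M + 1)) by (unfold q; field; nonzero).
assert (HMM : 0 < (M * M + 1) / d) by (apply Rdiv_lt_0_compat; nra).
assert (HOq : Omega (vscale q (gamma phi))).
{ apply (path_avoiding_boundary Omega (fun s => vscale s (gamma phi)) (1 + t) q);
    [ | | exact HO].
  - intros s. unfold vscale. cont.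
  - intros s Hs Hb. destruct (boundary_gamma _ Hb) as [theta E].
    assert (Hs1 : 1 < s).
    { destruct Hs as [Hs _]. rewrite Rmin_left in Hs by (unfold q; lra). lra. }
    specialize (H theta). rewrite <- E, Hd in H.
    assert (1 < s * s) by nra. nra. }
specialize (HM _ HOq). unfold enorm in HM. rewrite Hd in HM.
assert (HS : 0 <= q * q * d) by nra.
assert (F := sqrt_sqrt _ HS). assert (F' := sqrt_pos (q * q * d)).
assert (q * q * d <= M * M) by nra.
assert (1 <= q) by (unfold q; lra).
nra.
Qed.

(** A point of the normal line has [det] equal to t times the squared speed, and this is at least
    half the square of [norm1] of the velocity. With m the minimum of that norm, a slope bound of
    m/4 for short chords contradicts it uniformly in theta. *)
Lemma normal_side a :
  exists r, 0 < r /\ forall theta t, a <= theta <= a + 2 * PI -> t <> 0 ->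
    norm1 (vscale t (normal gamma theta)) < r ->
    ~ boundary Omega (vadd (gamma theta) (vscale t (normal gamma theta))).
Proof.
generalize PI_RGT_0; intros HP.
destruct (continuity_ab_min (fun t => norm1 (velocity gamma t)) a (a + 2 * PI))
  as [t0 [Hmin _]]; [lra | |].
{ intros c _. apply continuity_pt_filterlim.
  assert (Hc := proj2 (gamma_C1 Hgamma c)).
  change (continuous (fun t => norm1 (velocity gamma t)) c). unfold norm1. cont. }
assert (Hm := gamma_regular Hgamma t0). set (m := norm1 (velocity gamma t0)) in *.
destruct (gamma_transversal Hgamma a (m / 4)) as [r [Hr K]]; [lra|].
exists r. split; [exact Hr|]. intros theta t Hth Ht Hn Hb.
destruct (boundary_gamma _ Hb) as [phi E].
specialize (K theta phi _ Hth Hn E). specialize (Hmin theta Hth).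
fold m in Hmin.
rewrite norm1_scale in K.
replace (det _ _) with (t * dot (velocity gamma theta) (velocity gamma theta)) in K
  by (unfold det, vscale, normal, dot; simpl; ring).
replace (norm1 (normal gamma theta)) with (norm1 (velocity gamma theta)) in K
  by (unfold norm1, normal; simpl; rewrite Rabs_Ropp; ring).
rewrite Rabs_mult, (Rabs_pos_eq (dot _ _)) in K by (apply Rlt_le, dot_velocity_pos).
assert (HT := Rabs_pos_lt _ Ht).
revert K Hmin. unfold norm1, dot. set (u := fst _). set (v := snd _). intros K Hmin.
assert (Eu : u * u = Rabs u * Rabs u) by exact (Rsqr_abs _).
assert (Ev : v * v = Rabs v * Rabs v) by exact (Rsqr_abs _).
assert (A : Rabs t * (u * u + v * v) <= Rabs t * (m / 4 * (Rabs u + Rabs v))) by lra.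
apply Rmult_le_reg_l in A; [|exact HT].
generalize (Rabs_pos u) (Rabs_pos v). rewrite Eu, Ev in A.
set (p := Rabs u) in *. set (q := Rabs v) in *. intros Hp Hq.
assert (0 <= (p - q) * (p - q)) by apply Rle_0_sqr.
assert (0 <= (p + q) * (p + q - m)) by (apply Rmult_le_pos; lra).
nra.
Qed.

Lemma right_normal_outside theta :
  exists r, 0 < r /\ forall t, 0 < t < r ->
    ~ Omega (vadd (gamma theta) (vscale (- t) (normal gamma theta))).
Proof.
generalize PI_RGT_0; intros HP.
destruct (farthest_point theta) as [phi [Hphi Hmax]].
assert (Horth := farthest_point_normal phi Hmax).
assert (Hdot := dot_velocity_pos phi).
(* At a farthest point the position vector is orthogonal to the tangent, so it is l times the left
   normal; the sign of l tells which normal points away from the origin. *)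
set (l := dot (gamma phi) (normal gamma phi) / dot (velocity gamma phi) (velocity gamma phi)).
assert (Hl : gamma phi = vscale l (normal gamma phi)).
{ revert Hdot Horth. unfold l, vscale, normal, dot; cbn [fst snd].
  set (u := fst (velocity _ _)). set (v := snd (velocity _ _)). set (D := u * u + v * v).
  intros Hdot Horth.
  assert (Hu : u * (fst (gamma phi) * u + snd (gamma phi) * v) = 0) by (rewrite Horth; ring).
  assert (Hv : v * (fst (gamma phi) * u + snd (gamma phi) * v) = 0) by (rewrite Horth; ring).
  apply pt_ext; cbn [fst snd]; apply (Rmult_eq_reg_r D); try nonzero;
    [ replace (_ / D * _ * D) with ((fst (gamma phi) * - v + snd (gamma phi) * u) * - v)
        by (field; nonzero)
    | replace (_ / D * _ * D) with ((fst (gamma phi) * - v + snd (gamma phi) * u) * u)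
        by (field; nonzero) ]; unfold D; lra. }
clearbody l.
destruct (normal_side theta) as [r [Hr Hside]].
destruct (continuity_ab_maj (fun t => norm1 (normal gamma t)) theta (theta + 2 * PI))
  as [t0 [HN _]]; [lra | |].
{ intros c _. apply continuity_pt_filterlim.
  assert (Hc := proj2 (gamma_C1 Hgamma c)).
  change (continuous (fun t => norm1 (normal gamma t)) c). unfold norm1, normal; cbn [fst snd].
  cont. }
set (N := norm1 (normal gamma t0)) in *.
assert (HN0 : 0 <= N) by apply norm1_ge0.
(* N bounds all normals over the period, so a single t keeps the whole parallel path closer than r
   to the curve. *)
exists (r / (N + 1)). split; [apply Rdiv_lt_0_compat; lra|].
intros t [Ht0 Ht] HO.
assert (HtN : t * (N + 1) < r).
{ apply Rmult_lt_compat_r with (r := N + 1) in Ht; [|lra].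
  replace (r / (N + 1) * (N + 1)) with r in Ht by (field; nonzero). exact Ht. }
(* For positive l the inward left normal would run along the outward ray, which misses [Omega]; for
   l = 0 the boundary point would be the origin, which is on the segment. *)
assert (Hl0 : l < 0).
{ apply Rnot_le_lt. intros Hl0.
  destruct Hgamma as (_ & _ & _ & _ & Hin). destruct (Hin phi) as [_ [r' [Hr' HL]]].
  fold (normal gamma phi) in HL.
  destruct Hl0 as [Hl0|Hl0].
  - apply (farthest_ray_outside phi (r' / 2 / l) Hmax); [apply Rdiv_lt_0_compat; lra|].
    replace (vscale _ _) with (vadd (gamma phi) (vscale (r' / 2) (normal gamma phi))).
    + apply HL. lra.
    + rewrite Hl at 1 2. apply pt_ext; unfold vadd, vscale; cbn [fst snd]; field; nonzero.
  - apply (gamma_off_segment phi). rewrite Hl, <- Hl0. unfold on_segment, vscale; cbn [fst snd].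
    split; [split|]; rewrite ?Rmult_0_l; lra. }
(* The assumed inner point is carried along the curve from theta to phi, where it falls on the
   outward ray. *)
assert (HOphi : Omega (vadd (gamma phi) (vscale (- t) (normal gamma phi)))).
{ apply (path_avoiding_boundary Omega
    (fun s => vadd (gamma s) (vscale (- t) (normal gamma s))) theta phi); [ | | exact HO].
  - intros s. assert (Hc := proj2 (gamma_C1 Hgamma s)). assert (Hc' := gamma_continuous Hgamma s).
    unfold vadd, vscale, normal; cbn [fst snd]. cont.
  - rewrite Rmin_left, Rmax_right by lra. intros s Hs.
    assert (Hs' : theta <= s <= theta + 2 * PI) by lra.
    apply Hside; [exact Hs' | lra |].
    rewrite norm1_scale, Rabs_Ropp, Rabs_pos_eq by lra.
    specialize (HN s Hs'). fold N in HN. nra. }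
apply (farthest_ray_outside phi (- t / l) Hmax).
- replace (- t / l) with (t / - l) by (field; nonzero). apply Rdiv_lt_0_compat; lra.
- replace (vscale _ _) with (vadd (gamma phi) (vscale (- t) (normal gamma phi))); [exact HOphi|].
  rewrite Hl at 1 2. apply pt_ext; unfold vadd, vscale; cbn [fst snd]; field; nonzero.
Qed.

(** By [gamma_transversal] neither of the two cones meets the boundary within radius r. Such a
    truncated cone is convex, so it lies on one side, decided by the left or the right normal; the
    condition on k places these normals in the cones. *)
Lemma sides theta k :
  0 < k -> k * norm1 (velocity gamma theta) < dot (velocity gamma theta) (velocity gamma theta) ->
  exists r, 0 < r /\ forall z, norm1 z < r ->
    (k * norm1 z < det (velocity gamma theta) z -> Omega (vadd (gamma theta) z)) /\
    (k * norm1 z < - det (velocity gamma theta) z -> ~ Omega (vadd (gamma theta) z)).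
Proof.
intros Hk Hv. generalize PI_RGT_0; intros HP.
destruct (gamma_transversal Hgamma theta k Hk) as [r [Hr HT]].
exists r. split; [exact Hr|].
assert (HC : forall e z z', e = 1 \/ e = -1 -> norm1 z < r -> norm1 z' < r ->
   k * norm1 z < e * det (velocity gamma theta) z ->
   k * norm1 z' < e * det (velocity gamma theta) z' ->
   Omega (vadd (gamma theta) z) -> Omega (vadd (gamma theta) z')).
{ intros e z z' He Hz Hz' Hd Hd' HO.
  set (c := fun s => vadd (vscale (1 - s) z) (vscale s z')).
  replace z' with (c 1) by (unfold c; apply pt_ext; unfold vadd, vscale; simpl; ring).
  replace z with (c 0) in HO by (unfold c; apply pt_ext; unfold vadd, vscale; simpl; ring).
  apply (path_avoiding_boundary Omega (fun s => vadd (gamma theta) (c s)) 0 1); [ | | exact HO].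
  - intros s. unfold c, vadd, vscale; cbn [fst snd]. cont.
  - rewrite Rmin_left, Rmax_right by lra. intros s Hs Hb.
    destruct (boundary_gamma _ Hb) as [phi E].
    assert (Hn : norm1 (c s) <= (1 - s) * norm1 z + s * norm1 z').
    { eapply Rle_trans; [apply norm1_add|].
      rewrite !norm1_scale, !Rabs_pos_eq by lra. lra. }
    assert (Hcr : norm1 (c s) < r).
    { destruct (Req_dec s 0) as [->|]; nra. }
    specialize (HT theta phi (c s) ltac:(lra) Hcr E).
    assert (Ed : det (velocity gamma theta) (c s) =
        (1 - s) * det (velocity gamma theta) z + s * det (velocity gamma theta) z')
      by (unfold c, det, vadd, vscale; cbn [fst snd]; ring).
    assert (Hlt : k * norm1 (c s) < e * det (velocity gamma theta) (c s)).
    { rewrite Ed. destruct (Req_dec s 0) as [->|]; [nra|].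
      apply Rle_lt_trans with ((1 - s) * (k * norm1 z) + s * (k * norm1 z')); [nra|].
      nra. }
    assert (e * det (velocity gamma theta) (c s) <= Rabs (det (velocity gamma theta) (c s))).
    { destruct He as [-> | ->]; [rewrite Rmult_1_l; apply Rle_abs|].
      rewrite <- Rabs_Ropp. replace (-1 * _) with (- det (velocity gamma theta) (c s)) by ring.
      apply Rle_abs. }
    lra. }
assert (HN : norm1 (normal gamma theta) = norm1 (velocity gamma theta)).
{ unfold norm1, normal; cbn [fst snd]. rewrite Rabs_Ropp. ring. }
assert (HNp := gamma_regular Hgamma theta).
assert (Hsmall : forall r', 0 < r' -> exists t, 0 < t < r' /\
    t * norm1 (velocity gamma theta) < r).
{ intros r' Hr'. exists (Rmin (r' / 2) (r / norm1 (velocity gamma theta) / 2)).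
  assert (A : 0 < r / norm1 (velocity gamma theta)) by now apply Rdiv_lt_0_compat.
  assert (B := Rmin_l (r' / 2) (r / norm1 (velocity gamma theta) / 2)).
  assert (C := Rmin_r (r' / 2) (r / norm1 (velocity gamma theta) / 2)).
  split; [split; [apply Rmin_glb_lt; lra | lra]|].
  apply Rlt_le_trans with (r / norm1 (velocity gamma theta) * norm1 (velocity gamma theta));
    [apply Rmult_lt_compat_r; lra | right; field; nonzero]. }
assert (Hnorm : forall e t, e = 1 \/ e = -1 -> 0 < t ->
    k * norm1 (vscale (e * t) (normal gamma theta)) <
    e * det (velocity gamma theta) (vscale (e * t) (normal gamma theta))).
{ intros e t He Ht. rewrite norm1_scale, HN.
  replace (det _ _) with (e * t * dot (velocity gamma theta) (velocity gamma theta))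
    by (unfold det, vscale, normal, dot; cbn [fst snd]; ring).
  rewrite Rabs_mult, (Rabs_pos_eq t) by lra.
  destruct He as [-> | ->]; [rewrite Rabs_R1 | rewrite (Rabs_left (-1)) by lra]; nra. }
intros z Hz. split; intros Hd.
- destruct Hgamma as (_ & _ & _ & _ & Hin). destruct (Hin theta) as [_ [r' [Hr' HL]]].
  fold (normal gamma theta) in HL.
  destruct (Hsmall r' Hr') as [t [Ht1 Ht2]].
  apply (HC 1 (vscale (1 * t) (normal gamma theta)) z); auto; try lra.
  + rewrite norm1_scale, HN, Rmult_1_l, Rabs_pos_eq; lra.
  + apply Hnorm; [auto | lra].
  + rewrite Rmult_1_l. now apply HL.
- intros HO.
  destruct (right_normal_outside theta) as [r' [Hr' HL]].
  destruct (Hsmall r' Hr') as [t [Ht1 Ht2]].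
  apply (HL t Ht1). replace (- t) with (-1 * t) by ring.
  apply (HC (-1) z (vscale (-1 * t) (normal gamma theta))); auto; try lra.
  + rewrite norm1_scale, HN. replace (-1 * t) with (- t) by ring.
    rewrite Rabs_Ropp, Rabs_pos_eq; lra.
  + apply Hnorm; [auto | lra].
Qed.

End Sides.

(** * Directions in which trajectories enter and leave the domain *)

Lemma derive_expansion (u : R -> R) x l e :
  is_derive u x l -> 0 < e ->
  exists d, 0 < d /\ forall h, Rabs h < d -> Rabs (u (x + h) - u x - h * l) <= e * Rabs h.
Proof.
intros D He. apply is_derive_Reals in D. destruct (D e He) as [d Hd].
exists d. split; [apply cond_pos|]. intros h Hh.
destruct (Req_dec h 0) as [->|H0].
- rewrite Rplus_0_r, Rabs_R0. replace (_ - _ - _) with 0 by ring. rewrite Rabs_R0. lra.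
- specialize (Hd h H0 Hh).
  replace (u (x + h) - u x - h * l) with (((u (x + h) - u x) / h - l) * h) by (field; exact H0).
  rewrite Rabs_mult. apply Rmult_le_compat_r; [apply Rabs_pos | lra].
Qed.

Lemma differentiable_expansion y t e :
  differentiable y t -> 0 < e ->
  exists d, 0 < d /\ forall h, Rabs h < d ->
    norm1 (vsub (vsub (y (t + h)) (y t)) (vscale h (velocity y t))) <= e * Rabs h.
Proof.
intros H He. destruct (is_derive_velocity y t H) as [D1 D2].
destruct (derive_expansion _ _ _ (e / 2) D1) as [d1 [Hd1 K1]]; [lra|].
destruct (derive_expansion _ _ _ (e / 2) D2) as [d2 [Hd2 K2]]; [lra|].
exists (Rmin d1 d2). split; [now apply Rmin_glb_lt|]. intros h Hh.
specialize (K1 h (Rlt_le_trans _ _ _ Hh (Rmin_l _ _))).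
specialize (K2 h (Rlt_le_trans _ _ _ Hh (Rmin_r _ _))).
unfold norm1, vsub, vscale; cbn [fst snd]. lra.
Qed.

Section Directions.
Context {Omega : pt -> Prop} {gamma : R -> pt}.
Context (HOmega : bounded_domain Omega).
Context (Hseg : forall x, on_segment x -> Omega x).
Context (Hgamma : boundary_parametrisation Omega gamma).

(** If the sign were wrong, the curve would for small t be in the right-hand cone, which is outside
    [Omega]. The sign e treats the start of an arc (1) and, with time reversed, its end (-1)
    together. *)
Lemma entering_direction y t0 theta e :
  differentiable y t0 -> y t0 = gamma theta -> e = 1 \/ e = -1 ->
  det (velocity y t0) (velocity gamma theta) <> 0 ->
  (exists r, 0 < r /\ forall t, 0 < t < r -> Omega (y (t0 + e * t))) ->
  0 < e * det (velocity gamma theta) (velocity y t0).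
Proof.
intros Hy Hy0 He Hdet [r0 [Hr0 HO]].
set (v := velocity y t0) in *. set (w := velocity gamma theta) in *.
apply Rnot_le_lt. intros Hneg.
set (D := - (e * det w v)).
assert (HD : 0 < D).
{ assert (A : det w v <> 0).
  { intros E. apply Hdet. unfold det in *. lra. }
  unfold D. destruct He as [-> | ->]; lra. }
assert (HN : 0 < norm1 w) by apply (gamma_regular Hgamma).
assert (HV := norm1_ge0 v).
assert (Hdot : 0 < dot w w) by apply (dot_velocity_pos Hgamma).
(* The curve moves to the right at rate D. The width of the cone, through k, and the expansion
   error, through [k'], are each allowed D/4; the first entry of the minimum is what [sides]
   requires. *)
set (k := Rmin (dot w w / (2 * norm1 w)) (D / (4 * (norm1 v + 1)))).
assert (Hk : 0 < k).
{ apply Rmin_glb_lt; apply Rdiv_lt_0_compat; lra. }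
assert (Hk1 : k * norm1 w < dot w w).
{ apply Rle_lt_trans with (dot w w / (2 * norm1 w) * norm1 w).
  - apply Rmult_le_compat_r; [lra | apply Rmin_l].
  - replace (_ * _) with (dot w w / 2) by (field; nonzero). lra. }
assert (Hk2 : k * (norm1 v + 1) <= D / 4).
{ apply Rle_trans with (D / (4 * (norm1 v + 1)) * (norm1 v + 1)).
  - apply Rmult_le_compat_r; [lra | apply Rmin_r].
  - right. field; nonzero. }
set (k' := Rmin 1 (D / (4 * norm1 w))).
assert (Hk' : 0 < k').
{ apply Rmin_glb_lt; [lra | apply Rdiv_lt_0_compat; lra]. }
assert (Hk'1 : norm1 w * k' <= D / 4).
{ apply Rle_trans with (norm1 w * (D / (4 * norm1 w))).
  - apply Rmult_le_compat_l; [lra | apply Rmin_r].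
  - right. field; nonzero. }
assert (Hk'2 : k' <= 1) by apply Rmin_l.
destruct (sides HOmega Hseg Hgamma theta k Hk Hk1) as [r1 [Hr1 Hside]].
destruct (differentiable_expansion y t0 k' Hy Hk') as [d [Hd Hexp]].
set (q := Rmin (Rmin r0 d) (r1 / (norm1 v + 1))).
assert (Hq : 0 < q).
{ repeat apply Rmin_glb_lt; try assumption. apply Rdiv_lt_0_compat; lra. }
set (t := q / 2).
assert (Q1 := Rmin_l (Rmin r0 d) (r1 / (norm1 v + 1))).
assert (Q2 := Rmin_r (Rmin r0 d) (r1 / (norm1 v + 1))).
assert (Q3 := Rmin_l r0 d). assert (Q4 := Rmin_r r0 d). fold q in Q1, Q2.
assert (Hae : Rabs (e * t) = t).
{ rewrite Rabs_mult, (Rabs_pos_eq t) by (unfold t; lra).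
  destruct He as [-> | ->]; [rewrite Rabs_R1 | rewrite (Rabs_left (-1)) by lra]; ring. }
assert (Herr := Hexp (e * t) ltac:(rewrite Hae; unfold t; lra)). rewrite Hae in Herr.
set (err := vsub (vsub (y (t0 + e * t)) (y t0)) (vscale (e * t) (velocity y t0))) in *.
set (z := vsub (y (t0 + e * t)) (gamma theta)).
assert (Hz : z = vadd (vscale (e * t) v) err).
{ unfold z, err, v. rewrite Hy0. apply pt_ext; unfold vadd, vsub, vscale; cbn [fst snd]; ring. }
assert (Hnz : norm1 z <= t * (norm1 v + 1)).
{ rewrite Hz. eapply Rle_trans; [apply norm1_add|]. rewrite norm1_scale, Hae.
  assert (0 < t) by (unfold t; lra). nra. }
assert (Hsmall : norm1 z < r1).
{ eapply Rle_lt_trans; [exact Hnz|].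
  apply Rlt_le_trans with (r1 / (norm1 v + 1) * (norm1 v + 1)).
  - apply Rmult_lt_compat_r; [lra|]. unfold t; lra.
  - right. field; nonzero. }
destruct (Hside z Hsmall) as [_ HR]. apply HR.
- fold w. rewrite Hz at 2.
  replace (- det w (vadd (vscale (e * t) v) err)) with (t * D - det w err)
    by (unfold D, det, vadd, vscale; cbn [fst snd]; ring).
  assert (A := det_le_norm1 w err). apply Rabs_le_between in A.
  assert (0 < t) by (unfold t; lra).
  assert (norm1 w * norm1 err <= D / 4 * t) by nra.
  assert (k * norm1 z <= t * (D / 4)) by nra.
  nra.
- replace (vadd (gamma theta) z) with (y (t0 + e * t)).
  + apply HO. unfold t; lra.
  + unfold z. apply pt_ext; unfold vadd, vsub; cbn [fst snd]; ring.
Qed.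

Lemma inward_left theta v :
  0 < det (velocity gamma theta) v -> inward Omega gamma theta v.
Proof.
intros Hd. set (w := velocity gamma theta) in *.
split; [unfold det in *; fold w; lra|].
assert (HN : 0 < norm1 w) by apply (gamma_regular Hgamma).
assert (HV := norm1_ge0 v).
assert (Hdot : 0 < dot w w) by apply (dot_velocity_pos Hgamma).
set (k := Rmin (dot w w / (2 * norm1 w)) (det w v / (2 * (norm1 v + 1)))).
assert (Hk : 0 < k).
{ apply Rmin_glb_lt; apply Rdiv_lt_0_compat; lra. }
assert (Hk1 : k * norm1 w < dot w w).
{ apply Rle_lt_trans with (dot w w / (2 * norm1 w) * norm1 w).
  - apply Rmult_le_compat_r; [lra | apply Rmin_l].
  - replace (_ * _) with (dot w w / 2) by (field; nonzero). lra. }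
assert (Hk2 : k * (norm1 v + 1) <= det w v / 2).
{ apply Rle_trans with (det w v / (2 * (norm1 v + 1)) * (norm1 v + 1)).
  - apply Rmult_le_compat_r; [lra | apply Rmin_r].
  - right. field; nonzero. }
destruct (sides HOmega Hseg Hgamma theta k Hk Hk1) as [r [Hr Hside]].
exists (r / (norm1 v + 1)). split; [apply Rdiv_lt_0_compat; lra|].
intros t [Ht0 Ht].
assert (Hn : norm1 (vscale t v) = t * norm1 v) by (rewrite norm1_scale, Rabs_pos_eq; lra).
apply Hside.
- rewrite Hn. apply Rmult_lt_compat_r with (r := norm1 v + 1) in Ht; [|lra].
  replace (r / (norm1 v + 1) * (norm1 v + 1)) with r in Ht by (field; nonzero). lra.
- rewrite Hn. fold w. replace (det w (vscale t v)) with (t * det w v)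
    by (unfold det, vscale; cbn [fst snd]; ring).
  nra.
Qed.

Lemma inside_of_closure x : closure Omega x -> ~ boundary Omega x -> Omega x.
Proof.
intros Hc Hb. destruct (locally_inside_or_outside Omega x Hb) as [H|H].
- exact (locally_singleton _ _ H).
- destruct (Hc _ H) as [y [A B]]. contradiction.
Qed.

(** These opposite strict signs are what excludes that a trajectory passes through an impact point
    with unchanged velocity. *)
Lemma arc_inside_directions theta1 theta2 T x :
  0 < T -> differentiable x 0 -> differentiable x T ->
  x 0 = gamma theta1 -> x T = gamma theta2 ->
  arc_inside Omega gamma theta1 theta2 T x ->
  0 < det (velocity gamma theta1) (velocity x 0) /\
  det (velocity gamma theta2) (velocity x T) < 0.
Proof.
intros HT D0 DT E0 ET (Hc & Hb & H0 & H1).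
assert (HO : forall t, 0 < t < T -> Omega (x t))
  by (intros t Ht; apply inside_of_closure; [apply Hc; lra | now apply Hb]).
split.
- rewrite <- Rmult_1_l. apply entering_direction; auto.
  exists T. split; [exact HT|]. intros t Ht. apply HO. lra.
- assert (A : 0 < -1 * det (velocity gamma theta2) (velocity x T)); [|lra].
  apply entering_direction; auto.
  exists T. split; [exact HT|]. intros t Ht. apply HO. lra.
Qed.

End Directions.

(** * Minima of cyclic sums *)

Definition update (th : nat -> R) (i : nat) (t : R) (j : nat) : R :=
  if Nat.eq_dec j i then t else th j.

Lemma update_eq th i t : update th i t i = t.
Proof. unfold update. now destruct (Nat.eq_dec i i). Qed.

Lemma update_neq th i t j : j <> i -> update th i t j = th j.
Proof. intros H. unfold update. now destruct (Nat.eq_dec j i). Qed.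

Lemma update_id th i : update th i (th i) = th.
Proof.
apply functional_extensionality. intros j. unfold update.
destruct (Nat.eq_dec j i); congruence.
Qed.

Lemma update_in a b th i t :
  (forall j, a <= th j <= b) -> a <= t <= b -> forall j, a <= update th i t j <= b.
Proof. intros H Ht j. unfold update. destruct (Nat.eq_dec j i); auto. Qed.

Lemma lipschitz_continuous (m : R -> R) K :
  (forall s t, Rabs (m s - m t) <= K * Rabs (s - t)) -> forall c, continuity_pt m c.
Proof.
intros H c. apply continuity_pt_filterlim, filterlim_locally. intros e.
assert (HK : 0 < Rabs K + 1) by (generalize (Rabs_pos K); lra).
assert (He : 0 < e / (Rabs K + 1)) by (apply Rdiv_lt_0_compat; [apply cond_pos | lra]).
exists (mkposreal _ He). intros s Hs.
change (Rabs (s - c) < e / (Rabs K + 1)) in Hs. change (Rabs (m s - m c) < e).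
eapply Rle_lt_trans; [apply H|].
apply Rle_lt_trans with ((Rabs K + 1) * Rabs (s - c)).
- apply Rmult_le_compat_r; [apply Rabs_pos|]. generalize (Rle_abs K). lra.
- apply Rlt_le_trans with ((Rabs K + 1) * (e / (Rabs K + 1))).
  + now apply Rmult_lt_compat_l.
  + right. field. nonzero.
Qed.

Lemma clamp_lipschitz a b s t : a <= b -> Rabs (clamp a b s - clamp a b t) <= Rabs (s - t).
Proof.
intros H. unfold clamp, Rmax, Rmin, Rabs.
destruct (Rle_dec b s); destruct (Rle_dec b t);
  repeat destruct (Rle_dec a _); repeat destruct (Rcase_abs _); lra.
Qed.

(** Induction on the number of free coordinates; those from n on stay frozen at [th0]. The minimum
    over the first n coordinates is again a Lipschitz function of coordinate n, so it attains its
    minimum on the interval. No topology on the space of sequences is used. *)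
Lemma cube_minimum a b K (F : (nat -> R) -> R) :
  a <= b -> 0 <= K ->
  (forall th i s t, (forall j, a <= th j <= b) -> a <= s <= b -> a <= t <= b ->
     Rabs (F (update th i s) - F (update th i t)) <= K * Rabs (s - t)) ->
  forall n th0, (forall j, a <= th0 j <= b) ->
  exists th, (forall j, a <= th j <= b) /\ (forall j, (n <= j)%nat -> th j = th0 j) /\
    forall th', (forall j, a <= th' j <= b) ->
      (forall j, (n <= j)%nat -> th' j = th0 j) -> F th <= F th'.
Proof.
intros Hab HK HF. induction n as [|n IH]; intros th0 H0.
- exists th0. split; [exact H0|]. split; [easy|]. intros th' _ E. right. f_equal.
  apply functional_extensionality. intros j. symmetry. apply E. lia.
- set (Q := fun s th => (forall j, a <= th j <= b) /\
    (forall j, (n <= j)%nat -> th j = update th0 n (clamp a b s) j) /\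
    forall th', (forall j, a <= th' j <= b) ->
      (forall j, (n <= j)%nat -> th' j = update th0 n (clamp a b s) j) -> F th <= F th').
  assert (HQ : forall s, {th | Q s th}).
  { intros s. apply constructive_indefinite_description.
    apply (IH (update th0 n (clamp a b s))).
    apply update_in; [exact H0 | now apply clamp_bounds]. }
  set (A := fun s => proj1_sig (HQ s)).
  assert (HA : forall s, Q s (A s)) by (intros s; exact (proj2_sig (HQ s))).
  (* The minimiser for t with coordinate n replaced by that of s is a competitor for s. *)
  assert (Hone : forall s t, F (A s) - F (A t) <= K * Rabs (s - t)).
  { intros s t. destruct (HA s) as (_ & _ & Hs). destruct (HA t) as (Ht1 & Ht2 & _).
    assert (Hcs := clamp_bounds a b s Hab). assert (Hct := clamp_bounds a b t Hab).
    assert (E : A t = update (A t) n (clamp a b t)).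
    { rewrite <- (update_id (A t) n) at 1. f_equal.
      rewrite (Ht2 n) by lia. apply update_eq. }
    assert (L1 : F (A s) <= F (update (A t) n (clamp a b s))).
    { apply Hs.
      - now apply update_in.
      - intros j Hj. unfold update at 1 2. destruct (Nat.eq_dec j n) as [|Hn]; [reflexivity|].
        rewrite (Ht2 j Hj). now apply update_neq. }
    assert (L2 := HF (A t) n _ _ Ht1 Hcs Hct). rewrite <- E in L2.
    assert (L3 := clamp_lipschitz a b s t Hab).
    apply Rabs_le_between in L2. nra. }
  destruct (continuity_ab_min (fun s => F (A s)) a b Hab) as [s [Hmin Hs]].
  { intros c _. apply (lipschitz_continuous _ K). intros s t. apply Rabs_le.
    generalize (Hone s t) (Hone t s). rewrite (Rabs_minus_sym t s). lra. }
  destruct (HA s) as (Hs1 & Hs2 & Hs3).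
  exists (A s). split; [exact Hs1|]. split.
  + intros j Hj. rewrite Hs2 by lia. apply update_neq. lia.
  + intros th' Hth' E. specialize (Hmin (th' n) (Hth' n)).
    eapply Rle_trans; [exact Hmin|].
    destruct (HA (th' n)) as (_ & _ & H). apply H; [exact Hth'|].
    intros j Hj. rewrite (clamp_id a b (th' n)) by apply Hth'.
    unfold update. destruct (Nat.eq_dec j n) as [->|]; [reflexivity|]. apply E. lia.
Qed.

(** The indices 0, ..., m are cyclic, m being one less than the number of arcs. For m = 0 the only
    index is its own successor, so both arguments of the single term of a cyclic sum move
    together. *)
Definition next (m j : nat) : nat := if Nat.eq_dec j m then 0%nat else S j.
Definition prev (m i : nat) : nat := if Nat.eq_dec i 0 then m else Nat.pred i.

Lemma next_le m j : (j <= m)%nat -> (next m j <= m)%nat.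
Proof. unfold next. destruct (Nat.eq_dec j m); lia. Qed.

Lemma prev_le m i : (i <= m)%nat -> (prev m i <= m)%nat.
Proof. unfold prev. destruct (Nat.eq_dec i 0); lia. Qed.

Lemma prev_next m j : (j <= m)%nat -> prev m (next m j) = j.
Proof.
unfold prev, next. intros H.
destruct (Nat.eq_dec j m); [|destruct (Nat.eq_dec (S j) 0)]; try lia.
destruct (Nat.eq_dec 0 0); lia.
Qed.

Lemma next_eq_iff m i j : (i <= m)%nat -> (j <= m)%nat -> next m j = i <-> j = prev m i.
Proof.
intros Hi Hj. unfold next, prev.
destruct (Nat.eq_dec j m); destruct (Nat.eq_dec i 0); lia.
Qed.

Definition cyclic_sum (L : nat -> R -> R -> R) (m : nat) (th : nat -> R) : R :=
  sum_f_R0 (fun j => L j (th j) (th (next m j))) m.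

Lemma sum_delta (c : nat -> R) m i :
  (i <= m)%nat -> sum_f_R0 (fun j => if Nat.eq_dec j i then c j else 0) m = c i.
Proof.
induction m as [|m IH]; intros Hi; cbn [sum_f_R0].
- destruct (Nat.eq_dec 0 i); [now subst | lia].
- destruct (Nat.eq_dec (S m) i) as [E|E].
  + subst i. rewrite (sum_eq _ (fun _ => 0)).
    * rewrite sum_cte. ring.
    * intros j Hj. destruct (Nat.eq_dec j (S m)); [lia | reflexivity].
  + rewrite IH by lia. ring.
Qed.

(** Changing one coordinate alters each term in at most two arguments, which gives the crude
    Lipschitz constant [2 * K * INR (S m)] for the sum. *)
Lemma cyclic_sum_minimum L m a b K :
  a <= b -> 0 <= K ->
  (forall j x x' y, (j <= m)%nat -> a <= x <= b -> a <= x' <= b -> a <= y <= b ->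
     Rabs (L j x y - L j x' y) <= K * Rabs (x - x')) ->
  (forall j x y y', (j <= m)%nat -> a <= x <= b -> a <= y <= b -> a <= y' <= b ->
     Rabs (L j x y - L j x y') <= K * Rabs (y - y')) ->
  exists th, (forall j, a <= th j <= b) /\
    forall th', (forall j, a <= th' j <= b) -> cyclic_sum L m th <= cyclic_sum L m th'.
Proof.
intros Hab HK H1 H2.
assert (HL : forall th i s t, (forall j, a <= th j <= b) -> a <= s <= b -> a <= t <= b ->
     Rabs (cyclic_sum L m (update th i s) - cyclic_sum L m (update th i t))
     <= (2 * K * INR (S m)) * Rabs (s - t)).
{ intros th i s t Hth Hs Ht. unfold cyclic_sum.
  rewrite <- minus_sum.
  eapply Rle_trans; [apply Rsum_abs|].
  replace (2 * K * INR (S m) * Rabs (s - t)) with (2 * K * Rabs (s - t) * INR (S m)) by ring.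
  rewrite <- sum_cte. apply sum_Rle. intros j Hj.
  assert (I1 := update_in a b th i s Hth Hs). assert (I2 := update_in a b th i t Hth Ht).
  assert (Hu : forall l, Rabs (update th i s l - update th i t l) <= Rabs (s - t)).
  { intros l. unfold update. destruct (Nat.eq_dec l i); [lra|].
    rewrite Rminus_diag, Rabs_R0. apply Rabs_pos. }
  set (x := update th i s) in *. set (x' := update th i t) in *.
  replace (L j (x j) (x (next m j)) - L j (x' j) (x' (next m j))) with
    ((L j (x j) (x (next m j)) - L j (x' j) (x (next m j))) +
     (L j (x' j) (x (next m j)) - L j (x' j) (x' (next m j)))) by ring.
  eapply Rle_trans; [apply Rabs_triang|].
  generalize (H1 j _ _ _ Hj (I1 j) (I2 j) (I1 (next m j)))
    (H2 j _ _ _ Hj (I2 j) (I1 (next m j)) (I2 (next m j))) (Hu j) (Hu (next m j)).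
  nra. }
assert (HK' : 0 <= 2 * K * INR (S m)) by (generalize (pos_INR (S m)); nra).
destruct (cube_minimum a b _ _ Hab HK' HL (S m) (fun _ => a)) as [th [A [B C]]]; [intros; lra|].
exists th. split; [exact A|]. intros th' Hth'.
set (th'' := fun j => if le_lt_dec j m then th' j else a).
replace (cyclic_sum L m th') with (cyclic_sum L m th'').
- apply C.
  + intros j. unfold th''. destruct (le_lt_dec j m); [apply Hth' | lra].
  + intros j Hj. unfold th''. destruct (le_lt_dec j m); [lia | reflexivity].
- apply sum_eq. intros j Hj. unfold th''.
  destruct (le_lt_dec j m); [|lia].
  destruct (le_lt_dec (next m j) m) as [|F]; [reflexivity|].
  generalize (next_le m j Hj). lia.
Qed.

(** The cost of moving coordinate i is booked as c where i is the first argument of a term and as d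
    where it is the second. Summation keeps one value of each; for m = 0 the same term carries
    both. *)
Lemma cyclic_minimum_variation L m th (c d : nat -> R) i t a b :
  (forall j, a <= th j <= b) ->
  (forall th', (forall j, a <= th' j <= b) -> cyclic_sum L m th <= cyclic_sum L m th') ->
  (i <= m)%nat -> a <= t <= b ->
  (forall j, (j <= m)%nat ->
     L j (update th i t j) (update th i t (next m j)) <=
     L j (th j) (th (next m j)) + (if Nat.eq_dec j i then c j else 0)
       + (if Nat.eq_dec (next m j) i then d j else 0)) ->
  0 <= c i + d (prev m i).
Proof.
intros Hth Hmin Hi Ht H.
assert (A := Hmin _ (update_in a b th i t Hth Ht)).
assert (B : cyclic_sum L m (update th i t) <=
  cyclic_sum L m th + c i + d (prev m i)); [|lra].
unfold cyclic_sum. rewrite <- (sum_delta c m i Hi), <- (sum_delta d m (prev m i) (prev_le m i Hi)).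
rewrite <- !sum_plus. apply sum_Rle. intros j Hj.
eapply Rle_trans; [exact (H j Hj)|].
apply Rplus_le_compat_l. right.
destruct (Nat.eq_dec (next m j) i) as [E|E];
  destruct (Nat.eq_dec j (prev m i)) as [E'|E']; try reflexivity;
  apply next_eq_iff in E || apply <- next_eq_iff in E'; auto; lia || contradiction.
Qed.

(** * Elliptic coordinates *)

Lemma edist_ge0 x y : 0 <= edist x y.
Proof. apply sqrt_pos. Qed.

Lemma edist_sqr x y : edist x y * edist x y = dot (vsub x y) (vsub x y).
Proof. unfold edist, enorm. apply sqrt_sqrt. unfold dot. nra. Qed.

Lemma continuous_edist {T : UniformSpace} (F : T -> pt) y t :
  continuous F t -> continuous (fun s => edist (F s) y) t.
Proof.
intros H. unfold edist, enorm, dot, vsub; cbn [fst snd]. cont.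
Qed.

Lemma edist_gt0 x y : x <> y -> 0 < edist x y.
Proof.
intros H. destruct (edist_ge0 x y) as [A|A]; [exact A|].
exfalso. apply H. generalize (edist_sqr x y). rewrite <- A.
unfold dot, vsub; cbn [fst snd]. intros E.
destruct (Rplus_sqr_eq_0 (fst x - fst y) (snd x - snd y)) as [E1 E2];
  [unfold Rsqr; lra | apply pt_ext; lra].
Qed.

Lemma off_segment_neq x : ~ on_segment x -> x <> c1 /\ x <> c2.
Proof.
intros H. split; intros ->; apply H; unfold on_segment, c1, c2; cbn [fst snd]; lra.
Qed.

(** The horizontal parts bound the focal distances below by x1 + 1 and 1 - x1; a sum of at most 2
    forces equality in both, so the vertical part vanishes. *)
Lemma off_segment_foci x : ~ on_segment x -> 2 < edist x c1 + edist x c2.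
Proof.
intros H.
generalize (edist_ge0 x c1) (edist_ge0 x c2) (edist_sqr x c1) (edist_sqr x c2).
set (r1 := edist x c1). set (r2 := edist x c2).
unfold dot, vsub, c1, c2; cbn [fst snd].
set (x1 := fst x). set (x2 := snd x). intros P1 P2 E1 E2.
apply Rnot_le_lt. intros Hle.
assert (x2 = 0 /\ -1 <= x1 <= 1); [|apply H; unfold on_segment; fold x1 x2; tauto].
assert (r1 >= x1 + 1) by nra. assert (r2 >= 1 - x1) by nra.
assert (F1 : r1 = x1 + 1) by lra. assert (F2 : r2 = 1 - x1) by lra.
rewrite F1 in E1. split; [nra | lra].
Qed.

Lemma on_segment_foci x : on_segment x -> edist x c1 + edist x c2 = 2.
Proof.
intros [H1 H2].
assert (A : edist x c1 = fst x + 1).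
{ unfold edist, enorm. replace (dot _ _) with ((fst x + 1) * (fst x + 1))
    by (unfold dot, vsub, c1; cbn [fst snd]; rewrite H2; ring).
  apply sqrt_square. lra. }
assert (B : edist x c2 = 1 - fst x).
{ unfold edist, enorm. replace (dot _ _) with ((1 - fst x) * (1 - fst x))
    by (unfold dot, vsub, c2; cbn [fst snd]; rewrite H2; ring).
  apply sqrt_square. lra. }
lra.
Qed.

Lemma foci_difference x : -2 <= edist x c1 - edist x c2 <= 2.
Proof.
generalize (edist_ge0 x c1) (edist_ge0 x c2) (edist_sqr x c1) (edist_sqr x c2).
set (r1 := edist x c1). set (r2 := edist x c2).
unfold dot, vsub, c1, c2; cbn [fst snd].
set (x1 := fst x). set (x2 := snd x). intros P1 P2 E1 E2.
split; apply Rnot_lt_le; intros Hlt.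
- assert (r1 < - (x1 + 1)) by nra. nra.
- assert (r2 < x1 - 1) by nra. nra.
Qed.

(* cosh xi, sinh xi, cos eta and sin eta at the point x = Phi xi eta are
   [ech x], [esh x], [ecs x] and [esn x]; they avoid the choice in [Phi_inv]. *)
Definition ech (x : pt) : R := (edist x c1 + edist x c2) / 2.
Definition ecs (x : pt) : R := (edist x c1 - edist x c2) / 2.
Definition esh (x : pt) : R := sqrt (ech x * ech x - 1).
Definition esn (x : pt) : R := snd x / esh x.

(** The squared focal distances differ by four times the first coordinate. *)
Lemma elliptic_fst x : ech x * ecs x = fst x.
Proof.
unfold ech, ecs. generalize (edist_sqr x c1) (edist_sqr x c2).
unfold dot, vsub, c1, c2; cbn [fst snd]. intros. nra.
Qed.

(** The half-sum of the squared focal distances is both [ech] squared plus [ecs] squared and 1 plus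
    the squared norm of x. *)
Lemma elliptic_snd x : (ech x * ech x - 1) * (1 - ecs x * ecs x) = snd x * snd x.
Proof.
replace (_ * _) with (ech x * ech x + ecs x * ecs x - 1 - (ech x * ecs x) * (ech x * ecs x))
  by ring.
rewrite elliptic_fst. unfold ech, ecs.
generalize (edist_sqr x c1) (edist_sqr x c2).
unfold dot, vsub, c1, c2; cbn [fst snd]. intros. nra.
Qed.

Section OffSegment.
Context (x : pt) (Hx : ~ on_segment x).

Lemma ech_gt1 : 1 < ech x.
Proof. unfold ech. generalize (off_segment_foci x Hx). lra. Qed.

Lemma esh_sqr : esh x * esh x = ech x * ech x - 1.
Proof. apply sqrt_sqrt. generalize ech_gt1. nra. Qed.

Lemma esh_gt0 : 0 < esh x.
Proof. apply sqrt_lt_R0. generalize ech_gt1. nra. Qed.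

Lemma ecs_bounds : -1 <= ecs x <= 1.
Proof. unfold ecs. generalize (foci_difference x). lra. Qed.

Lemma esh_esn : esh x * esn x = snd x.
Proof. unfold esn. field. apply Rgt_not_eq, esh_gt0. Qed.

Lemma esn_sqr : esn x * esn x = 1 - ecs x * ecs x.
Proof.
assert (H := esh_gt0). apply (Rmult_eq_reg_l (esh x * esh x)); [|nra].
rewrite esh_sqr at 2. rewrite elliptic_snd, <- esh_esn. ring.
Qed.

End OffSegment.

Lemma cosh_sqr t : cosh t * cosh t = 1 + sinh t * sinh t.
Proof.
unfold cosh, sinh. assert (E : exp t * exp (- t) = 1)
  by (rewrite <- exp_plus, Rplus_opp_r; apply exp_0). nra.
Qed.

Lemma cosh_ge1 t : 1 <= cosh t.
Proof.
generalize (cosh_sqr t). assert (0 < cosh t).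
{ unfold cosh. generalize (exp_pos t) (exp_pos (- t)). lra. }
nra.
Qed.

(** Needed to know that the choice in [Phi_inv] succeeds. The arccosine determines eta up to sign,
    and the sign is that of [esn]. *)
Lemma Phi_surjective x : ~ on_segment x -> exists p, 0 < fst p /\ Phi (fst p) (snd p) = x.
Proof.
intros Hx. assert (Hs := esh_gt0 x Hx). assert (Hs2 := esh_sqr x Hx).
assert (Hc := ech_gt1 x Hx). assert (Hc' := ecs_bounds x).
set (xi := arcsinh (esh x)).
assert (Esh : sinh xi = esh x) by apply sinh_arcsinh.
assert (Ech : cosh xi = ech x).
{ assert (A := cosh_sqr xi). rewrite Esh in A. assert (B := cosh_ge1 xi). nra. }
assert (Hxi : 0 < xi) by (rewrite <- arcsinh_0; now apply arcsinh_lt).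
assert (Hsin : sin (acos (ecs x)) = Rabs (esn x)).
{ rewrite sin_acos by exact Hc'. rewrite <- sqrt_Rsqr_abs. f_equal.
  unfold Rsqr. rewrite (esn_sqr x Hx). ring. }
destruct (Rle_dec 0 (esn x)) as [Hn|Hn].
- exists (xi, acos (ecs x)). cbn [fst snd]. split; [exact Hxi|].
  unfold Phi. rewrite Ech, Esh, cos_acos, Hsin, Rabs_pos_eq by assumption.
  apply pt_ext; cbn [fst snd]; [apply elliptic_fst | now apply esh_esn].
- exists (xi, - acos (ecs x)). cbn [fst snd]. split; [exact Hxi|].
  unfold Phi. rewrite cos_neg, sin_neg, Ech, Esh, cos_acos, Hsin, Rabs_left by (assumption || lra).
  rewrite Ropp_involutive.
  apply pt_ext; cbn [fst snd]; [apply elliptic_fst | now apply esh_esn].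
Qed.

Lemma Phi_foci xi eta :
  edist (Phi xi eta) c1 = cosh xi + cos eta /\ edist (Phi xi eta) c2 = cosh xi - cos eta.
Proof.
assert (A := cosh_sqr xi). assert (B := cosh_ge1 xi).
assert (C := sin2_cos2 eta). unfold Rsqr in C. assert (D := COS_bound eta).
unfold edist, enorm. split.
- replace (dot _ _) with ((cosh xi + cos eta) * (cosh xi + cos eta)).
  + apply sqrt_square. lra.
  + unfold dot, vsub, Phi, c1; cbn [fst snd].
    replace ((sinh xi * sin eta - 0) * (sinh xi * sin eta - 0)) with
      ((sinh xi * sinh xi) * (sin eta * sin eta)) by ring.
    replace (sin eta * sin eta) with (1 - cos eta * cos eta) by lra.
    replace (sinh xi * sinh xi) with (cosh xi * cosh xi - 1) by lra. ring.
- replace (dot _ _) with ((cosh xi - cos eta) * (cosh xi - cos eta)).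
  + apply sqrt_square. lra.
  + unfold dot, vsub, Phi, c2; cbn [fst snd].
    replace ((sinh xi * sin eta - 0) * (sinh xi * sin eta - 0)) with
      ((sinh xi * sinh xi) * (sin eta * sin eta)) by ring.
    replace (sin eta * sin eta) with (1 - cos eta * cos eta) by lra.
    replace (sinh xi * sinh xi) with (cosh xi * cosh xi - 1) by lra. ring.
Qed.

(** Whichever preimage is chosen, the focal distances fix cosh xi and cos eta; positivity of xi then
    fixes sinh xi, and the second coordinate fixes sin eta. *)
Lemma Phi_inv_spec x : ~ on_segment x ->
  let xi := fst (Phi_inv x) in let eta := snd (Phi_inv x) in
  cosh xi = ech x /\ sinh xi = esh x /\ cos eta = ecs x /\ sin eta = esn x.
Proof.
intros Hx.
destruct (epsilon_spec (inhabits (0, 0)) _ (Phi_surjective x Hx)) as [Hpos E].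
fold (Phi_inv x) in Hpos, E. cbv zeta.
set (xi := fst (Phi_inv x)) in *. set (eta := snd (Phi_inv x)) in *.
assert (F := Phi_foci xi eta). rewrite E in F. destruct F as [F1 F2].
assert (Ech : cosh xi = ech x) by (unfold ech; lra).
assert (Ecs : cos eta = ecs x) by (unfold ecs; lra).
assert (Hsh : 0 < sinh xi).
{ rewrite <- sinh_0. now apply sinh_lt. }
assert (Esh : sinh xi = esh x).
{ assert (A := cosh_sqr xi). rewrite Ech in A. assert (B := esh_sqr x Hx).
  assert (C := esh_gt0 x Hx). nra. }
repeat split; try assumption.
apply (Rmult_eq_reg_l (esh x)); [|apply Rgt_not_eq, esh_gt0, Hx].
rewrite (esh_esn x Hx), <- Esh. now rewrite <- E.
Qed.

Lemma dPhi_eq xi eta u :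
  dPhi xi eta u =
  vadd (vscale (fst u) (sinh xi * cos eta, cosh xi * sin eta))
       (vscale (snd u) (cosh xi * - sin eta, sinh xi * cos eta)).
Proof.
assert (H1 : forall k, Derive (fun s => cosh s * k) xi = sinh xi * k).
{ intros k. rewrite Derive_scal_l. f_equal.
  apply is_derive_unique, is_derive_Reals, derivable_pt_lim_cosh. }
assert (H2 : forall k, Derive (fun s => sinh s * k) xi = cosh xi * k).
{ intros k. rewrite Derive_scal_l. f_equal.
  apply is_derive_unique, is_derive_Reals, derivable_pt_lim_sinh. }
assert (H3 : forall k, Derive (fun s => k * cos s) eta = k * - sin eta).
{ intros k. rewrite Derive_scal. f_equal.
  apply is_derive_unique, is_derive_Reals, derivable_pt_lim_cos. }
assert (H4 : forall k, Derive (fun s => k * sin s) eta = k * cos eta).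
{ intros k. rewrite Derive_scal. f_equal.
  apply is_derive_unique, is_derive_Reals, derivable_pt_lim_sin. }
unfold dPhi, velocity, Phi; cbn [fst snd]. now rewrite H1, H2, H3, H4.
Qed.

(** * The fields [hatX] and the function [Upsilon] in terms of focal distances *)

Section Pairing.
Context (m1 m2 h : R) (Hm : 0 < m2 <= m1) (Hh : 0 <= h).

Lemma U_gt0 x : ~ on_segment x -> 0 < U m1 m2 x.
Proof.
intros Hx. destruct (off_segment_neq x Hx) as [H1 H2].
unfold U. apply Rplus_lt_0_compat; apply Rdiv_lt_0_compat;
  try (apply edist_gt0; assumption); lra.
Qed.

Definition ea (x : pt) : R := sqrt (2 * (((m1 + m2) + h * ech x) * ech x - (m1 + m2) - h)).
Definition eb (x : pt) : R := sqrt (2 * ((m1 + m2) + h - ((m1 - m2) + h * ecs x) * ecs x)).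

(** The push-forward of X before normalisation: the two vectors are the columns of the differential
    of [Phi]. *)
Definition pushX (e : R) (x : pt) : pt :=
  vadd (vscale (- ea x) (esh x * ecs x, ech x * esn x))
       (vscale (e * eb x) (ech x * - esn x, esh x * ecs x)).

Lemma hatX_explicit e x : ~ on_segment x ->
  hatX m1 m2 h e x = vscale (/ gnorm m1 m2 h x (pushX e x)) (pushX e x).
Proof.
intros Hx. destruct (Phi_inv_spec x Hx) as (E1 & E2 & E3 & E4).
unfold hatX. rewrite dPhi_eq, E1, E2, E3, E4.
unfold X, coef_a, coef_b, W1, W2. rewrite E1, E3. reflexivity.
Qed.

Lemma ea_gt0 x : ~ on_segment x -> 0 < ea x.
Proof.
intros Hx. apply sqrt_lt_R0. assert (H := ech_gt1 x Hx).
replace (2 * _) with (2 * ((m1 + m2) * (ech x - 1) + h * ((ech x - 1) * (ech x + 1)))) by ring.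
assert (0 < (m1 + m2) * (ech x - 1)) by (apply Rmult_lt_0_compat; lra).
assert (0 <= h * ((ech x - 1) * (ech x + 1))) by (repeat apply Rmult_le_pos; lra).
lra.
Qed.

Lemma elliptic_gap x : ~ on_segment x -> 0 < ech x * ech x - ecs x * ecs x.
Proof. intros Hx. generalize (ech_gt1 x Hx) (ecs_bounds x). nra. Qed.

(** [Phi] is conformal: its columns are orthogonal with the same squared length, the product of the
    focal distances. The norm is therefore the same for both signs e. *)
Lemma dot_pushX e x : ~ on_segment x -> e * e = 1 ->
  dot (pushX e x) (pushX e x) =
  (ea x * ea x + eb x * eb x) * (ech x * ech x - ecs x * ecs x).
Proof.
intros Hx He.
transitivity ((ea x * ea x + (e * e) * (eb x * eb x)) *
  ((esh x * esh x) * (ecs x * ecs x) + (ech x * ech x) * (esn x * esn x))).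
- unfold dot, pushX, vadd, vscale; cbn [fst snd]. ring.
- rewrite He, (esh_sqr x Hx), (esn_sqr x Hx). ring.
Qed.

Definition push_norm (x : pt) : R :=
  sqrt (2 * (h + U m1 m2 x) *
    ((ea x * ea x + eb x * eb x) * (ech x * ech x - ecs x * ecs x))).

Lemma gnorm_pushX e x : ~ on_segment x -> e * e = 1 ->
  gnorm m1 m2 h x (pushX e x) = push_norm x.
Proof. intros Hx He. unfold gnorm, gdot. now rewrite dot_pushX. Qed.

Lemma push_norm_gt0 x : ~ on_segment x -> 0 < push_norm x.
Proof.
intros Hx. apply sqrt_lt_R0.
assert (H1 := U_gt0 x Hx). assert (H2 := ea_gt0 x Hx). assert (H3 := elliptic_gap x Hx).
apply Rmult_lt_0_compat; [lra|]. apply Rmult_lt_0_compat; [nra | exact H3].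
Qed.

Lemma pairing_explicit e x v : ~ on_segment x -> e * e = 1 ->
  gdot m1 m2 h x (hatX m1 m2 h e x) v =
  2 * (h + U m1 m2 x) * (/ push_norm x * dot (pushX e x) v).
Proof.
intros Hx He. rewrite (hatX_explicit e x Hx), (gnorm_pushX e x Hx He).
unfold gdot. f_equal. unfold dot, vscale; cbn [fst snd]. ring.
Qed.

Lemma continuous_U {T : UniformSpace} (F : T -> pt) t :
  continuous F t -> F t <> c1 -> F t <> c2 -> continuous (fun s => U m1 m2 (F s)) t.
Proof.
intros HF H1 H2. unfold U.
assert (A1 := continuous_edist F c1 t HF). assert (A2 := continuous_edist F c2 t HF).
cont; apply Rgt_not_eq, edist_gt0; assumption.
Qed.

(** The angle in [Phi_inv] is chosen separately at each point, so continuity is proved for the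
    choice-free expression. *)
Lemma continuous_pairing (g w : R -> pt) e t :
  e * e = 1 -> (forall s, ~ on_segment (g s)) -> continuous g t -> continuous w t ->
  continuous (fun s => gdot m1 m2 h (g s) (hatX m1 m2 h e (g s)) (w s)) t.
Proof.
intros He Hg Hct Hwt.
apply continuous_ext with (fun s =>
  2 * (h + U m1 m2 (g s)) * (/ push_norm (g s) * dot (pushX e (g s)) (w s))).
{ intros s. symmetry. now apply pairing_explicit. }
destruct (off_segment_neq _ (Hg t)) as [N1 N2].
assert (CU := continuous_U g t Hct N1 N2).
assert (D1 := continuous_edist g c1 t Hct). assert (D2 := continuous_edist g c2 t Hct).
assert (Cc : continuous (fun s => ech (g s)) t) by (unfold ech; cont; lra).
assert (Cs : continuous (fun s => ecs (g s)) t) by (unfold ecs; cont; lra).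
assert (Ch : continuous (fun s => esh (g s)) t) by (unfold esh; cont).
assert (Hesh := esh_gt0 _ (Hg t)).
assert (Cn : continuous (fun s => esn (g s)) t) by (unfold esn; cont; lra).
assert (Ca : continuous (fun s => ea (g s)) t) by (unfold ea; cont).
assert (Cb : continuous (fun s => eb (g s)) t) by (unfold eb; cont).
assert (Hpn := push_norm_gt0 _ (Hg t)).
assert (Cp : continuous (fun s => push_norm (g s)) t) by (unfold push_norm; cont).
unfold dot, pushX, vadd, vscale; cbn [fst snd]. cont. lra.
Qed.

Lemma is_derive_edist (g : R -> pt) y t :
  differentiable g t -> g t <> y ->
  is_derive (fun s => edist (g s) y) t (dot (vsub (g t) y) (velocity g t) / edist (g t) y).
Proof.
intros Hg Hy. destruct (is_derive_velocity g t Hg) as [D1 D2].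
assert (Hpos := edist_gt0 _ _ Hy).
assert (D : is_derive (fun s => dot (vsub (g s) y) (vsub (g s) y)) t
    (2 * dot (vsub (g t) y) (velocity g t))).
{ assert (Z : forall (u : R -> R) l k, is_derive u t l ->
    is_derive (fun s => (u s - k) * (u s - k)) t (2 * ((u t - k) * l))).
  { intros u l k Hu.
    assert (Hk : is_derive (fun s => u s - k) t l).
    { evar_last; [apply (is_derive_minus (V := R_NormedModule) u (fun _ => k) t l 0 Hu);
        apply (is_derive_const (V := R_NormedModule) k t)|].
      unfold minus, plus, opp; simpl; ring. }
    evar_last; [apply (is_derive_mult (K := R_AbsRing) _ _ _ _ _ Hk Hk Rmult_comm)|].
    unfold plus, mult; simpl; ring. }
  evar_last.
  - apply (is_derive_plus (V := R_NormedModule) _ _ _ _ _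
      (Z _ _ (fst y) D1) (Z _ _ (snd y) D2)).
  - unfold plus, dot, vsub; simpl; ring. }
unfold edist at 1, enorm.
evar_last.
- refine (is_derive_comp sqrt (fun s => dot (vsub (g s) y) (vsub (g s) y)) t
    (/ (2 * edist (g t) y)) _ _ D).
  apply is_derive_Reals. unfold edist, enorm. apply derivable_pt_lim_sqrt.
  rewrite <- edist_sqr. nra.
- unfold scal; simpl. unfold mult; simpl. field. lra.
Qed.

(** f is cosh xi along the curve, so its derivative is sinh xi times that of xi; by conformality the
    gradient of xi is the first column of the differential of [Phi] divided by its squared
    length. *)
Lemma Derive_f (g : R -> pt) t :
  differentiable g t -> ~ on_segment (g t) ->
  Derive (f g) t = esh (g t) / (ech (g t) * ech (g t) - ecs (g t) * ecs (g t)) *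
    dot (esh (g t) * ecs (g t), ech (g t) * esn (g t)) (velocity g t).
Proof.
intros Hg Hx. destruct (off_segment_neq _ Hx) as [N1 N2].
assert (D1 := is_derive_edist g c1 t Hg N1). assert (D2 := is_derive_edist g c2 t Hg N2).
assert (P1 := edist_gt0 _ _ N1). assert (P2 := edist_gt0 _ _ N2).
apply is_derive_unique. evar_last.
- apply (is_derive_scal (fun s => edist (g s) c1 + edist (g s) c2) t (/ 2));
  apply (is_derive_plus (V := R_NormedModule) _ _ _ _ _ D1 D2).
- unfold plus, mult; simpl.
  assert (R1 : edist (g t) c1 = ech (g t) + ecs (g t)) by (unfold ech, ecs; lra).
  assert (R2 : edist (g t) c2 = ech (g t) - ecs (g t)) by (unfold ech, ecs; lra).
  rewrite R1, R2 in *.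
  unfold dot, vsub, c1, c2; cbn [fst snd].
  rewrite <- (elliptic_fst (g t)), <- (esh_esn (g t) Hx).
  set (u := fst (velocity g t)). set (v := snd (velocity g t)).
  transitivity ((esh (g t) * esh (g t)) * ecs (g t) / (ech (g t) * ech (g t) - ecs (g t) * ecs (g t)) * u
    + esh (g t) * ech (g t) * esn (g t) / (ech (g t) * ech (g t) - ecs (g t) * ecs (g t)) * v).
  + rewrite (esh_sqr (g t) Hx).
    replace (ech (g t) * ech (g t) - ecs (g t) * ecs (g t)) with
      ((ech (g t) + ecs (g t)) * (ech (g t) - ecs (g t))) by ring.
    field. split; lra.
  + field. generalize (elliptic_gap _ Hx). lra.
Qed.

(** The two fields have the same norm, so in their sum the eta components cancel and a negative
    multiple of the xi direction remains, which is the direction of the gradient of xi. The factor 4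
    joins the 2 of the metric and the 2 of the sum. *)
Lemma Upsilon_derivative (g : R -> pt) t :
  differentiable g t -> ~ on_segment (g t) ->
  exists P, 0 < P /\ Upsilon m1 m2 h g t = P * Derive (f g) t.
Proof.
intros Hg Hx.
assert (H1 := U_gt0 _ Hx). assert (H2 := ea_gt0 _ Hx). assert (H3 := elliptic_gap _ Hx).
assert (H4 := push_norm_gt0 _ Hx). assert (H5 := esh_gt0 _ Hx).
exists (4 * (h + U m1 m2 (g t)) * / push_norm (g t) * ea (g t) *
  ((ech (g t) * ech (g t) - ecs (g t) * ecs (g t)) * / esh (g t))).
split.
- assert (0 < / push_norm (g t)) by now apply Rinv_0_lt_compat.
  assert (0 < / esh (g t)) by now apply Rinv_0_lt_compat.
  repeat apply Rmult_lt_0_compat; lra.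
- rewrite (Derive_f g t Hg Hx). unfold Upsilon.
  replace (gdot _ _ _ _ _ _) with
    (gdot m1 m2 h (g t) (hatX m1 m2 h 1 (g t)) (velocity g t) +
     gdot m1 m2 h (g t) (hatX m1 m2 h (-1) (g t)) (velocity g t))
    by (unfold gdot, dot, vadd; cbn [fst snd]; ring).
  rewrite !pairing_explicit by (assumption || ring).
  unfold pushX, dot, vadd, vscale; cbn [fst snd]. field. repeat split; lra.
Qed.

End Pairing.

(** * First variation of the length *)

Lemma dot_ge0 u : 0 <= dot u u.
Proof. unfold dot. nra. Qed.

Lemma enorm_sqr u : enorm u * enorm u = dot u u.
Proof. apply sqrt_sqrt, dot_ge0. Qed.

Lemma dot_le_enorm u v : dot u v <= enorm u * enorm v.
Proof.
assert (A := sqrt_pos (dot u u)). assert (B := sqrt_pos (dot v v)).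
assert (C := enorm_sqr u). assert (D := enorm_sqr v).
fold (enorm u) in A. fold (enorm v) in B.
apply Rnot_lt_le. intros H.
assert (E : dot u v * dot u v <= dot u u * dot v v).
{ unfold dot. assert (0 <= det u v * det u v) by apply Rle_0_sqr. unfold det in *. lra. }
assert (F : 0 <= enorm u * enorm v) by now apply Rmult_le_pos.
assert ((enorm u * enorm v) * (enorm u * enorm v) < dot u v * dot u v) by nra.
rewrite <- C, <- D in E. lra.
Qed.

Lemma edist_shift_sqr z w y :
  (edist (vadd z w) y - edist z y) * (edist (vadd z w) y - edist z y) <= dot w w.
Proof.
assert (A := edist_sqr (vadd z w) y). assert (B := edist_sqr z y).
assert (C := dot_le_enorm (vsub (vadd z w) y) (vsub z y)).
fold (edist (vadd z w) y) in C. fold (edist z y) in C.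
unfold dot, vsub, vadd in *; cbn [fst snd] in *. lra.
Qed.

Lemma edist_shift z w y e :
  0 <= e -> dot w w <= e * e -> edist z y - e <= edist (vadd z w) y.
Proof.
intros He Hw. generalize (edist_shift_sqr z w y). nra.
Qed.

(** With r and q the distances before and after the shift, the remainder equals (q - r)^2 (1/(2r^3)
    + 1/(r^2 q)) minus a nonnegative term. Here (q - r)^2 is at most the square of w, r is at least
    d and q at least d/2, whence 1/2 + 2 = 5/2. *)
Lemma inv_edist_upper z w y d :
  0 < d -> d <= edist z y -> dot w w <= d / 2 * (d / 2) ->
  / edist (vadd z w) y <=
  / edist z y - dot (vsub z y) w / (edist z y * edist z y * edist z y)
    + 5 / 2 * / (d * d * d) * dot w w.
Proof.
intros Hd Hr Hw.
assert (H1 := edist_shift_sqr z w y).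
assert (H2 := edist_shift z w y (d / 2) ltac:(lra) Hw).
assert (H3 : edist (vadd z w) y * edist (vadd z w) y =
   edist z y * edist z y + 2 * dot (vsub z y) w + dot w w).
{ rewrite !edist_sqr. unfold dot, vsub, vadd; cbn [fst snd]. ring. }
set (q := edist (vadd z w) y) in *. set (r := edist z y) in *.
replace (dot (vsub z y) w) with ((q * q - r * r - dot w w) / 2) by lra.
set (W := dot w w) in *. assert (HW : 0 <= W) by apply dot_ge0.
assert (E : / q - (/ r - (q * q - r * r - W) / 2 / (r * r * r)) =
  (q - r) * (q - r) * (/ (2 * (r * r * r)) + / (r * r * q)) - W * / (2 * (r * r * r))).
{ field. split; lra. }
assert (P1 : 0 < / (2 * (r * r * r))).
{ apply Rinv_0_lt_compat. repeat apply Rmult_lt_0_compat; lra. }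
assert (P2 : 0 < / (r * r * q)).
{ apply Rinv_0_lt_compat. repeat apply Rmult_lt_0_compat; lra. }
assert (Q1 : / (2 * (r * r * r)) <= / (2 * (d * d * d))).
{ apply Rinv_le_contravar.
  - repeat apply Rmult_lt_0_compat; lra.
  - apply Rmult_le_compat_l; [lra|]. repeat apply Rmult_le_compat; try nra. }
assert (Q2 : / (r * r * q) <= 2 * / (d * d * d)).
{ replace (2 * / (d * d * d)) with (/ (d * d * (d / 2))) by (field; lra).
  apply Rinv_le_contravar.
  - repeat apply Rmult_lt_0_compat; lra.
  - repeat apply Rmult_le_compat; try nra. }
replace (/ (2 * (d * d * d))) with (/ 2 * / (d * d * d)) in Q1 by (field; lra).
assert (F : (q - r) * (q - r) * (/ (2 * (r * r * r)) + / (r * r * q)) <=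
   W * (5 / 2 * / (d * d * d))).
{ apply Rmult_le_compat; try lra. apply Rle_0_sqr. }
assert (0 <= W * / (2 * (r * r * r))) by (apply Rmult_le_pos; lra).
lra.
Qed.

Lemma gradU_explicit m1 m2 x : x <> c1 -> x <> c2 ->
  gradU m1 m2 x =
  vadd (vscale (- m1 / (edist x c1 * edist x c1 * edist x c1)) (vsub x c1))
       (vscale (- m2 / (edist x c2 * edist x c2 * edist x c2)) (vsub x c2)).
Proof.
intros N1 N2.
assert (K : forall (g : R -> pt) t, differentiable g t -> g t = x ->
  Derive (fun s => U m1 m2 (g s)) t =
  - m1 / (edist x c1 * edist x c1 * edist x c1) * dot (vsub x c1) (velocity g t) +
  - m2 / (edist x c2 * edist x c2 * edist x c2) * dot (vsub x c2) (velocity g t)).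
{ intros g t Hg E. apply is_derive_unique. unfold U.
  assert (Z : forall m y, x <> y ->
    is_derive (fun s => m / edist (g s) y) t
     (- m / (edist x y * edist x y * edist x y) * dot (vsub x y) (velocity g t))).
  { intros m y Hy. assert (P := edist_gt0 _ _ Hy).
    assert (Hy' : g t <> y) by now rewrite E.
    assert (D := is_derive_edist g y t Hg Hy').
    evar_last.
    - apply (is_derive_scal (fun s => / edist (g s) y) t m).
      apply (is_derive_inv (fun s => edist (g s) y) t _ D). rewrite E. lra.
    - rewrite E. unfold pow. field. lra. }
  apply (is_derive_plus (V := R_NormedModule) _ _ _ _ _ (Z m1 c1 N1) (Z m2 c2 N2)). }
assert (V1 : differentiable (fun s => (s, snd x)) (fst x)).
{ split; cbn [fst snd]; [apply ex_derive_id | apply ex_derive_const]. }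
assert (V2 : differentiable (fun s => (fst x, s)) (snd x)).
{ split; cbn [fst snd]; [apply ex_derive_const | apply ex_derive_id]. }
unfold gradU.
rewrite (K (fun s => (s, snd x)) (fst x) V1), (K (fun s => (fst x, s)) (snd x) V2)
  by (now destruct x).
unfold velocity; cbn [fst snd]. rewrite !Derive_id, !Derive_const.
apply pt_ext; unfold dot, vadd, vscale, vsub; cbn [fst snd]; ring.
Qed.

(** Only upper bounds on the inverse distances are available; nonnegative masses turn them into an
    upper bound for U, the direction needed for the length of a competitor. *)
Lemma U_upper m1 m2 z w d :
  0 <= m1 -> 0 <= m2 -> 0 < d -> d <= edist z c1 -> d <= edist z c2 ->
  dot w w <= d / 2 * (d / 2) ->
  U m1 m2 (vadd z w) <= U m1 m2 z + dot (gradU m1 m2 z) w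
    + (m1 + m2) * (5 / 2 * / (d * d * d)) * dot w w.
Proof.
intros Hm1 Hm2 Hd H1 H2 Hw.
assert (N1 : z <> c1).
{ intros ->. generalize (edist_sqr c1 c1). unfold dot, vsub; cbn [fst snd].
  rewrite !Rminus_diag. nra. }
assert (N2 : z <> c2).
{ intros ->. generalize (edist_sqr c2 c2). unfold dot, vsub; cbn [fst snd].
  rewrite !Rminus_diag. nra. }
assert (A1 := inv_edist_upper z w c1 d Hd H1 Hw).
assert (A2 := inv_edist_upper z w c2 d Hd H2 Hw).
apply (Rmult_le_compat_l m1) in A1; [|exact Hm1].
apply (Rmult_le_compat_l m2) in A2; [|exact Hm2].
rewrite gradU_explicit by assumption.
unfold U. unfold dot at 1. unfold vadd at 3 4, vscale; cbn [fst snd].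
unfold dot, Rdiv in *. lra.
Qed.

Definition shift (T : R) (D1 D2 : pt) (x : R -> pt) (t : R) : pt :=
  vadd (x t) (vadd (vscale (1 - t / T) D1) (vscale (t / T) D2)).

Lemma shift_offset_sqr s D1 D2 M :
  0 <= s <= 1 -> dot D1 D1 <= M -> dot D2 D2 <= M ->
  dot (vadd (vscale (1 - s) D1) (vscale s D2)) (vadd (vscale (1 - s) D1) (vscale s D2))
  <= M.
Proof.
intros Hs H1 H2.
apply Rle_trans with ((1 - s) * dot D1 D1 + s * dot D2 D2).
- assert (0 <= s * (1 - s) * dot (vsub D1 D2) (vsub D1 D2)).
  { apply Rmult_le_pos; [apply Rmult_le_pos; lra | apply dot_ge0]. }
  unfold dot, vadd, vsub, vscale in *; cbn [fst snd] in *. lra.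
- nra.
Qed.

Lemma shift_derive T D1 D2 x t :
  T <> 0 -> differentiable x t ->
  differentiable (shift T D1 D2 x) t /\
  velocity (shift T D1 D2 x) t = vadd (velocity x t) (vscale (/ T) (vsub D2 D1)).
Proof.
intros HT Hx. destruct (is_derive_velocity x t Hx) as [E1 E2].
assert (K : forall (u : R -> R) l a b, is_derive u t l ->
  is_derive (fun s => u s + ((1 - s / T) * a + s / T * b)) t (l + / T * (b - a))).
{ intros u l a b Hu.
  apply (is_derive_plus (V := R_NormedModule) u _ _ _ _ Hu).
  auto_derive; [exact I | field; exact HT]. }
assert (F1 := K _ _ (fst D1) (fst D2) E1). assert (F2 := K _ _ (snd D1) (snd D2) E2).
split.
- split; eexists; [exact F1 | exact F2].
- unfold velocity at 1. unfold shift, vadd at 1 2, vscale at 1 2; cbn [fst snd].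
  apply pt_ext; cbn [fst snd vadd vscale vsub]; apply is_derive_unique; [exact F1 | exact F2].
Qed.

Lemma edist_diag y : edist y y = 0.
Proof.
unfold edist, enorm. replace (dot _ _) with 0 by (unfold dot, vsub; cbn [fst snd]; ring).
apply sqrt_0.
Qed.

(** * Length of a trajectory whose ends are displaced *)

Section Trajectory.
Context (m1 m2 h : R) (Hm : 0 < m2 <= m1) (Hh : 0 <= h).
Context (x : R -> pt) (T : R) (HT : 0 < T).
Context (Htraj : energy_trajectory m1 m2 h x 0 T).
Context (Hoff : forall t, 0 <= t <= T -> ~ on_segment (x t)).

Lemma trajectory_continuous t : 0 <= t <= T -> continuous x t.
Proof. intros Ht. apply differentiable_continuous. now apply (Htraj t Ht). Qed.

Lemma trajectory_velocity_continuous t : 0 <= t <= T -> continuous (velocity x) t.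
Proof. intros Ht. apply differentiable_continuous. now apply (Htraj t Ht). Qed.

(** The excess of the sum of the focal distances over 2 is positive exactly off the segment and
    serves as the distance to it; compactness gives a positive minimum. *)
Lemma trajectory_clearance :
  exists d, 0 < d /\ forall t, 0 <= t <= T ->
    d <= edist (x t) c1 /\ d <= edist (x t) c2 /\ d <= edist (x t) c1 + edist (x t) c2 - 2.
Proof.
set (g := fun t => Rmin (Rmin (edist (x t) c1) (edist (x t) c2))
                     (edist (x t) c1 + edist (x t) c2 - 2)).
destruct (continuity_ab_min g 0 T) as [t0 [H1 H2]]; [lra | |].
- intros t Ht. apply continuity_pt_filterlim. assert (Hc := trajectory_continuous t Ht).
  assert (K1 := continuous_edist x c1 t Hc). assert (K2 := continuous_edist x c2 t Hc).
  change (continuous g t). unfold g. cont.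
- exists (g t0). split.
  + assert (Hx := Hoff t0 H2). destruct (off_segment_neq _ Hx) as [N1 N2].
    generalize (edist_gt0 _ _ N1) (edist_gt0 _ _ N2) (off_segment_foci _ Hx). intros.
    unfold g. repeat apply Rmin_glb_lt; lra.
  + intros t Ht. specialize (H1 t Ht).
    assert (A1 := Rmin_l (Rmin (edist (x t) c1) (edist (x t) c2))
                    (edist (x t) c1 + edist (x t) c2 - 2)).
    assert (A2 := Rmin_r (Rmin (edist (x t) c1) (edist (x t) c2))
                    (edist (x t) c1 + edist (x t) c2 - 2)).
    assert (A3 := Rmin_l (edist (x t) c1) (edist (x t) c2)).
    assert (A4 := Rmin_r (edist (x t) c1) (edist (x t) c2)).
    fold (g t) in A1, A2. lra.
Qed.

Lemma gnorm_trajectory t : 0 <= t <= T ->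
  gnorm m1 m2 h (x t) (velocity x t) = h + U m1 m2 (x t) + / 2 * dot (velocity x t) (velocity x t).
Proof.
intros Ht. destruct (Htraj t Ht) as (_ & _ & _ & _ & _ & E). unfold energy in E.
assert (P := U_gt0 m1 m2 Hm _ (Hoff t Ht)).
unfold gnorm, gdot.
replace (2 * _ * _) with ((2 * (h + U m1 m2 (x t))) * (2 * (h + U m1 m2 (x t)))).
- rewrite sqrt_square; lra.
- replace (dot _ _) with (2 * (h + U m1 m2 (x t))) by lra. ring.
Qed.

Lemma gnorm_le_lagrangian y v :
  ~ on_segment y -> gnorm m1 m2 h y v <= h + U m1 m2 y + / 2 * dot v v.
Proof.
intros Hy. assert (P := U_gt0 m1 m2 Hm y Hy). assert (Q := dot_ge0 v).
unfold gnorm, gdot.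
rewrite <- (sqrt_square (h + U m1 m2 y + / 2 * dot v v)) by lra.
apply sqrt_le_1_alt.
assert (0 <= (h + U m1 m2 y - / 2 * dot v v) * (h + U m1 m2 y - / 2 * dot v v))
  by apply Rle_0_sqr.
lra.
Qed.

(** Each focal distance drops by at most d/4, so at least d/2 of the excess survives. *)
Lemma shift_off_segment D1 D2 d t :
  0 < d -> 0 <= t <= T ->
  d <= edist (x t) c1 + edist (x t) c2 - 2 ->
  dot D1 D1 <= d / 4 * (d / 4) -> dot D2 D2 <= d / 4 * (d / 4) ->
  ~ on_segment (shift T D1 D2 x t).
Proof.
intros Hd Ht Hc H1 H2 Hs. apply on_segment_foci in Hs.
assert (Hs1 : 0 <= t / T <= 1).
{ split; [apply Rmult_le_pos; [lra | apply Rlt_le, Rinv_0_lt_compat; lra]|].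
  apply (Rmult_le_reg_r T); [lra|]. replace (t / T * T) with t by (field; lra). lra. }
assert (W := shift_offset_sqr (t / T) D1 D2 _ Hs1 H1 H2).
unfold shift in Hs.
assert (A1 := edist_shift (x t) _ c1 (d / 4) ltac:(lra) W).
assert (A2 := edist_shift (x t) _ c2 (d / 4) ltac:(lra) W).
lra.
Qed.

(** Integration by parts: by the equation of motion the integrand is the derivative of the velocity
    paired with the interpolated displacement, and only boundary terms remain. *)
Lemma trajectory_momentum_integral D1 D2 :
  is_RInt (fun t =>
     dot (gradU m1 m2 (x t)) (vadd (vscale (1 - t / T) D1) (vscale (t / T) D2)) +
     dot (velocity x t) (vscale (/ T) (vsub D2 D1))) 0 T
   (dot (velocity x T) D2 - dot (velocity x 0) D1).
Proof.
set (w := fun t => vadd (vscale (1 - t / T) D1) (vscale (t / T) D2)).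
evar_last.
- apply (is_RInt_derive (V := R_CompleteNormedModule) (fun t => dot (velocity x t) (w t))).
  + rewrite Rmin_left, Rmax_right by lra. intros t Ht.
    destruct (Htraj t Ht) as (N1 & N2 & Dx & Dv & E & _).
    destruct (is_derive_velocity _ t Dv) as [V1 V2]. rewrite E in V1, V2.
    assert (K : forall a b, is_derive (fun s => (1 - s / T) * a + s / T * b) t (/ T * (b - a))).
    { intros a b. auto_derive; [exact I | field; lra]. }
    unfold dot, w, vadd, vscale, vsub; cbn [fst snd].
    evar_last.
    * apply (is_derive_plus (V := R_NormedModule)
       (fun s => fst (velocity x s) * _) (fun s => snd (velocity x s) * _) t).
      -- apply (is_derive_mult (K := R_AbsRing) _ _ _ _ _ V1 (K (fst D1) (fst D2)) Rmult_comm).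
      -- apply (is_derive_mult (K := R_AbsRing) _ _ _ _ _ V2 (K (snd D1) (snd D2)) Rmult_comm).
    * unfold plus, mult; simpl. unfold vadd, vscale; simpl. ring.
  + rewrite Rmin_left, Rmax_right by lra. intros t Ht.
    assert (Hc := trajectory_continuous t Ht).
    assert (Hv := trajectory_velocity_continuous t Ht).
    destruct (Htraj t Ht) as (N1 & N2 & _).
    (* [gradU] is built from [Derive]; its explicit form holds only off the centres, so it is used
       on a neighbourhood of t on which x avoids them. *)
    assert (Hg : continuous (fun s => gradU m1 m2 (x s)) t).
    { assert (C1' := continuous_edist x c1 t Hc). assert (C2' := continuous_edist x c2 t Hc).
      assert (P1 := edist_gt0 _ _ N1). assert (P2 := edist_gt0 _ _ N2).
      assert (Hn : locally t (fun s => x s <> c1 /\ x s <> c2)).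
      { assert (Z : forall y, x t <> y -> locally t (fun s => x s <> y)).
        { intros y Hy. assert (P := edist_gt0 _ _ Hy).
          destruct (continuous_R_ball _ t _ (continuous_edist x y t Hc) P) as [r [Hr K]].
          exists (mkposreal r Hr). intros s Hs E. specialize (K s Hs).
          rewrite E, edist_diag in K. apply Rabs_def2 in K. lra. }
        apply filter_and; now apply Z. }
      apply (continuous_ext_loc _ (fun s =>
        vadd (vscale (- m1 / (edist (x s) c1 * edist (x s) c1 * edist (x s) c1)) (vsub (x s) c1))
         (vscale (- m2 / (edist (x s) c2 * edist (x s) c2 * edist (x s) c2)) (vsub (x s) c2)))).
      - revert Hn. apply filter_imp. intros s [Q1 Q2]. symmetry. now apply gradU_explicit.
      - unfold vadd, vscale, vsub; cbn [fst snd]. cont;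
        apply Rgt_not_eq; repeat apply Rmult_lt_0_compat; lra. }
    unfold dot, w, vadd, vscale, vsub; cbn [fst snd]. cont; lra.
- unfold minus, plus, opp, w; simpl. unfold dot, vadd, vscale; cbn [fst snd].
  field. lra.
Qed.

Lemma velocity_shift D1 D2 t : 0 <= t <= T ->
  velocity (shift T D1 D2 x) t = vadd (velocity x t) (vscale (/ T) (vsub D2 D1)).
Proof. intros Ht. apply shift_derive; [lra | now apply (Htraj t Ht)]. Qed.

(* AM-GM replaces the length of the shifted curve by its action, which equals
   the length along an energy-h trajectory and expands quadratically. *)
Lemma shift_length D1 D2 d :
  0 < d ->
  (forall t, 0 <= t <= T ->
    d <= edist (x t) c1 /\ d <= edist (x t) c2 /\ d <= edist (x t) c1 + edist (x t) c2 - 2) ->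
  dot D1 D1 <= d / 4 * (d / 4) -> dot D2 D2 <= d / 4 * (d / 4) ->
  jacobi_length m1 m2 h T (shift T D1 D2 x) <=
  jacobi_length m1 m2 h T x + (dot (velocity x T) D2 - dot (velocity x 0) D1) +
  T * (((m1 + m2) * (5 / 2 * / (d * d * d)) + / (T * T)) * (dot D1 D1 + dot D2 D2)).
Proof.
intros Hd Hcl H1 H2.
set (w := fun t => vadd (vscale (1 - t / T) D1) (vscale (t / T) D2)).
set (k := (m1 + m2) * (5 / 2 * / (d * d * d))).
set (M := dot D1 D1 + dot D2 D2).
assert (HM1 := dot_ge0 D1). assert (HM2 := dot_ge0 D2).
assert (Hk : 0 <= k).
{ unfold k. apply Rmult_le_pos; [lra|]. apply Rmult_le_pos; [lra|].
  apply Rlt_le, Rinv_0_lt_compat. repeat apply Rmult_lt_0_compat; lra. }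
assert (Hint : ex_RInt (fun t => gnorm m1 m2 h (x t) (velocity x t)) 0 T).
{ apply (ex_RInt_continuous (V := R_CompleteNormedModule)).
  rewrite Rmin_left, Rmax_right by lra. intros t Ht.
  assert (Hc := trajectory_continuous t Ht).
  assert (Hv := trajectory_velocity_continuous t Ht).
  destruct (Htraj t Ht) as (N1 & N2 & _).
  assert (CU := continuous_U m1 m2 x t Hc N1 N2).
  unfold gnorm, gdot, dot. cont. }
(* First-order change of the Lagrangian along the shift; the integrand is compared with this term
   and a constant quadratic error. *)
set (E := fun t => dot (gradU m1 m2 (x t)) (w t) + dot (velocity x t) (vscale (/ T) (vsub D2 D1))).
assert (HE : is_RInt E 0 T (dot (velocity x T) D2 - dot (velocity x 0) D1))
  by apply trajectory_momentum_integral.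
assert (HR : is_RInt (fun t => gnorm m1 m2 h (x t) (velocity x t) + E t
     + (k + / (T * T)) * M) 0 T
   (jacobi_length m1 m2 h T x + (dot (velocity x T) D2 - dot (velocity x 0) D1)
    + T * ((k + / (T * T)) * M))).
{ apply (is_RInt_plus (V := R_NormedModule)
    (fun t => gnorm m1 m2 h (x t) (velocity x t) + E t) (fun _ => (k + / (T * T)) * M)).
  - apply (is_RInt_plus (V := R_NormedModule)
      (fun t => gnorm m1 m2 h (x t) (velocity x t)) E); [|exact HE].
    apply (RInt_correct (V := R_CompleteNormedModule)), Hint.
  - evar_last; [apply (is_RInt_const (V := R_NormedModule))|].
    unfold scal; simpl. unfold mult; simpl. ring. }
rewrite <- (is_RInt_unique _ _ _ _ HR).
unfold jacobi_length. apply RInt_le; [lra | | eexists; exact HR |].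
- apply (ex_RInt_ext (V := R_NormedModule) (fun t => gnorm m1 m2 h (shift T D1 D2 x t)
    (vadd (velocity x t) (vscale (/ T) (vsub D2 D1))))).
  + rewrite Rmin_left, Rmax_right by lra. intros t Ht.
    rewrite velocity_shift by lra. reflexivity.
  + apply (ex_RInt_continuous (V := R_CompleteNormedModule)).
    rewrite Rmin_left, Rmax_right by lra. intros t Ht.
    assert (Hc := trajectory_continuous t Ht).
    assert (Hv := trajectory_velocity_continuous t Ht).
    assert (Hs : continuous (shift T D1 D2 x) t).
    { unfold shift, vadd, vscale; cbn [fst snd]. cont; lra. }
    destruct (Hcl t Ht) as (_ & _ & Hcl3).
    destruct (off_segment_neq _ (shift_off_segment D1 D2 d t Hd Ht Hcl3 H1 H2)) as [N1 N2].
    assert (CU := continuous_U m1 m2 _ t Hs N1 N2).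
    unfold gnorm, gdot, dot, vadd, vscale; cbn [fst snd]. cont.
- intros t Ht'. assert (Ht : 0 <= t <= T) by lra.
  destruct (Hcl t Ht) as (Hcl1 & Hcl2 & Hcl3).
  rewrite velocity_shift by exact Ht.
  eapply Rle_trans; [apply gnorm_le_lagrangian, (shift_off_segment D1 D2 d t Hd Ht Hcl3 H1 H2)|].
  rewrite (gnorm_trajectory t Ht).
  assert (Hs1 : 0 <= t / T <= 1).
  { split; [apply Rmult_le_pos; [lra | apply Rlt_le, Rinv_0_lt_compat; lra]|].
    apply (Rmult_le_reg_r T); [lra|]. replace (t / T * T) with t by (field; lra). lra. }
  assert (W1 := shift_offset_sqr (t / T) D1 D2 _ Hs1 H1 H2).
  assert (W2 : dot (w t) (w t) <= M).
  { apply (shift_offset_sqr (t / T) D1 D2 _ Hs1); unfold M; lra. }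
  fold (w t) in W1.
  assert (HU := U_upper m1 m2 (x t) (w t) d ltac:(lra) ltac:(lra) Hd Hcl1 Hcl2 ltac:(nra)).
  fold k in HU.
  assert (Hkw : k * dot (w t) (w t) <= k * M) by (apply Rmult_le_compat_l; lra).
  assert (HT2 : 0 < / (T * T)) by (apply Rinv_0_lt_compat; nra).
  assert (Hv : / 2 * dot (vscale (/ T) (vsub D2 D1)) (vscale (/ T) (vsub D2 D1)) <= / (T * T) * M).
  { replace (/ 2 * dot _ _) with (/ (T * T) * (/ 2 * dot (vsub D2 D1) (vsub D2 D1)))
      by (unfold dot, vscale; cbn [fst snd]; field; lra).
    apply Rmult_le_compat_l; [lra|].
    assert (0 <= dot (vadd D2 D1) (vadd D2 D1)) by apply dot_ge0.
    unfold M, dot, vsub, vadd in *; cbn [fst snd] in *. lra. }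
  replace (dot (vadd (velocity x t) (vscale (/ T) (vsub D2 D1)))
             (vadd (velocity x t) (vscale (/ T) (vsub D2 D1)))) with
    (dot (velocity x t) (velocity x t) + 2 * dot (velocity x t) (vscale (/ T) (vsub D2 D1))
     + dot (vscale (/ T) (vsub D2 D1)) (vscale (/ T) (vsub D2 D1)))
    by (unfold dot, vadd; cbn [fst snd]; ring).
  unfold shift. fold (w t). unfold E. lra.
Qed.

End Trajectory.

(** * Homotopies of loops off the segment *)

Definition unit_square (p : R * R) : Prop := 0 <= fst p <= 1 /\ 0 <= snd p <= 1.

Lemma continuous_clamped (H : R * R -> pt) (a b : R * R -> R) p :
  continuous_on unit_square H -> continuous a p -> continuous b p ->
  continuous (fun q => H (clamp 0 1 (a q), clamp 0 1 (b q))) p.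
Proof.
intros HH Ha Hb.
set (g := fun q => (clamp 0 1 (a q), clamp 0 1 (b q))).
assert (Hin : forall q, unit_square (g q)).
{ intros q. split; apply clamp_bounds; lra. }
assert (Hg : continuous g p).
{ apply continuous_pair; now apply continuous_clamp. }
intros P HP. specialize (HH (g p) (Hin p) P HP). unfold filtermap, within in HH.
specialize (Hg _ HH). unfold filtermap in *. revert Hg. apply filter_imp.
intros q K. apply K, Hin.
Qed.

(** The two homotopies are glued additively: both run with clamped time and their common loop is
    subtracted once. On each half two of the three terms cancel, and continuity needs no pasting of
    closed sets. *)
Lemma loop_homotopic_trans l l' l'' :
  loop_homotopic l l' -> loop_homotopic l' l'' -> loop_homotopic l l''.
Proof.
intros (H1 & C1 & E1 & L1 & O1) (H2 & C2 & E2 & L2 & O2).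
set (K := fun p : R * R =>
  vadd (vsub (H1 (clamp 0 1 (2 * fst p), clamp 0 1 (snd p))) (H1 (1, clamp 0 1 (snd p))))
       (H2 (clamp 0 1 (2 * fst p - 1), clamp 0 1 (snd p)))).
assert (Kleft : forall s t, 0 <= s <= / 2 -> 0 <= t <= 1 -> K (s, t) = H1 (2 * s, t)).
{ intros s t Hs Ht. unfold K; cbn [fst snd].
  rewrite (clamp_id 0 1 (2 * s)), (clamp_id 0 1 t) by lra.
  replace (clamp 0 1 (2 * s - 1)) with 0.
  - destruct (E1 t Ht) as [_ ->]. destruct (E2 t Ht) as [-> _].
    apply pt_ext; unfold vadd, vsub; cbn [fst snd]; ring.
  - unfold clamp. rewrite Rmin_right, Rmax_left; lra. }
assert (Kright : forall s t, / 2 <= s <= 1 -> 0 <= t <= 1 -> K (s, t) = H2 (2 * s - 1, t)).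
{ intros s t Hs Ht. unfold K; cbn [fst snd].
  rewrite (clamp_id 0 1 (2 * s - 1)), (clamp_id 0 1 t) by lra.
  replace (clamp 0 1 (2 * s)) with 1.
  - apply pt_ext; unfold vadd, vsub; cbn [fst snd]; ring.
  - unfold clamp. rewrite Rmin_left, Rmax_right; lra. }
exists K. split; [|split; [|split]].
- apply continuous_on_forall. intros p _.
  assert (F1 : continuous (fun q : R * R => fst q) p) by (cont; apply continuous_id).
  assert (F2 : continuous (fun q : R * R => snd q) p) by (cont; apply continuous_id).
  assert (G1 : continuous (fun q : R * R => H1 (clamp 0 1 (2 * fst q), clamp 0 1 (snd q))) p).
  { apply (continuous_clamped H1 (fun q => 2 * fst q) (fun q => snd q));
      [exact C1 | cont | exact F2]. }
  assert (G2 : continuous (fun q : R * R => H2 (clamp 0 1 (2 * fst q - 1), clamp 0 1 (snd q))) p).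
  { apply (continuous_clamped H2 (fun q => 2 * fst q - 1) (fun q => snd q));
      [exact C2 | cont | exact F2]. }
  assert (G3 : continuous (fun q : R * R => H1 (1, clamp 0 1 (snd q))) p).
  { apply continuous_ext with (fun q : R * R => H1 (clamp 0 1 1, clamp 0 1 (snd q))).
    - intros q. now rewrite (clamp_id 0 1 1) by lra.
    - apply (continuous_clamped H1 (fun q => 1) (fun q => snd q)); [exact C1 | cont | exact F2]. }
  unfold K, vadd, vsub; cbn [fst snd]. cont.
- intros t Ht. rewrite Kleft, Kright by lra.
  rewrite Rmult_0_r. replace (2 * 1 - 1) with 1 by ring.
  split; [now apply E1 | now apply E2].
- intros s Hs. destruct (Rle_dec s (/ 2)).
  + rewrite !Kleft by lra. apply L1. lra.
  + rewrite !Kright by lra. apply L2. lra.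
- intros s t Hs Ht. destruct (Rle_dec s (/ 2)).
  + rewrite Kleft by lra. apply O1; lra.
  + rewrite Kright by lra. apply O2; lra.
Qed.

(** [lift] jumps only at representatives of theta0, and none lies in the arc: a jump of the integer
    part between a and b would place one there. *)
Lemma lift_translation thm thp theta0 a b :
  off_arc thm thp theta0 -> thm <= a <= thp -> thm <= b <= thp ->
  lift theta0 b = lift theta0 a + (b - a).
Proof.
intros Hoff.
assert (W : forall a b, thm <= a <= thp -> thm <= b <= thp ->
  (Int_part ((a - theta0) / (2 * PI)) < Int_part ((b - theta0) / (2 * PI)))%Z -> False).
{ clear a b. intros a b Ha Hb Hlt. generalize PI_RGT_0; intros HP.
  destruct (base_Int_part ((a - theta0) / (2 * PI))) as [A1 A2].
  destruct (base_Int_part ((b - theta0) / (2 * PI))) as [B1 B2].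
  set (na := Int_part ((a - theta0) / (2 * PI))) in *.
  set (nb := Int_part ((b - theta0) / (2 * PI))) in *.
  assert (Hn : IZR na + 1 <= IZR nb) by (rewrite <- plus_IZR; apply IZR_le; lia).
  assert (Ea : a = theta0 + 2 * PI * ((a - theta0) / (2 * PI))) by (field; lra).
  assert (Eb : b = theta0 + 2 * PI * ((b - theta0) / (2 * PI))) by (field; lra).
  set (qa := (a - theta0) / (2 * PI)) in *. set (qb := (b - theta0) / (2 * PI)) in *.
  apply (Hoff (theta0 + 2 * PI * IZR nb)); [now exists nb|].
  assert (2 * PI * qa <= 2 * PI * IZR nb) by (apply Rmult_le_compat_l; lra).
  assert (2 * PI * IZR nb <= 2 * PI * qb) by (apply Rmult_le_compat_l; lra).
  lra. }
intros Ha Hb.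
assert (E : Int_part ((a - theta0) / (2 * PI)) = Int_part ((b - theta0) / (2 * PI))).
{ generalize (W a b Ha Hb) (W b a Hb Ha). lia. }
unfold lift. rewrite E. ring.
Qed.

Lemma piecewise_C1_shift T D1 D2 x :
  0 < T -> piecewise_C1 T x -> piecewise_C1 T (shift T D1 D2 x).
Proof.
intros HT (N & s & g & H0 & HN & H).
exists N, s, (fun i => shift T D1 D2 (g i)). split; [exact H0|]. split; [exact HN|].
intros i Hi. destruct (H i Hi) as (Hs & HC & Hg). split; [exact Hs|]. split.
- intros t. split.
  + apply shift_derive; [lra | apply HC].
  + apply continuous_ext with (fun t => vadd (velocity (g i) t) (vscale (/ T) (vsub D2 D1))).
    * intros u. symmetry. apply shift_derive; [lra | apply HC].
    * assert (Hc := proj2 (HC t)). unfold vadd, vscale; cbn [fst snd]. cont.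
- intros t Ht. unfold shift. now rewrite Hg.
Qed.

(** * First variation of the arc lengths *)

Section FirstVariation.
Context {Omega : pt -> Prop} {gamma : R -> pt}.
Context (HOmega : bounded_domain Omega).
Context (Hseg : forall x, on_segment x -> Omega x).
Context (Hgamma : boundary_parametrisation Omega gamma).
Context (m1 m2 h : R) (Hm : 0 < m2 <= m1) (Hh : 0 <= h).
Context (thm thp theta0 : R) (Hoff0 : off_arc thm thp theta0).

(** The displaced ends return linearly to a and b, dragging along the shifted curve and the closing
    arc. The former stays off the segment by clearance, the latter because it lies on the
    boundary. *)
Lemma closed_up_shift_homotopic x T d a b a' b' :
  0 < T -> (forall t, 0 <= t <= T -> continuous x t) ->
  x 0 = gamma a -> x T = gamma b ->
  0 < d ->
  (forall t, 0 <= t <= T -> d <= edist (x t) c1 + edist (x t) c2 - 2) ->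
  thm <= a <= thp -> thm <= b <= thp -> thm <= a' <= thp -> thm <= b' <= thp ->
  (forall s, 0 <= s <= 1 ->
    dot (vsub (gamma (a' + s * (a - a'))) (gamma a)) (vsub (gamma (a' + s * (a - a'))) (gamma a))
      <= d / 4 * (d / 4) /\
    dot (vsub (gamma (b' + s * (b - b'))) (gamma b)) (vsub (gamma (b' + s * (b - b'))) (gamma b))
      <= d / 4 * (d / 4)) ->
  loop_homotopic
    (closed_up gamma theta0 a' b' T
       (shift T (vsub (gamma a') (gamma a)) (vsub (gamma b') (gamma b)) x))
    (closed_up gamma theta0 a b T x).
Proof.
intros HT Hx Hx0 HxT Hd Hcl Ha Hb Ha' Hb' Hsmall.
set (A := fun s => a' + s * (a - a')). set (B := fun s => b' + s * (b - b')).
set (DA := fun s => vsub (gamma (A s)) (gamma a)).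
set (DB := fun s => vsub (gamma (B s)) (gamma b)).
set (la := fun s => lift theta0 a + (A s - a)).
(* The lifted ends are carried along continuously instead of being recomputed with the discontinuous
   [lift]; at s = 0 the two agree by [lift_translation]. *)
set (lb := fun s => lift theta0 b + (B s - b)).
assert (Ela : forall s, gamma (la s) = gamma (A s)).
{ intros s. apply (gamma_inj Hgamma).
  exists (Int_part ((a - theta0) / (2 * PI))). unfold la, lift. ring. }
assert (Elb : forall s, gamma (lb s) = gamma (B s)).
{ intros s. apply (gamma_inj Hgamma).
  exists (Int_part ((b - theta0) / (2 * PI))). unfold lb, lift. ring. }
set (P := fun s t => shift T (DA s) (DB s) x (clamp 0 T (2 * t * T))).
set (Q := fun s t => gamma (lb s + (2 * t - 1) * (la s - lb s))).
(* Additive gluing again: before time 1/2 the two Q terms cancel, afterwards P is frozen at its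
   value at 1/2, which is that of Q. *)
set (H := fun p : R * R => vadd (P (fst p) (Rmin (snd p) (/ 2)))
   (vsub (Q (fst p) (Rmax (snd p) (/ 2))) (Q (fst p) (/ 2)))).
assert (EP : forall s, P s (/ 2) = Q s (/ 2)).
{ intros s. unfold P, Q. replace (2 * / 2 * T) with T by field.
  rewrite clamp_id by lra. replace (lb s + _) with (lb s) by field.
  rewrite Elb. unfold shift, DB. rewrite HxT.
  apply pt_ext; unfold vadd, vsub, vscale; cbn [fst snd]; field; lra. }
assert (Hleft : forall s t, t <= / 2 -> H (s, t) = P s t).
{ intros s t Ht. unfold H; cbn [fst snd]. rewrite Rmin_left, Rmax_right by lra.
  apply pt_ext; unfold vadd, vsub; cbn [fst snd]; ring. }
assert (Hright : forall s t, / 2 <= t -> H (s, t) = Q s t).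
{ intros s t Ht. unfold H; cbn [fst snd]. rewrite Rmin_right, Rmax_left by lra. rewrite EP.
  apply pt_ext; unfold vadd, vsub; cbn [fst snd]; ring. }
assert (Hgc : forall (u : R * R -> R) p, continuous u p -> continuous (fun q => gamma (u q)) p).
{ intros u p Hu. apply (continuous_comp u gamma); [exact Hu | apply (gamma_continuous Hgamma)]. }
exists H. split; [|split; [|split]].
- apply continuous_on_forall. intros p _.
  assert (F1 : continuous (fun q : R * R => fst q) p) by (cont; apply continuous_id).
  assert (F2 : continuous (fun q : R * R => snd q) p) by (cont; apply continuous_id).
  assert (FA : continuous (fun q : R * R => A (fst q)) p) by (unfold A; cont).
  assert (FB : continuous (fun q : R * R => B (fst q)) p) by (unfold B; cont).
  assert (Fla : continuous (fun q : R * R => la (fst q)) p) by (unfold la; cont).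
  assert (Flb : continuous (fun q : R * R => lb (fst q)) p) by (unfold lb; cont).
  assert (GA := Hgc _ p FA). assert (GB := Hgc _ p FB).
  assert (FDA : continuous (fun q : R * R => DA (fst q)) p) by (unfold DA, vsub; cont).
  assert (FDB : continuous (fun q : R * R => DB (fst q)) p) by (unfold DB, vsub; cont).
  assert (HQ : forall r : R * R -> R, continuous r p -> continuous (fun q => Q (fst q) (r q)) p).
  { intros r Hr. unfold Q. apply Hgc. cont. }
  assert (Q1 : continuous (fun q : R * R => Q (fst q) (Rmax (snd q) (/ 2))) p)
    by (apply HQ; cont).
  assert (Q2 : continuous (fun q : R * R => Q (fst q) (/ 2)) p) by (apply HQ; cont).
  assert (FT : continuous (fun q : R * R => clamp 0 T (2 * Rmin (snd q) (/ 2) * T)) p)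
    by (apply (continuous_clamp 0 T (fun q : R * R => 2 * Rmin (snd q) (/ 2) * T)); cont).
  assert (FX : continuous (fun q : R * R => x (clamp 0 T (2 * Rmin (snd q) (/ 2) * T))) p).
  { apply (continuous_comp (fun q : R * R => clamp 0 T (2 * Rmin (snd q) (/ 2) * T)) x);
      [exact FT | apply Hx, clamp_bounds; lra]. }
  assert (P1 : continuous (fun q : R * R => P (fst q) (Rmin (snd q) (/ 2))) p).
  { unfold P, shift, vadd, vscale; cbn [fst snd]. cont; lra. }
  unfold H, vadd, vsub. cont.
- intros t Ht.
  assert (Eclamp : t <= / 2 -> clamp 0 T (2 * t * T) = 2 * t * T).
  { intros Ht2. apply clamp_id. split; nra. }
  assert (DA0 : DA 0 = vsub (gamma a') (gamma a)) by (unfold DA, A; do 2 f_equal; ring).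
  assert (DB0 : DB 0 = vsub (gamma b') (gamma b)) by (unfold DB, B; do 2 f_equal; ring).
  assert (DA1 : DA 1 = (0, 0)).
  { unfold DA, A. replace (a' + 1 * (a - a')) with a by ring.
    apply pt_ext; unfold vsub; cbn [fst snd]; ring. }
  assert (DB1 : DB 1 = (0, 0)).
  { unfold DB, B. replace (b' + 1 * (b - b')) with b by ring.
    apply pt_ext; unfold vsub; cbn [fst snd]; ring. }
  assert (la0 : la 0 = lift theta0 a').
  { rewrite (lift_translation thm thp theta0 a a') by assumption. unfold la, A. ring. }
  assert (lb0 : lb 0 = lift theta0 b').
  { rewrite (lift_translation thm thp theta0 b b') by assumption. unfold lb, B. ring. }
  assert (la1 : la 1 = lift theta0 a) by (unfold la, A; ring).
  assert (lb1 : lb 1 = lift theta0 b) by (unfold lb, B; ring).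
  unfold closed_up. destruct (Rle_dec t (/ 2)) as [Ht2|Ht2].
  + rewrite !Hleft by assumption. unfold P. rewrite Eclamp, DA0, DB0, DA1, DB1 by assumption.
    split; [reflexivity|].
    apply pt_ext; unfold shift, vadd, vscale; cbn [fst snd]; ring.
  + rewrite !Hright by lra. unfold Q. rewrite la0, lb0, la1, lb1. split; reflexivity.
- intros s Hs. rewrite Hleft, Hright by lra. unfold P, Q.
  rewrite clamp_id by nra. replace (2 * 0 * T) with 0 by ring.
  replace (lb s + _) with (la s) by ring. rewrite Ela. unfold shift. rewrite Hx0. unfold DA.
  apply pt_ext; unfold vadd, vsub, vscale; cbn [fst snd]; field; lra.
- intros s t Hs Ht. destruct (Rle_dec t (/ 2)).
  + rewrite Hleft by assumption. destruct (Hsmall s Hs) as [S1 S2].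
    assert (Hcl' : 0 <= clamp 0 T (2 * t * T) <= T) by (apply clamp_bounds; lra).
    apply (shift_off_segment x T HT _ _ d); try assumption. now apply Hcl.
  + rewrite Hright by lra. apply (gamma_off_segment HOmega Hseg Hgamma).
Qed.

Lemma arc_spec k a b : arc_exists m1 m2 h gamma k theta0 a b ->
  is_arc m1 m2 h gamma k theta0 a b
    (arc_time m1 m2 h gamma k theta0 a b) (arc_curve m1 m2 h gamma k theta0 a b).
Proof.
intros (T & x & H).
exact (epsilon_spec (inhabits (0, fun _ => (0, 0)))
  (fun s => is_arc m1 m2 h gamma k theta0 a b (fst s) (snd s)) (ex_intro _ (T, x) H)).
Qed.

Lemma gamma_near a e : 0 < e ->
  exists r, 0 < r /\ forall t, Rabs (t - a) < r ->
    dot (vsub (gamma t) (gamma a)) (vsub (gamma t) (gamma a)) <= e.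
Proof.
intros He.
destruct (continuous_R_ball (fun t => dot (vsub (gamma t) (gamma a)) (vsub (gamma t) (gamma a))) a e)
  as [r [Hr K]]; [ | exact He |].
- assert (Hc := gamma_continuous Hgamma a). unfold dot, vsub; cbn [fst snd]. cont.
- exists r. split; [exact Hr|]. intros t Ht. specialize (K t Ht).
  apply Rabs_def2 in K. destruct K as [K _]. revert K.
  replace (dot (vsub (gamma a) (gamma a)) _) with 0 by (unfold dot, vsub; cbn [fst snd]; ring).
  lra.
Qed.

(** The minimiser for the new ends is no longer than the shifted x, by admissibility of the latter,
    and [shift_length] estimates that curve. The length of x itself is at most that of the chosen
    arc from a to b, as both minimise. *)
Lemma first_variation k a b T x :
  (forall a' b', thm <= a' <= thp -> thm <= b' <= thp ->
     arc_exists m1 m2 h gamma k theta0 a' b') ->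
  thm <= a <= thp -> thm <= b <= thp ->
  is_arc m1 m2 h gamma k theta0 a b T x ->
  exists C r, 0 <= C /\ 0 < r /\ forall a' b',
    thm <= a' <= thp -> thm <= b' <= thp -> Rabs (a' - a) < r -> Rabs (b' - b) < r ->
    arc_length m1 m2 h gamma k theta0 a' b' <=
    arc_length m1 m2 h gamma k theta0 a b
    + (dot (velocity x T) (vsub (gamma b') (gamma b)) - dot (velocity x 0) (vsub (gamma a') (gamma a)))
    + C * (dot (vsub (gamma a') (gamma a)) (vsub (gamma a') (gamma a)) +
           dot (vsub (gamma b') (gamma b)) (vsub (gamma b') (gamma b))).
Proof.
intros Hex Ha Hb [[Hadm Hmin] Htraj].
destruct Hadm as (HT & Hpw & Hoff & Hx0 & HxT & Hhom).
destruct (trajectory_clearance m1 m2 h x T HT Htraj Hoff) as [d [Hd Hcl]].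
assert (Hd4 : 0 < d / 4 * (d / 4)) by nra.
destruct (gamma_near a _ Hd4) as [ra [Hra Ka]].
destruct (gamma_near b _ Hd4) as [rb [Hrb Kb]].
exists (T * ((m1 + m2) * (5 / 2 * / (d * d * d)) + / (T * T))), (Rmin ra rb).
split; [|split].
{ apply Rmult_le_pos; [lra|]. apply Rplus_le_le_0_compat.
  - apply Rmult_le_pos; [lra|]. apply Rmult_le_pos; [lra|].
    apply Rlt_le, Rinv_0_lt_compat. repeat apply Rmult_lt_0_compat; lra.
  - apply Rlt_le, Rinv_0_lt_compat. nra. }
{ now apply Rmin_glb_lt. }
intros a' b' Ha' Hb' Hra' Hrb'.
assert (Hra2 := Rlt_le_trans _ _ _ Hra' (Rmin_l _ _)).
assert (Hrb2 := Rlt_le_trans _ _ _ Hrb' (Rmin_r _ _)).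
assert (Hseg' : forall u u' r s, Rabs (u' - u) < r -> 0 <= s <= 1 ->
   Rabs (u' + s * (u - u') - u) < r).
{ intros u u' r s Hu Hs. replace (_ - u) with ((1 - s) * (u' - u)) by ring.
  rewrite Rabs_mult, (Rabs_pos_eq (1 - s)) by lra. generalize (Rabs_pos (u' - u)). nra. }
set (Da := vsub (gamma a') (gamma a)). set (Db := vsub (gamma b') (gamma b)).
assert (HDa : dot Da Da <= d / 4 * (d / 4)) by now apply Ka.
assert (HDb : dot Db Db <= d / 4 * (d / 4)) by now apply Kb.
assert (HL := shift_length m1 m2 h Hm Hh x T HT Htraj Hoff Da Db d Hd Hcl HDa HDb).
destruct (arc_spec k a b (Hex a b Ha Hb)) as [[Hadm0 Hmin0] _].
destruct (arc_spec k a' b' (Hex a' b' Ha' Hb')) as [[_ Hmin'] _].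
assert (Hcomp : admissible gamma k theta0 a' b' T (shift T Da Db x)).
{ split; [exact HT|]. split; [now apply piecewise_C1_shift|].
  split; [|split; [|split]].
  - intros t Ht. apply (shift_off_segment x T HT _ _ d); try assumption. apply Hcl, Ht.
  - unfold shift, Da. rewrite Hx0.
    apply pt_ext; unfold vadd, vsub, vscale; cbn [fst snd]; field; lra.
  - unfold shift, Db. rewrite HxT.
    apply pt_ext; unfold vadd, vsub, vscale; cbn [fst snd]; field; lra.
  - apply loop_homotopic_trans with (2 := Hhom).
    apply (closed_up_shift_homotopic x T d); try assumption.
    + intros t Ht. now apply (trajectory_continuous m1 m2 h x T Htraj).
    + intros t Ht. apply Hcl, Ht.
    + intros s Hs. split; [apply Ka | apply Kb]; now apply Hseg'. }
destruct (Hmin' T _ Hcomp) as [HA _].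
destruct (Hmin _ _ Hadm0) as [HB _].
unfold arc_length. eapply Rle_trans; [exact HA|]. eapply Rle_trans; [exact HL|].
apply Rle_trans with (jacobi_length m1 m2 h T x +
  (dot (velocity x T) Db - dot (velocity x 0) Da) +
  T * ((m1 + m2) * (5 / 2 * / (d * d * d)) + / (T * T)) * (dot Da Da + dot Db Db)); [right; ring|].
lra.
Qed.

End FirstVariation.

(** * Periodic billiard trajectories *)

(** The squares of [det tau u] and [dot u tau] add up to the product of the squared norms. Equal
    norms and tangential parts thus leave the normal part determined up to sign, and the strict
    signs select the reflection. *)
Lemma reflect_characterised tau v v' :
  0 < dot tau tau -> dot v v = dot v' v' -> dot (vsub v v') tau = 0 ->
  det tau v < 0 -> 0 < det tau v' -> v' = reflect tau v.
Proof.
intros Ht Hn Hd H1 H2.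
assert (Hd' : dot v' tau = dot v tau)
  by (revert Hd; unfold dot, vsub; cbn [fst snd]; lra).
assert (L : forall u, det tau u * det tau u + dot u tau * dot u tau = dot tau tau * dot u u)
  by (intros u; unfold det, dot; ring).
assert (A := L v). assert (B := L v'). rewrite Hd', <- Hn in B.
assert (E : det tau v' = - det tau v) by nra.
assert (Dec : forall u, vscale (dot tau tau) u =
    vadd (vscale (dot u tau) tau) (vscale (det tau u) (- snd tau, fst tau)))
  by (intros u; apply pt_ext; unfold vadd, vscale, det, dot; cbn [fst snd]; ring).
assert (F := Dec v'). rewrite E, Hd' in F.
apply (f_equal (vscale (/ dot tau tau))) in F.
replace (vscale (/ dot tau tau) (vscale (dot tau tau) v')) with v' in F
  by (apply pt_ext; unfold vscale; cbn [fst snd]; field; lra).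
rewrite F. unfold reflect.
apply pt_ext; unfold vscale, vadd, vsub, det; cbn [fst snd];
  apply (Rmult_eq_reg_l (dot tau tau)); try lra; field_simplify; try lra;
  unfold dot; ring.
Qed.

(** The expression vanishes at a and is minimal there; its quadratic part does not contribute to the
    derivative. *)
Lemma critical_momentum g a w K r :
  differentiable g a -> 0 < r ->
  (forall t, Rabs (t - a) < r ->
     0 <= dot w (vsub (g t) (g a)) + K * dot (vsub (g t) (g a)) (vsub (g t) (g a))) ->
  dot w (velocity g a) = 0.
Proof.
intros Hg Hr H. destruct (is_derive_velocity g a Hg) as [D1 D2].
set (phi := fun t => dot w (vsub (g t) (g a)) + K * dot (vsub (g t) (g a)) (vsub (g t) (g a))).
assert (D : is_derive phi a (dot w (velocity g a))).
{ assert (K0 : forall (u v : R -> R) l l', is_derive u a l -> is_derive v a l' ->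
    is_derive (fun t => fst w * (u t - u a) + snd w * (v t - v a) +
      K * ((u t - u a) * (u t - u a) + (v t - v a) * (v t - v a))) a
      (fst w * l + snd w * l')).
  { intros u v l l' Hu Hv. auto_derive.
    - repeat split; eexists; eassumption.
    - change (Derive (fun x => u x) a) with (Derive u a).
      change (Derive (fun x => v x) a) with (Derive v a).
      rewrite (is_derive_unique _ _ _ Hu), (is_derive_unique _ _ _ Hv). ring. }
  exact (K0 _ _ _ _ D1 D2). }
assert (Hd := proj1 (is_derive_Reals _ _ _) D).
assert (E : derive_pt phi a (exist _ _ Hd) = 0).
{ apply (deriv_minimum _ (a - r) (a + r)); try lra. intros t Ht1 Ht2.
  assert (E : phi a = 0) by (unfold phi, dot, vsub; cbn [fst snd]; ring).
  rewrite E. apply H, Rabs_def1; lra. }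
exact E.
Qed.

Section Periodic.
Context {Omega : pt -> Prop} {gamma : R -> pt}.
Context (HOmega : bounded_domain Omega).
Context (Hseg : forall x, on_segment x -> Omega x).
Context (Hgamma : boundary_parametrisation Omega gamma).
Context (m1 m2 h : R) (Hm : 0 < m2 <= m1) (Hh : 0 <= h).
Context (thm thp theta0 : R) (Hth : thm < thp) (Hoff0 : off_arc thm thp theta0).
Context (eps : R) (k1 k0 : nat).
Context (Hchoice4 : choice4 m1 m2 h gamma thm thp theta0 eps k1 k0).

Definition pairing (e theta : R) : R :=
  gdot m1 m2 h (gamma theta) (hatX m1 m2 h e (gamma theta)) (velocity gamma theta).

Lemma pairing_continuous e theta : e * e = 1 -> continuous (pairing e) theta.
Proof.
intros He. apply (continuous_pairing m1 m2 h Hm Hh gamma (velocity gamma)).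
- exact He.
- intros s. apply (gamma_off_segment HOmega Hseg Hgamma).
- apply (gamma_continuous Hgamma).
- apply (gamma_C1 Hgamma).
Qed.

Lemma Upsilon_pairing theta :
  Upsilon m1 m2 h gamma theta = - (pairing 1 theta + pairing (-1) theta).
Proof. unfold Upsilon, pairing, gdot, dot, vadd; cbn [fst snd]. ring. Qed.

Lemma pairing_bounded e : e * e = 1 ->
  exists M, 0 <= M /\ forall theta, thm <= theta <= thp -> Rabs (pairing e theta) <= M.
Proof.
intros He.
destruct (continuity_ab_maj (fun t => Rabs (pairing e t)) thm thp) as [t [H _]]; [lra | |].
- intros c _. apply continuity_pt_filterlim.
  assert (Hc := pairing_continuous e c He).
  change (continuous (fun t => Rabs (pairing e t)) c). cont.
- exists (Rabs (pairing e t)). split; [apply Rabs_pos | exact H].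
Qed.

(** The mean value form is uniform in the fixed end b and needs no continuity of the partial
    derivative: continuity of [pairing] later takes its place. *)
Lemma arc_length_increment1 (k : nat) a a' b :
  (k0 <= k)%nat -> thm <= a <= thp -> thm <= a' <= thp -> thm <= b <= thp ->
  exists xi q, Rmin a a' <= xi <= Rmax a a' /\ Rabs (q + pairing 1 xi) <= eps / 2 /\
    arc_length m1 m2 h gamma (Z.of_nat k) theta0 a' b -
    arc_length m1 m2 h gamma (Z.of_nat k) theta0 a b = q * (a' - a).
Proof.
intros Hk Ha Ha' Hb. destruct Hchoice4 as [_ H4].
set (S := fun s => arc_length m1 m2 h gamma (Z.of_nat k) theta0 s b).
assert (Hin : forall s, Rmin a a' <= s <= Rmax a a' -> thm <= s <= thp).
{ intros s [H1 H2]. split.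
  - apply Rle_trans with (2 := H1). now apply Rmin_glb.
  - apply Rle_trans with (1 := H2). now apply Rmax_lub. }
destruct (MVT_gen S a a' (Derive S)) as [xi [Hxi E]].
- intros s Hs. apply Derive_correct.
  apply (H4 k s b Hk); [apply Hin; lra | exact Hb].
- intros s Hs. apply continuity_pt_filterlim, (ex_derive_continuous S s).
  apply (H4 k s b Hk); [now apply Hin | exact Hb].
- exists xi, (Derive S xi). split; [exact Hxi|]. split; [|exact E].
  destruct (H4 k xi b Hk (Hin xi Hxi) Hb) as (_ & _ & B).
  fold S in B. fold (pairing 1 xi) in B.
  eapply Rle_trans; [|exact B]. rewrite <- (Rplus_0_r (Rabs _)) at 1.
  apply Rplus_le_compat_l, Rabs_pos.
Qed.

Lemma arc_length_increment2 (k : nat) a b b' :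
  (k0 <= k)%nat -> thm <= a <= thp -> thm <= b <= thp -> thm <= b' <= thp ->
  exists xi q, Rmin b b' <= xi <= Rmax b b' /\ Rabs (q + pairing (-1) xi) <= eps / 2 /\
    arc_length m1 m2 h gamma (Z.of_nat k) theta0 a b' -
    arc_length m1 m2 h gamma (Z.of_nat k) theta0 a b = q * (b' - b).
Proof.
intros Hk Ha Hb Hb'. destruct Hchoice4 as [_ H4].
set (S := fun s => arc_length m1 m2 h gamma (Z.of_nat k) theta0 a s).
assert (Hin : forall s, Rmin b b' <= s <= Rmax b b' -> thm <= s <= thp).
{ intros s [H1 H2]. split.
  - apply Rle_trans with (2 := H1). now apply Rmin_glb.
  - apply Rle_trans with (1 := H2). now apply Rmax_lub. }
destruct (MVT_gen S b b' (Derive S)) as [xi [Hxi E]].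
- intros s Hs. apply Derive_correct.
  apply (H4 k a s Hk); [exact Ha | apply Hin; lra].
- intros s Hs. apply continuity_pt_filterlim, (ex_derive_continuous S s).
  apply (H4 k a s Hk); [exact Ha | now apply Hin].
- exists xi, (Derive S xi). split; [exact Hxi|]. split; [|exact E].
  destruct (H4 k a xi Hk Ha (Hin xi Hxi)) as (_ & _ & B).
  fold S in B. fold (pairing (-1) xi) in B.
  eapply Rle_trans; [|exact B]. rewrite <- (Rplus_0_l (Rabs _)) at 1.
  apply Rplus_le_compat_r, Rabs_pos.
Qed.

Lemma arc_length_lipschitz :
  exists K, 0 <= K /\ forall k : nat, (k0 <= k)%nat ->
   (forall a a' b, thm <= a <= thp -> thm <= a' <= thp -> thm <= b <= thp ->
     Rabs (arc_length m1 m2 h gamma (Z.of_nat k) theta0 a b -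
           arc_length m1 m2 h gamma (Z.of_nat k) theta0 a' b) <= K * Rabs (a - a')) /\
   (forall a b b', thm <= a <= thp -> thm <= b <= thp -> thm <= b' <= thp ->
     Rabs (arc_length m1 m2 h gamma (Z.of_nat k) theta0 a b -
           arc_length m1 m2 h gamma (Z.of_nat k) theta0 a b') <= K * Rabs (b - b')).
Proof.
destruct (pairing_bounded 1 ltac:(ring)) as [M1 [HM1 B1]].
destruct (pairing_bounded (-1) ltac:(ring)) as [M2 [HM2 B2]].
(* The sign of eps is not yet known here, hence the absolute value. *)
exists (M1 + M2 + Rabs (eps / 2)).
split; [generalize (Rabs_pos (eps / 2)); lra|].
assert (Hin : forall a b s, thm <= a <= thp -> thm <= b <= thp ->
   Rmin a b <= s <= Rmax a b -> thm <= s <= thp).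
{ intros a b s Ha Hb [H1 H2]. split.
  - apply Rle_trans with (2 := H1). now apply Rmin_glb.
  - apply Rle_trans with (1 := H2). now apply Rmax_lub. }
assert (HA := Rle_abs (eps / 2)).
intros k Hk. split.
- intros a a' b Ha Ha' Hb.
  destruct (arc_length_increment1 k a' a b Hk Ha' Ha Hb) as (xi & q & Hxi & Hq & ->).
  rewrite Rabs_mult. apply Rmult_le_compat_r; [apply Rabs_pos|].
  replace q with (q + pairing 1 xi + - pairing 1 xi) by ring.
  eapply Rle_trans; [apply Rabs_triang|]. rewrite Rabs_Ropp.
  specialize (B1 xi (Hin _ _ _ Ha' Ha Hxi)). lra.
- intros a b b' Ha Hb Hb'.
  destruct (arc_length_increment2 k a b' b Hk Ha Hb' Hb) as (xi & q & Hxi & Hq & ->).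
  rewrite Rabs_mult. apply Rmult_le_compat_r; [apply Rabs_pos|].
  replace q with (q + pairing (-1) xi + - pairing (-1) xi) by ring.
  eapply Rle_trans; [apply Rabs_triang|]. rewrite Rabs_Ropp.
  specialize (B2 xi (Hin _ _ _ Hb' Hb Hxi)). lra.
Qed.

Context (m : nat) (sigma : nat -> nat).
Context (Hsigma : forall j, (j <= m)%nat -> (k0 <= sigma j)%nat).

Definition lengths (j : nat) (a b : R) : R :=
  arc_length m1 m2 h gamma (Z.of_nat (sigma j)) theta0 a b.

Definition minimal (th : nat -> R) : Prop :=
  (forall j, thm <= th j <= thp) /\
  forall th', (forall j, thm <= th' j <= thp) ->
    cyclic_sum lengths m th <= cyclic_sum lengths m th'.

Lemma minimal_exists : exists th, minimal th.
Proof.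
destruct arc_length_lipschitz as [K [HK HL]].
apply (cyclic_sum_minimum lengths m thm thp K); [lra | exact HK | |].
- intros j x x' y Hj. exact (proj1 (HL _ (Hsigma j Hj)) x x' y).
- intros j x y y' Hj. exact (proj2 (HL _ (Hsigma j Hj)) x y y').
Qed.

(* Mean value increments in one variable at a time, instead of derivatives of
   the sum, also cover the case where both ends of one arc move (n = 1). *)
Lemma minimal_not_at th i p e :
  minimal th -> (i <= m)%nat -> 0 < eps ->
  (e = 1 /\ p = thm) \/ (e = -1 /\ p = thp) ->
  e * Upsilon m1 m2 h gamma p <= - (2 * eps) -> th i <> p.
Proof.
intros [Hin Hmin] Hi Heps Hep HU Ep.
(* Each of the two increments loses eps/2 from [choice4] and eps/8 from replacing xi by p, together
   5/4 eps, which is less than the 2 eps that [Upsilon] supplies at p. *)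
destruct (continuous_R_ball (pairing 1) p (eps / 8)) as [r1 [Hr1 K1]];
  [apply pairing_continuous; ring | lra |].
destruct (continuous_R_ball (pairing (-1)) p (eps / 8)) as [r2 [Hr2 K2]];
  [apply pairing_continuous; ring | lra |].
set (s := Rmin (Rmin r1 r2) (thp - thm) / 2).
assert (Q0 : 0 < Rmin (Rmin r1 r2) (thp - thm)) by (repeat apply Rmin_glb_lt; lra).
assert (Q1 := Rmin_l (Rmin r1 r2) (thp - thm)).
assert (Q2 := Rmin_r (Rmin r1 r2) (thp - thm)).
assert (Q3 := Rmin_l r1 r2). assert (Q4 := Rmin_r r1 r2).
assert (Hs : 0 < s < thp - thm) by (unfold s; lra).
assert (Hsr : s < r1 /\ s < r2) by (unfold s; lra).
(* The sign e points from the end p into the interval. *)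
set (t := p + e * s).
assert (Ht : thm <= t <= thp).
{ unfold t. destruct Hep as [[-> ->] | [-> ->]]; lra. }
assert (Hxi : forall xi, Rmin p t <= xi <= Rmax p t -> Rabs (xi - p) <= s).
{ intros xi. unfold t, Rmin, Rmax. destruct (Rle_dec p (p + e * s));
  destruct Hep as [[-> _] | [-> _]]; intros; apply Rabs_le; lra. }
assert (Hq : forall q g g', Rabs (q + g) <= eps / 2 -> Rabs (g - g') < eps / 8 ->
   q * (t - p) <= s * (- (e * g') + eps / 2 + eps / 8)).
{ intros q g g' A1 A2. replace (t - p) with (e * s) by (unfold t; ring).
  apply Rabs_le_between in A1. apply Rabs_def2 in A2.
  replace (q * (e * s)) with (s * (e * q)) by ring.
  apply Rmult_le_compat_l; [lra|].
  destruct Hep as [[-> _] | [-> _]]; lra. }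
assert (Hpin : thm <= p <= thp) by (destruct Hep as [[_ ->] | [_ ->]]; lra).
assert (V := cyclic_minimum_variation lengths m th
  (fun _ => s * (- (e * pairing 1 p) + eps / 2 + eps / 8))
  (fun _ => s * (- (e * pairing (-1) p) + eps / 2 + eps / 8)) i t thm thp Hin Hmin Hi Ht).
cbv beta in V.
assert (F : 0 <= s * (e * Upsilon m1 m2 h gamma p + 5 / 4 * eps)).
{ rewrite Upsilon_pairing.
  replace (s * _) with (s * (- (e * pairing 1 p) + eps / 2 + eps / 8) +
    s * (- (e * pairing (-1) p) + eps / 2 + eps / 8)) by field.
  apply V. intros j Hj. unfold lengths.
  assert (I := update_in thm thp th i t Hin Ht).
  set (L := arc_length m1 m2 h gamma (Z.of_nat (sigma j)) theta0).
  (* The first argument moves while the second already has its new value, then the second moves;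
     this order covers a term in which both arguments are theta_i. *)
  assert (S1 : L (update th i t j) (update th i t (next m j)) - L (th j) (update th i t (next m j))
     <= if Nat.eq_dec j i then s * (- (e * pairing 1 p) + eps / 2 + eps / 8) else 0).
  { unfold update at 1. destruct (Nat.eq_dec j i) as [->|]; [|lra].
    rewrite Ep.
    destruct (arc_length_increment1 (sigma i) p t _ (Hsigma i Hi) Hpin Ht (I (next m i)))
      as (xi & q & X1 & X2 & X3).
    unfold L. rewrite X3. apply (Hq _ _ _ X2). apply K1.
    eapply Rle_lt_trans; [apply Hxi, X1 | lra]. }
  assert (S2 : L (th j) (update th i t (next m j)) - L (th j) (th (next m j))
     <= if Nat.eq_dec (next m j) i then s * (- (e * pairing (-1) p) + eps / 2 + eps / 8) else 0).
  { unfold update. destruct (Nat.eq_dec (next m j) i) as [->|]; [|lra].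
    rewrite Ep.
    destruct (arc_length_increment2 (sigma j) (th j) p t (Hsigma j Hj) (Hin j) Hpin Ht)
      as (xi & q & X1 & X2 & X3).
    unfold L. rewrite X3. apply (Hq _ _ _ X2). apply K2.
    eapply Rle_lt_trans; [apply Hxi, X1 | lra]. }
  lra. }
assert (0 < s * (- (e * Upsilon m1 m2 h gamma p + 5 / 4 * eps)))
  by (apply Rmult_lt_0_compat; lra).
lra.
Qed.

Context (Hex : forall j a b, (j <= m)%nat -> thm <= a <= thp -> thm <= b <= thp ->
  arc_exists m1 m2 h gamma (Z.of_nat (sigma j)) theta0 a b).

Definition arcT (th : nat -> R) (j : nat) : R :=
  arc_time m1 m2 h gamma (Z.of_nat (sigma j)) theta0 (th j) (th (next m j)).
Definition arcX (th : nat -> R) (j : nat) : R -> pt :=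
  arc_curve m1 m2 h gamma (Z.of_nat (sigma j)) theta0 (th j) (th (next m j)).

(** Moving theta_i changes only the arcs that meet there. Their first-order bounds add up to the
    jump of the velocity paired with the displacement, and by minimality this plus a quadratic term
    is nonnegative. *)
Lemma minimal_momentum th i :
  minimal th -> (i <= m)%nat -> thm < th i < thp ->
  dot (vsub (velocity (arcX th (prev m i)) (arcT th (prev m i))) (velocity (arcX th i) 0))
      (velocity gamma (th i)) = 0.
Proof.
intros [Hin Hmin] Hi Hint.
assert (FV : forall j, (j <= m)%nat -> exists C r, 0 <= C /\ 0 < r /\ forall a' b',
    thm <= a' <= thp -> thm <= b' <= thp -> Rabs (a' - th j) < r -> Rabs (b' - th (next m j)) < r ->
    lengths j a' b' <= lengths j (th j) (th (next m j))
    + (dot (velocity (arcX th j) (arcT th j)) (vsub (gamma b') (gamma (th (next m j))))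
       - dot (velocity (arcX th j) 0) (vsub (gamma a') (gamma (th j))))
    + C * (dot (vsub (gamma a') (gamma (th j))) (vsub (gamma a') (gamma (th j))) +
           dot (vsub (gamma b') (gamma (th (next m j)))) (vsub (gamma b') (gamma (th (next m j)))))).
{ intros j Hj. unfold lengths.
  exact (first_variation HOmega Hseg Hgamma m1 m2 h Hm Hh thm thp theta0 Hoff0
    (Z.of_nat (sigma j)) (th j) (th (next m j)) (arcT th j) (arcX th j)
    (fun a b => Hex j a b Hj) (Hin j) (Hin (next m j))
    (arc_spec m1 m2 h theta0 _ _ _ (Hex j _ _ Hj (Hin j) (Hin (next m j))))). }
destruct (FV i Hi) as (Ci & ri & HCi & Hri & Fi).
destruct (FV (prev m i) (prev_le m i Hi)) as (Cp & rp & HCp & Hrp & Fp).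
assert (Enp : next m (prev m i) = i).
{ apply next_eq_iff; [exact Hi | now apply prev_le | reflexivity]. }
set (r := Rmin (Rmin ri rp) (Rmin (th i - thm) (thp - th i))).
assert (Q1 := Rmin_l (Rmin ri rp) (Rmin (th i - thm) (thp - th i))).
assert (Q2 := Rmin_r (Rmin ri rp) (Rmin (th i - thm) (thp - th i))). fold r in Q1, Q2.
assert (Q3 := Rmin_l ri rp). assert (Q4 := Rmin_r ri rp).
assert (Q5 := Rmin_l (th i - thm) (thp - th i)). assert (Q6 := Rmin_r (th i - thm) (thp - th i)).
(* Both ends are charged with [Ci + Cp], a constant valid for either arc and also for a single arc
   with both ends moving. *)
apply (critical_momentum gamma (th i) _ (2 * (Ci + Cp)) r).
{ apply (gamma_C1 Hgamma). }
{ repeat apply Rmin_glb_lt; lra. }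
intros t Ht.
assert (Htin : thm <= t <= thp) by (apply Rabs_def2 in Ht; lra).
set (D := vsub (gamma t) (gamma (th i))).
assert (HD := dot_ge0 D).
assert (V := cyclic_minimum_variation lengths m th
  (fun j => - dot (velocity (arcX th j) 0) D + (Ci + Cp) * dot D D)
  (fun j => dot (velocity (arcX th j) (arcT th j)) D + (Ci + Cp) * dot D D)
  i t thm thp Hin Hmin Hi Htin).
cbv beta in V.
replace (dot (vsub _ _) D) with
  (dot (velocity (arcX th (prev m i)) (arcT th (prev m i))) D - dot (velocity (arcX th i) 0) D)
  by (unfold dot, vsub; cbn [fst snd]; ring).
assert (Vc : forall j, (j <= m)%nat ->
  lengths j (update th i t j) (update th i t (next m j)) <=
  lengths j (th j) (th (next m j)) +
  (if Nat.eq_dec j i then - dot (velocity (arcX th j) 0) D + (Ci + Cp) * dot D D else 0) +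
  (if Nat.eq_dec (next m j) i then dot (velocity (arcX th j) (arcT th j)) D + (Ci + Cp) * dot D D
   else 0)); [|specialize (V Vc); lra].
intros j Hj.
assert (I := update_in thm thp th i t Hin Htin).
assert (Hnear : forall l r', r <= r' -> 0 < r' -> Rabs (update th i t l - th l) < r').
{ intros l r' Hr' Hr0. unfold update. destruct (Nat.eq_dec l i) as [->|]; [lra|].
  rewrite Rminus_diag, Rabs_R0. exact Hr0. }
assert (HDl : forall l, vsub (gamma (update th i t l)) (gamma (th l)) =
   if Nat.eq_dec l i then D else (0, 0)).
{ intros l. unfold update. destruct (Nat.eq_dec l i) as [->|]; [reflexivity|].
  apply pt_ext; unfold vsub; cbn [fst snd]; ring. }
assert (Z1 : forall u, dot u (0, 0) = 0) by (intros u; unfold dot; cbn [fst snd]; ring).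
assert (Cmp : forall C r', 0 <= C <= Ci + Cp -> r <= r' -> 0 < r' ->
  (forall a' b',
    thm <= a' <= thp -> thm <= b' <= thp -> Rabs (a' - th j) < r' -> Rabs (b' - th (next m j)) < r' ->
    lengths j a' b' <= lengths j (th j) (th (next m j))
    + (dot (velocity (arcX th j) (arcT th j)) (vsub (gamma b') (gamma (th (next m j))))
       - dot (velocity (arcX th j) 0) (vsub (gamma a') (gamma (th j))))
    + C * (dot (vsub (gamma a') (gamma (th j))) (vsub (gamma a') (gamma (th j))) +
           dot (vsub (gamma b') (gamma (th (next m j)))) (vsub (gamma b') (gamma (th (next m j)))))) ->
  lengths j (update th i t j) (update th i t (next m j)) <=
  lengths j (th j) (th (next m j)) +
  (if Nat.eq_dec j i then - dot (velocity (arcX th j) 0) D + (Ci + Cp) * dot D D else 0) +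
  (if Nat.eq_dec (next m j) i then dot (velocity (arcX th j) (arcT th j)) D + (Ci + Cp) * dot D D
   else 0)).
{ intros C r' HC Hr' Hr0 F.
  specialize (F _ _ (I j) (I (next m j)) (Hnear j r' Hr' Hr0) (Hnear (next m j) r' Hr' Hr0)).
  rewrite !HDl in F.
  assert (C * dot D D <= (Ci + Cp) * dot D D) by (apply Rmult_le_compat_r; lra).
  destruct (Nat.eq_dec j i); destruct (Nat.eq_dec (next m j) i); rewrite ?Z1 in F; lra. }
(* The bound of arc i serves even when that arc also ends at theta_i; the bound of the preceding arc
   is used only when it is a different one. *)
destruct (Nat.eq_dec j i) as [Ej|Nj].
- rewrite <- Ej in Fi.
  generalize (Cmp Ci ri ltac:(lra) ltac:(lra) Hri Fi).
  destruct (Nat.eq_dec j i); [auto | contradiction].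
- destruct (Nat.eq_dec (next m j) i) as [En|Nn].
  + assert (Ejp : j = prev m i) by now apply next_eq_iff.
    rewrite <- Ejp in Fp.
    generalize (Cmp Cp rp ltac:(lra) ltac:(lra) Hrp Fp).
    destruct (Nat.eq_dec j i); destruct (Nat.eq_dec (next m j) i); tauto.
  + rewrite !update_neq by assumption. lra.
Qed.

End Periodic.

Theorem corollary1
    (m1 m2 h : R) (Omega : pt -> Prop) (gamma : R -> pt)
    (Hm : 0 < m2 <= m1) (Hh : 0 <= h)
    (HOmega : bounded_domain Omega)
    (Hseg : forall x, on_segment x -> Omega x)
    (Hgamma : boundary_parametrisation Omega gamma)
    (Hellipse : ~ is_focal_ellipse (boundary Omega))
    (delta0 : R) (k1 : nat)
    (Hchoice1 : choice1 m1 m2 h Omega gamma delta0 k1)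
    (delta thm thp theta0 : R)
    (Hdelta : 0 < delta < delta0)
    (Hstar : star gamma delta thm thp)
    (Htheta0 : off_arc thm thp theta0)
    (eps : R)
    (Heps : 2 * eps = Rmin (Rabs (Upsilon m1 m2 h gamma thm))
                           (Rabs (Upsilon m1 m2 h gamma thp)))
    (k0 : nat)
    (Hchoice4 : choice4 m1 m2 h gamma thm thp theta0 eps k1 k0) :
  forall (n : nat) (sigma : nat -> nat),
    (1 <= n)%nat -> (forall i, (i < n)%nat -> (k0 <= sigma i)%nat) ->
    exists (p : nat -> pt * pt) (theta : nat -> R),
      (p n = p 0%nat /\
       forall i, (i < n)%nat ->
         billiard_map m1 m2 h Omega gamma (p i) (p (S i))) /\
      theta n = theta 0%nat /\
      forall i, (i < n)%nat ->
        thm <= theta i <= thp /\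
        fst (p i) = gamma (theta i) /\
        arc_exists m1 m2 h gamma (Z.of_nat (sigma i)) theta0
          (theta i) (theta (S i)) /\
        billiard_step m1 m2 h Omega gamma (p i)
          (arc_time m1 m2 h gamma (Z.of_nat (sigma i)) theta0
             (theta i) (theta (S i)))
          (arc_curve m1 m2 h gamma (Z.of_nat (sigma i)) theta0
             (theta i) (theta (S i)))
          (p (S i)).
Proof.
intros n sigma Hn Hsig.
assert (HT : thm < thp) by apply Hstar.
set (m := Nat.pred n).
assert (Hsigma : forall j, (j <= m)%nat -> (k0 <= sigma j)%nat)
  by (intros j Hj; apply Hsig; unfold m in Hj; lia).
assert (Hk1 : forall j, (j <= m)%nat -> (Z.of_nat k1 <= Z.abs (Z.of_nat (sigma j)))%Z).
{ intros j Hj. destruct Hchoice4 as [H _]. specialize (Hsigma j Hj). lia. }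
assert (Harc : forall j a b, (j <= m)%nat -> thm <= a <= thp -> thm <= b <= thp ->
  arc_exists m1 m2 h gamma (Z.of_nat (sigma j)) theta0 a b /\
  arc_inside Omega gamma a b
    (arc_time m1 m2 h gamma (Z.of_nat (sigma j)) theta0 a b)
    (arc_curve m1 m2 h gamma (Z.of_nat (sigma j)) theta0 a b)).
{ intros j a b Hj Ha Hb. destruct Hchoice1 as (_ & _ & H1).
  exact (H1 delta thm thp theta0 Hdelta Hstar Htheta0 a b _ Ha Hb (Hk1 j Hj)). }
assert (Hex : forall j a b, (j <= m)%nat -> thm <= a <= thp -> thm <= b <= thp ->
  arc_exists m1 m2 h gamma (Z.of_nat (sigma j)) theta0 a b)
  by (intros j a b Hj Ha Hb; exact (proj1 (Harc j a b Hj Ha Hb))).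
destruct Hstar as (_ & [Hfm Hfp] & _ & _).
(* The signs of f' at the ends pass to [Upsilon]; this makes eps positive and yields the bounds by 2
   eps that keep the minimiser in the interior. *)
destruct (Upsilon_derivative m1 m2 h Hm Hh gamma thm (proj1 (gamma_C1 Hgamma thm))
  (gamma_off_segment HOmega Hseg Hgamma thm)) as [Pm [HPm EPm]].
destruct (Upsilon_derivative m1 m2 h Hm Hh gamma thp (proj1 (gamma_C1 Hgamma thp))
  (gamma_off_segment HOmega Hseg Hgamma thp)) as [Pp [HPp EPp]].
assert (Hum : Upsilon m1 m2 h gamma thm < 0) by (rewrite EPm; nra).
assert (Hup : 0 < Upsilon m1 m2 h gamma thp) by (rewrite EPp; nra).
rewrite (Rabs_left _ Hum), (Rabs_pos_eq _ (Rlt_le _ _ Hup)) in Heps.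
assert (L1 := Rmin_l (- Upsilon m1 m2 h gamma thm) (Upsilon m1 m2 h gamma thp)).
assert (L2 := Rmin_r (- Upsilon m1 m2 h gamma thm) (Upsilon m1 m2 h gamma thp)).
assert (Heps0 : 0 < eps).
{ assert (0 < 2 * eps); [|lra]. rewrite Heps. apply Rmin_glb_lt; lra. }
rewrite <- Heps in L1, L2.
destruct (minimal_exists HOmega Hseg Hgamma m1 m2 h Hm Hh thm thp theta0 HT eps k1 k0
  Hchoice4 m sigma Hsigma) as [th Hmin].
assert (Hin : forall j, thm <= th j <= thp) by apply Hmin.
assert (Hint : forall i, (i <= m)%nat -> thm < th i < thp).
{ intros i Hi.
  assert (Nm : th i <> thm).
  { apply (minimal_not_at HOmega Hseg Hgamma m1 m2 h Hm Hh thm thp theta0 HT eps k1 k0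
      Hchoice4 m sigma Hsigma th i thm 1 Hmin Hi Heps0); [now left | lra]. }
  assert (Np : th i <> thp).
  { apply (minimal_not_at HOmega Hseg Hgamma m1 m2 h Hm Hh thm thp theta0 HT eps k1 k0
      Hchoice4 m sigma Hsigma th i thp (-1) Hmin Hi Heps0); [now right | lra]. }
  specialize (Hin i). lra. }
set (T := arcT m1 m2 h theta0 m sigma (gamma := gamma) th).
set (x := arcX m1 m2 h theta0 m sigma (gamma := gamma) th).
(* Reindexed by arcs: the criticality condition at vertex [next m i] concerns the end of arc i,
   because [prev] undoes [next]. *)
assert (Hmom : forall i, (i <= m)%nat ->
  dot (vsub (velocity (x i) (T i)) (velocity (x (next m i)) 0)) (velocity gamma (th (next m i))) = 0).
{ intros i Hi. rewrite <- (prev_next m i Hi) at 1 2.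
  exact (minimal_momentum HOmega Hseg Hgamma m1 m2 h Hm Hh thm thp theta0 Htheta0
    m sigma Hex th (next m i) Hmin (next_le m i Hi) (Hint _ (next_le m i Hi))). }
assert (Hspec : forall i, (i <= m)%nat ->
  is_arc m1 m2 h gamma (Z.of_nat (sigma i)) theta0 (th i) (th (next m i)) (T i) (x i)).
{ intros i Hi. apply arc_spec. now apply Hex. }
assert (Harc' : forall i, (i <= m)%nat ->
  0 < T i /\ energy_trajectory m1 m2 h (x i) 0 (T i) /\ x i 0 = gamma (th i) /\
  x i (T i) = gamma (th (next m i)) /\
  arc_inside Omega gamma (th i) (th (next m i)) (T i) (x i)).
{ intros i Hi. destruct (Hspec i Hi) as [[(A1 & _ & _ & A2 & A3 & _) _] A4].
  repeat split; try assumption; try apply A4; try assumption;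
    apply (Harc i (th i) (th (next m i)) Hi (Hin i) (Hin (next m i))); assumption. }
assert (Hdir : forall i, (i <= m)%nat ->
  0 < det (velocity gamma (th i)) (velocity (x i) 0) /\
  det (velocity gamma (th (next m i))) (velocity (x i) (T i)) < 0).
{ intros i Hi. destruct (Harc' i Hi) as (A1 & A2 & A3 & A4 & A5).
  apply (arc_inside_directions HOmega Hseg Hgamma); try assumption; apply A2; lra. }
assert (Hen : forall i, (i <= m)%nat ->
  energy m1 m2 (gamma (th i)) (velocity (x i) 0) = h /\
  energy m1 m2 (gamma (th (next m i))) (velocity (x i) (T i)) = h).
{ intros i Hi. destruct (Harc' i Hi) as (A1 & A2 & A3 & A4 & A5).
  rewrite <- A3, <- A4. split; apply A2; lra. }
assert (Hrefl : forall i, (i <= m)%nat ->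
  velocity (x (next m i)) 0 = reflect (velocity gamma (th (next m i))) (velocity (x i) (T i))).
{ intros i Hi. assert (Hni := next_le m i Hi). apply reflect_characterised.
  - apply (dot_velocity_pos Hgamma).
  - destruct (Hen i Hi) as [_ E1]. destruct (Hen _ Hni) as [E2 _].
    unfold energy in E1, E2. lra.
  - now apply Hmom.
  - now apply Hdir.
  - now apply Hdir. }
(* Index n is identified with 0, so that the orbit closes up by construction and the successor of i
   becomes [next m i], also for n = 1. *)
set (idx := fun i => if Nat.eq_dec i n then 0%nat else i).
assert (Hidx : forall i, (i < n)%nat -> idx i = i /\ idx (S i) = next m i /\ (i <= m)%nat).
{ intros i Hi. unfold idx, next, m.
  destruct (Nat.eq_dec i n); destruct (Nat.eq_dec (S i) n);
    destruct (Nat.eq_dec i (Nat.pred n)); repeat split; lia. }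
assert (Hidxn : idx n = idx 0%nat).
{ unfold idx. destruct (Nat.eq_dec n n); destruct (Nat.eq_dec 0 n); lia. }
set (p := fun i => (gamma (th (idx i)), velocity (x (idx i)) 0)).
assert (Hphase : forall j, (j <= m)%nat ->
  phase_point m1 m2 h Omega gamma (gamma (th j), velocity (x j) 0)).
{ intros j Hj. exists (th j). cbn [fst snd]. split; [reflexivity|]. split.
  - apply (inward_left HOmega Hseg Hgamma). now apply Hdir.
  - now apply Hen. }
assert (Hstep : forall i, (i < n)%nat ->
  billiard_step m1 m2 h Omega gamma (p i) (T i) (x i) (p (S i))).
{ intros i Hi. destruct (Hidx i Hi) as (I1 & I2 & Him). unfold p. rewrite I1, I2.
  destruct (Harc' i Him) as (A1 & A2 & A3 & A4 & _ & A5 & A6 & A7).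
  repeat (split; [first [assumption | reflexivity] |]).
  exists (th (next m i)). cbn [fst snd]. split; [reflexivity|]. split; [exact A7|].
  now apply Hrefl. }
exists p, (fun i => th (idx i)). split; [split|split].
- unfold p. now rewrite Hidxn.
- intros i Hi. destruct (Hidx i Hi) as (I1 & I2 & Him). split; [|split].
  + unfold p. rewrite I1. now apply Hphase.
  + unfold p. rewrite I2. now apply Hphase, next_le.
  + exists (T i), (x i). now apply Hstep.
- now rewrite Hidxn.
- intros i Hi. destruct (Hidx i Hi) as (I1 & I2 & Him).
  assert (St := Hstep i Hi).
  rewrite I1, I2. split; [apply Hin|]. split; [unfold p; now rewrite I1|].
  split; [now apply Hex | exact St].
Qed.
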